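(* Let $d,n\ge 1$ and let $f$ be a rational $\mathbb{C}^{n\times n}$-valued function of $d$ complex variables. Then $f\in\mathcal{B}_d^{n\times n}$ if and only if all of the following hold: $f$ belongs to the Herglotz--Agler class $\mathcal{HA}(\Pi^d,\mathbb{C}^n)$; $f$ is homogeneous of degree one, i.e. $f(\lambda z)=\lambda f(z)$ for every $\lambda\in\mathbb{C}\setminus\{0\}$ (as rational functions of $z$); and $f$ is Cayley inner on $\Pi^d$.
   Context: $\Pi^d=\{z\in\mathbb{C}^d:\operatorname{Re} z_k>0,\ k=1,\dots,d\}$ and $\mathbb{D}^d=\{\zeta\in\mathbb{C}^d:|\zeta_k|<1,\ k=1,\dots,d\}$. A matrix-valued function is rational if all its entries are quotients of polynomials; rational functions agreeing on a nonempty open set are identified. Bessmertnyĭ class: $\mathcal{B}_d^{n\times n}$ is the set of rational $\mathbb{C}^{n\times n}$-valued functions $f$ for which there exist $m\ge 0$ and positive semidefinite Hermitian matrices $A_1,\dots,A_d\in\mathbb{C}^{(n+m)\times(n+m)}$ such that, writing $A(z)=z_1A_1+\cdots+z_dA_d=\begin{bmatrix} A_{11}(z) & A_{12}(z) \\ A_{21}(z) & A_{22}(z) \end{bmatrix}$ with $A_{11}(z)$ of size $n\times n$ and $A_{22}(z)$ of size $m\times m$, $\det A_{22}\not\equiv 0$ and $f(z)=A_{11}(z)-A_{12}(z)A_{22}(z)^{-1}A_{21}(z)$. Herglotz--Agler class over $\Pi^d$: $\mathcal{HA}(\Pi^d,\mathbb{C}^n)$ consists of the holomorphic functions $f:\Pi^d\to\mathbb{C}^{n\times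 n}$ such that $f(R)+f(R)^*\ge 0$ for every $d$-tuple $R=(R_1,\dots,R_d)$ of commuting bounded strictly accretive operators on a common Hilbert space $\mathcal{K}$ (strictly accretive: there is a real $s>0$ with $R_k+R_k^*\ge sI_{\mathcal{K}}$ for all $k$). Here $f(R)$ is defined as follows: put $T_k=(R_k-I)(R_k+I)^{-1}$ (a commuting $d$-tuple of strict contractions), let $F(\zeta)=f\big(\frac{1+\zeta_1}{1-\zeta_1},\dots,\frac{1+\zeta_d}{1-\zeta_d}\big)=\sum_{t\in\mathbb{Z}_+^d}\widehat F_t\zeta^t$ on $\mathbb{D}^d$, and set $f(R)=\sum_t\widehat F_t\otimes T^t$, where $T^t=T_1^{t_1}\cdots T_d^{t_d}$. Cayley inner on $\Pi^d$: $f$ is holomorphic on $\Pi^d$ with $f(z)+f(z)^*\ge 0$ there, and its nontangential boundary values satisfy $f(t)+f(t)^*=0$ for almost every $t\in(i\mathbb{R})^d$. *)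

(* Defs.v *)
From mathcomp Require Import all_boot all_order all_algebra.
From mathcomp Require Import finmap fraction sesquilinear complex.
(* The notations of mpoly clash with those of MathComp-Analysis. *)
From mathcomp Require Import -(notations) mpoly.
From mathcomp Require Import all_classical all_reals all_analysis.
From mathcomp Require Import summability.

Set Implicit Arguments.
Unset Strict Implicit.
Unset Printing Implicit Defensive.
Import Order.TTheory GRing.Theory Num.Theory.
Import numFieldNormedType.Exports.
Local Open Scope classical_set_scope.
Local Open Scope ring_scope.

(* R[i] seen as an abstract numClosedFieldType, which MathComp-Analysis equips
   with the topology and the norm of C; R[i] itself has none. *)
Definition cplx (R : realType) : numClosedFieldType := R[i].

(* A rational function of d
   complex variables is an element of the field of fractions C(z_1,...,z_d):
   this is the identification of rational functions agreeing on a nonempty open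
   set.  A rational matrix-valued function is a matrix over this field. *)
Definition ratfun (R : realType) (d : nat) : fieldType :=
  {fraction (mpoly d (cplx R))}.

Section Matrices.
Variable R : realType.
Local Notation C := (cplx R).

Definition adjmx (p q : nat) (A : 'M[C]_(p, q)) : 'M[C]_(q, p) :=
  (map_mx Num.conj A)^T.

(* On C, 0 <= c means that c is real and nonnegative. *)
Definition psdmx (p : nat) (A : 'M[C]_p) : Prop :=
  A \is hermsymmx /\ forall x : 'cV[C]_p, 0 <= (adjmx x *m A *m x) 0 0.

End Matrices.

Section RationalFunctions.
Variables (R : realType) (d : nat).
Local Notation C := (cplx R).
Local Notation poly_d := (mpoly d C).
Local Notation rat_d := (ratfun R d).

Definition rconst (c : C) : rat_d := tofrac (mpolyC d c).

Definition rvar (k : 'I_d) : rat_d := tofrac (mpolyX C (mnm1 k)).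

(* p(lambda z) *)
Definition dilate (lambda : C) (p : poly_d) : poly_d :=
  comp_mpoly [tuple lambda *: mpolyX C (mnm1 k) | k < d] p.

(* The entry p / q of f becomes p(lambda z) / q(lambda z) in f(lambda z); this
   does not depend on the chosen quotient. *)
Definition homogeneous1 (n : nat) (f : 'M[rat_d]_n) : Prop :=
  forall (lambda : C), lambda != 0 ->
  forall (i j : 'I_n) (p q : poly_d), q != 0 ->
    f i j = tofrac p / tofrac q ->
    tofrac (dilate lambda p) / tofrac (dilate lambda q)
      = rconst lambda * f i j.

Definition pencil (r : nat) (A : 'I_d -> 'M[C]_r) : 'M[rat_d]_r :=
  \sum_(k < d) rvar k *: map_mx rconst (A k).

Definition bessmertnyi (n : nat) (f : 'M[rat_d]_n) : Prop :=
  exists (m : nat) (A : 'I_d -> 'M[C]_(n + m)),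
    [/\ forall k, psdmx (A k),
        \det (drsubmx (pencil A)) != 0
      & f = ulsubmx (pencil A) -
            ursubmx (pencil A) *m invmx (drsubmx (pencil A))
              *m dlsubmx (pencil A)].

End RationalFunctions.

Section Domains.
Variables (R : realType) (d n : nat).
Local Notation C := (cplx R).

Definition polyhalfplane : set 'rV[C]_d :=
  [set z | forall k, 0 < complex.Re (z 0 k)].

Definition polydisk : set 'rV[C]_d := [set zeta | forall k, `|zeta 0 k| < 1].

(* [differentiable] is Frechet differentiability of a map between normed spaces
   over the field C, hence complex differentiability. *)
Definition holomorphic_on (D : set 'rV[C]_d) (g : 'rV[C]_d -> 'M[C]_n) : Prop :=
  forall z, D z -> differentiable g z.

(* The values of g on the polyhalfplane are those of the rational function f
   wherever f can be evaluated.  A continuous g is determined by f there, since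
   the zero set of a nonzero polynomial has empty interior. *)
Definition represents (f : 'M[ratfun R d]_n) (g : 'rV[C]_d -> 'M[C]_n) : Prop :=
  forall z, polyhalfplane z ->
  forall (i j : 'I_n) (p q : mpoly d C),
    f i j = tofrac p / tofrac q -> meval (fun k => z 0 k) q != 0 ->
    g z i j = meval (fun k => z 0 k) p / meval (fun k => z 0 k) q.

End Domains.

Section HerglotzAgler.
Variables (R : realType) (d n : nat).
Local Notation C := (cplx R).
Local Notation multiindex := {ffun 'I_d -> nat}.

Definition cayley_point (zeta : 'rV[C]_d) : 'rV[C]_d :=
  \row_k ((1 + zeta 0 k) / (1 - zeta 0 k)).

(* [partial_sum u @ totally --> l]: the unordered sum of the family u is l. *)
Definition power_series_on_polydisk
    (F : 'rV[C]_d -> 'M[C]_n) (Fhat : multiindex -> 'M[C]_n) : Prop :=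
  forall zeta, polydisk zeta ->
    partial_sum (fun t : multiindex => (\prod_k zeta 0 k ^+ t k) *: Fhat t)
      @ totally --> F zeta.

Section Operators.
(* A Hilbert space: a complete normed space whose norm comes from an inner
   product (see [hilbert_norm]), linear in its first argument. *)
Variables (K : completeNormedModType C) (ip : {dot K for Num.conj}).

Definition hilbert_norm : Prop := forall x : K, ip x x = `|x| ^+ 2.

Definition bounded_op (A : K -> K) : Prop :=
  exists M : R, forall x, `|A x| <= (M%:C)%C * `|x|.

(* A + A^* >= s I, read through <(A + A^* )x, x> = <A x, x> + <x, A x>. *)
Definition strictly_accretive (A : K -> K) : Prop :=
  exists2 s : R, 0 < s &
    forall x, (s%:C)%C * ip x x <= ip (A x) x + ip x (A x).

(* (A - I)(A + I)^-1 *)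
Definition cayley_op (A : K -> K) : K -> K := fun x =>
  let y := 'pinv_(fun=> 0) [set: K] (fun u => A u + u) x in A y - y.

Definition op_monomial (T : 'I_d -> K -> K) (t : multiindex) : K -> K :=
  \big[(fun g h : K -> K => g \o h)/idfun]_(k < d) iter (t k) (T k).

(* C^n (x) K is identified with K^n, e_i (x) x being the family equal to x at i
   and 0 elsewhere; its Hilbert norm and inner product are as follows. *)
Definition tens_norm (h : 'I_n -> K) : C := sqrtC (\sum_i `|h i| ^+ 2).

Definition tens_ip (h h' : 'I_n -> K) : C := \sum_i ip (h i) (h' i).

(* M (x) T *)
Definition tens_op (M : 'M[C]_n) (T : K -> K) (h : 'I_n -> K) : 'I_n -> K :=
  fun i => \sum_j M i j *: T (h j).

(* S is the unordered sum of Fhat_t (x) T^t in operator norm. *)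
Definition op_series_sum (Fhat : multiindex -> 'M[C]_n) (T : 'I_d -> K -> K)
    (S : ('I_n -> K) -> ('I_n -> K)) : Prop :=
  forall e : R, 0 < e -> \forall J \near totally, forall h,
    tens_norm
      (partial_sum (fun t => tens_op (Fhat t) (op_monomial T t) h) J - S h)
      <= (e%:C)%C * tens_norm h.

(* S = g(A) *)
Definition functional_calculus (g : 'rV[C]_d -> 'M[C]_n) (A : 'I_d -> K -> K)
    (S : ('I_n -> K) -> ('I_n -> K)) : Prop :=
  exists2 Fhat, power_series_on_polydisk (g \o cayley_point) Fhat &
    op_series_sum Fhat (fun k => cayley_op (A k)) S.

Definition accretive_tens (S : ('I_n -> K) -> ('I_n -> K)) : Prop :=
  forall h, 0 <= tens_ip (S h) h + tens_ip h (S h).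

End Operators.

Definition herglotz_agler (g : 'rV[C]_d -> 'M[C]_n) : Prop :=
  holomorphic_on (@polyhalfplane R d) g /\
  forall (K : completeNormedModType C) (ip : {dot K for Num.conj}),
    hilbert_norm ip ->
  forall A : 'I_d -> {linear K -> K},
    (forall k, bounded_op (A k)) ->
    (forall k l x, A k (A l x) = A l (A k x)) ->
    (forall k, strictly_accretive ip (A k)) ->
  exists2 S, functional_calculus g (fun k => A k : K -> K) S &
    accretive_tens ip S.

End HerglotzAgler.

Section CayleyInner.
Variables (R : realType) (d n : nat).
Local Notation C := (cplx R).

(* Lebesgue null sets of R^d: for every e > 0, there is a cover by countably
   many boxes of total volume at most e. *)
Definition null_set (E : set 'rV[R]_d) : Prop :=
  forall e : R, 0 < e -> exists a b : nat -> 'rV[R]_d,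
    [/\ forall j k, a j 0 k <= b j 0 k,
        E `<=` \bigcup_j [set x | forall k, a j 0 k <= x 0 k <= b j 0 k]
      & forall N, \sum_(j < N) \prod_(k < d) (b j 0 k - a j 0 k) <= e].

(* (i R)^d is parametrized by R^d. *)
Definition imag_point (t : 'rV[R]_d) : 'rV[C]_d :=
  \row_k (0 +i* t 0 k)%C.

(* Product of Stolz sectors at a boundary point. *)
Definition stolz (alpha : R) (t : 'rV[R]_d) : set 'rV[C]_d :=
  [set z | polyhalfplane z /\ forall k,
     `|z 0 k - imag_point t 0 k| <= ((alpha * complex.Re (z 0 k))%:C)%C].

Definition nontangential_limit (g : 'rV[C]_d -> 'M[C]_n) (t : 'rV[R]_d)
    (L : 'M[C]_n) : Prop :=
  forall alpha : R, 1 < alpha ->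
    g @ within (stolz alpha t) (nbhs (imag_point t)) --> L.

Definition cayley_inner (g : 'rV[C]_d -> 'M[C]_n) : Prop :=
  [/\ holomorphic_on (@polyhalfplane R d) g,
      forall z, polyhalfplane z -> psdmx (g z + adjmx (g z))
    & null_set [set t : 'rV[R]_d |
        ~ exists2 L, nontangential_limit g t L & L + adjmx L = 0]].

End CayleyInner.

(* A rational function has a property of functions on the polyhalfplane when it
   is represented there by a function with this property. *)
Definition rat_herglotz_agler (R : realType) (d n : nat)
    (f : 'M[ratfun R d]_n) : Prop :=
  exists2 g, represents f g & herglotz_agler g.

Definition rat_cayley_inner (R : realType) (d n : nat)
    (f : 'M[ratfun R d]_n) : Prop :=
  exists2 g, represents f g & cayley_inner g.

(* Main.v *)
(* A(z) has nonnegative real part on the polyhalfplane, and so has its Schur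
   complement f(z).  Factoring A_k = G_k^* G_k and substituting the Cayley
   transform, f becomes F(zeta) = 2 b^* (1 + U Z(zeta))^-1 b - b^* b with U
   unitary and Z(zeta) diagonal with entries among the zeta_k.  The power series
   of F can then be summed at every commuting tuple T of strict contractions,
   and F(T) has nonnegative real part because U Z(T) is a contraction.  The
   boundary values are skew-adjoint off the set of t with det A_22(i t) = 0,
   which meets every coordinatewise increasing chain in at most m points and is
   therefore null.

   Conversely write f = P / p with polynomials, transplanted to the polydisk.  By
   the boundary condition the Hermitian kernel conj(p(w)) P(z) + P(w)^* p(z)
   vanishes on the torus, so its coefficient matrix H has trace 0.  H is a sum of
   terms K_k - S_k K_k S_k^* with K_k >= 0 and S_k the nilpotent shift in the
   variable zeta_k.  Otherwise Farkas' lemma gives a Hilbert norm on the finite-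
   dimensional space of coefficients for which the S_k are strict contractions,
   and the Herglotz-Agler inequality at this tuple contradicts the separation.  The vanishing trace removes the top
   coefficients of each K_k, which makes the decomposition a polynomial identity
     conj(p(w)) P(z) + P(w)^* p(z) = sum_k (1 - zeta_k conj(omega_k)) K_k(z, w),
   or sum_k (z_k + conj(w_k)) K_k(z, w) on the polyhalfplane.  By homogeneity of
   f its lowest-order part in z and in w separately reads
     f(z) = sum_k z_k Phi_k(w)^* Phi_k(z),
   and a basis of the span of the columns of Phi(w) - Phi(w0) turns this into the
   Schur complement of a positive semidefinite pencil. *)
Require Import Defs.
From HB Require Import structures.
From mathcomp Require Import all_boot all_order all_algebra.
From mathcomp Require Import finmap fraction sesquilinear spectral complex.
From mathcomp Require Import -(notations) mpoly.
From mathcomp Require Import all_classical all_reals all_analysis.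
From mathcomp Require Import summability.
From mathcomp Require Import ring lra zify.

Set Implicit Arguments.
Unset Strict Implicit.
Unset Printing Implicit Defensive.
Import Order.TTheory GRing.Theory Num.Theory.
Import numFieldNormedType.Exports.
Local Open Scope classical_set_scope.
Local Open Scope ring_scope.

(** * Adjoints and positive semidefinite matrices *)

(** The Farkas argument must end in an operator tuple to which the Herglotz-Agler hypothesis
    applies. The image of the cone of positive tuples is closed because a diagonal weight W on the
    coefficient space satisfies W - S_k^* W S_k >= 1, so that the traces of the K_k are controlled
    by a linear functional of the image. The separating Q satisfies only Q - S_k^* Q S_k >= 0;
    adding a small multiple of W makes this strict without losing the separation, and nilpotency of
    S_k then forces Q to be positive definite. Nilpotency also turns every power series at the tuple
    into a finite sum, whose action on the coefficients of p is read off from p f = P. In the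
    homogenization, the diagonal of the kernel shows that each factor of K_k vanishes at 0 at least
    to the order of p; only then may lowest-order terms be compared separately in two dilation
    parameters. Finally, a rational function has prescribed values only where a denominator is
    nonzero; the denominator is squared so that p f = P holds on the whole polyhalfplane. *)

Section Adjoint.
Variable R : realType.
Local Notation C := (cplx R).

Lemma adjmxE p q (A : 'M[C]_(p, q)) i j : adjmx A i j = (A j i)^*.
Proof. by rewrite !mxE. Qed.

Lemma adjmxK p q (A : 'M[C]_(p, q)) : adjmx (adjmx A) = A.
Proof. by apply/matrixP => i j; rewrite !adjmxE conjCK. Qed.

Lemma adjmxM p q r (A : 'M[C]_(p, q)) (B : 'M[C]_(q, r)) :
  adjmx (A *m B) = adjmx B *m adjmx A.
Proof. by rewrite /adjmx map_mxM trmx_mul. Qed.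

Lemma adjmxD p q (A B : 'M[C]_(p, q)) : adjmx (A + B) = adjmx A + adjmx B.
Proof. by rewrite /adjmx map_mxD linearD. Qed.

Lemma adjmxB p q (A B : 'M[C]_(p, q)) : adjmx (A - B) = adjmx A - adjmx B.
Proof. by rewrite /adjmx map_mxB linearB. Qed.

Lemma adjmxZ p q (c : C) (A : 'M[C]_(p, q)) : adjmx (c *: A) = c^* *: adjmx A.
Proof. by rewrite /adjmx map_mxZ linearZ. Qed.

Lemma adjmx_sum p q I r (P : pred I) (F : I -> 'M[C]_(p, q)) :
  adjmx (\sum_(i <- r | P i) F i) = \sum_(i <- r | P i) adjmx (F i).
Proof.
apply: (big_morph _ (@adjmxD p q)).
by apply/matrixP => i j; rewrite adjmxE !mxE conjC0.
Qed.

Lemma adjmx0 p q : adjmx (0 : 'M[C]_(p, q)) = 0.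
Proof. by apply/matrixP => i j; rewrite adjmxE !mxE conjC0. Qed.

Lemma adjmx1 p : adjmx (1%:M : 'M[C]_p) = 1%:M.
Proof.
by apply/matrixP => i j; rewrite adjmxE !mxE eq_sym; case: eqP => _; rewrite ?conjC0 ?conjC1.
Qed.

Lemma adjmx_delta p q (i : 'I_p) (j : 'I_q) :
  adjmx (delta_mx i j : 'M[C]_(p, q)) = delta_mx j i.
Proof.
apply/matrixP => a b; rewrite adjmxE !mxE andbC.
by case: (_ && _); rewrite ?conjC0 ?conjC1.
Qed.

Lemma adjmx_hermsym p (A : 'M[C]_p) : (A \is hermsymmx) = (A == adjmx A).
Proof. by rewrite is_hermitianmxE expr0 scale1r /adjmx map_trmx. Qed.

Lemma adjmx_self_ge0 p (x : 'cV[C]_p) : 0 <= (adjmx x *m x) 0 0.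
Proof.
rewrite mxE sumr_ge0 // => i _.
by rewrite adjmxE mulrC -normCK exprn_ge0.
Qed.

Lemma adjmx_self_eq0 p (x : 'cV[C]_p) : (adjmx x *m x) 0 0 = 0 -> x = 0.
Proof.
rewrite mxE => /eqP; rewrite psumr_eq0 => [/allP x0|i _]; last first.
  by rewrite adjmxE mulrC -normCK exprn_ge0.
apply/matrixP => i j; rewrite (ord1 j) mxE.
have := x0 i (mem_index_enum _); rewrite /= adjmxE mulrC -normCK.
by rewrite expf_eq0 /= normr_eq0 => /eqP.
Qed.

Lemma psdmx_gram p q (G : 'M[C]_(p, q)) : psdmx (adjmx G *m G).
Proof.
split; first by rewrite adjmx_hermsym adjmxM adjmxK.
by move=> x; rewrite mulmxA -mulmxA -adjmxM adjmx_self_ge0.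
Qed.

Lemma psdmx_sum p I r (P : pred I) (F : I -> 'M[C]_p) :
  (forall i, P i -> psdmx (F i)) -> psdmx (\sum_(i <- r | P i) F i).
Proof.
move=> FP; elim/big_rec : _ => [|i A Pi [hA pA]].
  split; first by rewrite adjmx_hermsym adjmx0.
  by move=> x; rewrite mulmx0 mul0mx mxE.
have [hF pF] := FP _ Pi; split.
  move: hF hA; rewrite !adjmx_hermsym adjmxD => /eqP <- /eqP <-; exact: eqxx.
by move=> x; rewrite mulmxDr mulmxDl mxE addr_ge0.
Qed.

Lemma psdmxZ p (c : C) (A : 'M[C]_p) : 0 <= c -> psdmx A -> psdmx (c *: A).
Proof.
move=> c0 [hA pA]; split.
  move: hA; rewrite !adjmx_hermsym adjmxZ => /eqP <-.
  by rewrite conj_Creal // ger0_real.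
by move=> x; rewrite -scalemxAr -scalemxAl mxE mulr_ge0.
Qed.

Lemma psdmx_congr p q (A : 'M[C]_p) (X : 'M[C]_(p, q)) :
  psdmx A -> psdmx (adjmx X *m A *m X).
Proof.
move=> [hA pA]; split.
  move: hA; rewrite !adjmx_hermsym !adjmxM adjmxK => /eqP <-.
  by rewrite mulmxA.
move=> x; have := pA (X *m x); rewrite adjmxM !mulmxA; exact.
Qed.

Lemma psdmx_gramP p (A : 'M[C]_p) :
  psdmx A -> exists G : 'M[C]_p, A = adjmx G *m G.
Proof.
move=> [hA pA].
have /orthomx_spectralP := hermitian_normalmx hA.
set P := spectralmx A; set D := spectral_diag A => AE.
have uP : P \is unitarymx := spectral_unitarymx A.
have iP : invmx P = adjmx P by rewrite invmx_unitary // /adjmx map_trmx.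
have PP : P *m adjmx P = 1%:M by rewrite -iP mulmxV // unitarymx_unit.
(* The eigenvalue [D 0 i] is the value of the form at the [i]-th eigenvector, a column of
   [adjmx P]. *)
have D0 i : 0 <= D 0 i.
  have := pA (adjmx P *m delta_mx i 0).
  rewrite adjmxM adjmxK AE iP adjmx_delta.
  rewrite -!mulmxA [P *m (adjmx P *m _)]mulmxA PP mul1mx !mulmxA.
  rewrite -[_ *m P *m adjmx P]mulmxA PP mulmx1 -rowE -colE !mxE eqxx mulr1n.
  exact.
exists (diag_mx (map_mx sqrtC D) *m P).
rewrite adjmxM mulmxA -[X in _ = X *m P]mulmxA.
have -> : adjmx (diag_mx (map_mx sqrtC D)) *m diag_mx (map_mx sqrtC D) = diag_mx D.
  apply/matrixP => i j; rewrite mul_mx_diag !mxE.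
  case: eqVneq => [->|ne]; last by rewrite !mulr0n conjC0 mul0r.
  rewrite !mulr1n conj_Creal ?ger0_real ?sqrtC_ge0 // -expr2 sqrtCK.
  by [].
by rewrite -iP -AE.
Qed.

End Adjoint.

(** * Separation of a point from the image of a closed cone *)
Section ConeSeparation.
Variables (R : realType) (p q : nat).
Local Notation sqn y := (\sum_j (y 0 j) ^+ 2).

Lemma sqn_affine_continuous (X : 'M[R]_(p, q)) (h : 'rV[R]_q) :
  continuous (fun v : 'rV[R]_p => sqn (h - v *m X)).
Proof.
have -> : (fun v : 'rV[R]_p => sqn (h - v *m X)) =
    fun v => \sum_j (h 0 j - \sum_i v 0 i * X i j) * (h 0 j - \sum_i v 0 i * X i j).
  by apply/funext => v; apply: eq_bigr => j _; rewrite !mxE expr2.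
have addc : continuous (fun x : R * R => x.1 + x.2) by move=> x; exact: (@add_continuous R).
have cs j : continuous (fun v : 'rV[R]_p => \sum_i v 0 i * X i j).
  apply: continuous_big => // i _ v.
  by apply: (@continuousM _ _ (fun v : 'rV[R]_p => v 0 i) (fun=> X i j)); [exact: coord_continuous|exact: cst_continuous].
have cj j : continuous (fun v : 'rV[R]_p => h 0 j - \sum_i v 0 i * X i j).
  move=> v; apply: (@continuousB _ _ _ (fun=> h 0 j)); first exact: cst_continuous.
  exact: cs.
apply: continuous_big => // j _ v.
by apply: (@continuousM _ _ (fun v : 'rV[R]_p => h 0 j - _)); exact: cj.
Qed.

(* The separating functional is the residual of the projection of [h] onto the
   image of the cone; [l] makes the distance coercive, so that it attains its
   minimum. *)
Lemma cone_separation (K : set 'rV[R]_p) (X : 'M[R]_(p, q))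
    (l : 'cV[R]_q) (c : R) (h : 'rV[R]_q) :
  closed K -> K 0 -> (forall u v, K u -> K v -> K (u + v)) ->
  (forall s v, 0 <= s -> K v -> K (s *: v)) ->
  (forall v, K v -> `|v| <= c * (v *m X *m l) 0 0) ->
  (exists2 v, K v & h = v *m X) \/
  exists2 e : 'cV[R]_q, (forall v, K v -> 0 <= (v *m X *m e) 0 0) &
    (h *m e) 0 0 < 0.
Proof.
move=> clK K0 KD KZ coer.
pose obj (v : 'rV[R]_p) := sqn (h - v *m X).
have objc : continuous obj by exact: sqn_affine_continuous.
have obj0 v : 0 <= obj v by apply: sumr_ge0 => j _; exact: sqr_ge0.
(* A sublevel set of the distance suffices for the minimum; it bounds [h - v *m X], hence [v *m X],
   and coercivity then bounds [v]. *)
pose S := K `&` (obj @^-1` [set x | x <= obj 0]).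
have S0 : S 0 by split => //=.
have clS : closed S.
  apply: closedI => //; apply: preimage_closed => [v _|]; first exact: objc.
  exact: closed_le.
have bS : bounded_set S.
  pose B := \sum_j `|l j 0| * (`|h 0 j| + (1 + obj 0)).
  exists (`|c| * B); split; first exact: num_real.
  move=> M ltM v [Kv /= Sv]; apply: le_trans (ltW ltM).
  apply: le_trans (coer v Kv) _; apply: le_trans (ler_norm _) _.
  rewrite normrM ler_wpM2l // mxE; apply: le_trans (ler_norm_sum _ _ _) _.
  apply: ler_sum => j _; rewrite normrM mulrC ler_wpM2l //.
  have -> : (v *m X) 0 j = h 0 j - (h - v *m X) 0 j by rewrite !mxE; ring.
  apply: le_trans (ler_normB _ _) _; rewrite lerD2l.
  have : ((h - v *m X) 0 j) ^+ 2 <= obj 0.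
    apply: le_trans Sv; rewrite /obj (bigD1 j) //= lerDl.
    by apply: sumr_ge0 => i _; exact: sqr_ge0.
  move: (_ 0 j) => y; rewrite -real_normK ?num_real //.
  have := normr_ge0 y; move: `|y| => z z0 zle.
  have := obj0 0; nra.
have [|v0 /set_mem [Kv0 _] minv] := EVT_min_rV _ (bounded_closed_compact bS clS)
    (continuous_subspaceT objc); first by exists 0.
have {}minv v : K v -> obj v0 <= obj v.
  move=> Kv; have [le|lt] := leP (obj v) (obj 0).
    by apply: minv; rewrite inE.
  by apply: le_trans (ltW lt); apply: minv; rewrite inE.
pose r := h - v0 *m X.
have [r0|rn0] := eqVneq r 0.
  by left; exists v0 => //; apply/eqP; rewrite -subr_eq0; apply/eqP.
have objD v s : obj (v0 + s *: v) =
    obj v0 - s * 2 * (v *m X *m r^T) 0 0 + s ^+ 2 * sqn (v *m X).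
  rewrite /obj mxE !mulr_sumr -sumrN -!big_split /=; apply: eq_bigr => j _.
  rewrite mulmxDl -scalemxAl /r; rewrite ![in LHS]mxE ![in RHS]mxE.
  move: (\sum_(k < p) v0 _ _ * _) (\sum_(k < p) v _ _ * _) => a b.
  by rewrite /GRing.scale /=; ring.
(* First-order condition at the minimum. The test value [a / (1 + |b| + a)] is at most [1] and makes
   [s * b < a], so a positive [a] is impossible. *)
have quad (a b : R) : (forall s, 0 < s -> s <= 1 -> 0 <= - s * a + s ^+ 2 * b) -> a <= 0.
  move=> H; rewrite leNgt; apply/negP => a0.
  have b1 : 0 < 1 + `|b| + a by have := normr_ge0 b; lra.
  pose s := a / (1 + `|b| + a).
  have s0 : 0 < s by rewrite divr_gt0.
  have s1 : s <= 1 by rewrite ler_pdivrMr // mul1r; have := normr_ge0 b; lra.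
  have := H s s0 s1.
  have sE : s * (1 + `|b| + a) = a by rewrite mulfVK // gt_eqF.
  have := ler_norm b; have : s * b < a.
    rewrite -sE ltr_pM2l //; have := ler_norm b; lra.
  move=> h1 _; rewrite expr2; nra.
right; exists (- r^T).
- move=> v Kv; rewrite mulmxN mxE oppr_ge0.
  rewrite -(pmulr_rle0 _ (ltr0n R 2)); apply: (quad _ (sqn (v *m X))) => s s0 _.
  have := minv (v0 + s *: v) (KD _ _ Kv0 (KZ _ _ (ltW s0) Kv)).
  by rewrite objD; lra.
(* Moving from [v0] towards the apex stays in the cone and cannot decrease the distance; hence the
   projection pairs nonnegatively with the residual [r], and [h *m r^T] is at least the square norm
   of [r]. *)
- have h1 : 0 <= (v0 *m X *m r^T) 0 0.
    rewrite -oppr_le0 -(pmulr_rle0 _ (ltr0n R 2)).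
    apply: (quad _ (sqn (v0 *m X))) => s s0 s1.
    have := minv (v0 + (- s) *: v0).
    rewrite objD sqrrN.
    have -> : v0 + - s *: v0 = (1 - s) *: v0 by rewrite scalerBl scale1r scaleNr.
    by move/(_ (KZ _ _ _ Kv0)); rewrite subr_ge0 => /(_ s1); lra.
  have -> : h = r + v0 *m X by rewrite /r subrK.
  rewrite mulmxN mulmxDl 2!mxE oppr_lt0 ltr_wpDr //.
  rewrite mxE lt_def sumr_ge0 ?andbT => [|j _]; last by rewrite !mxE -expr2 sqr_ge0.
  apply: contra rn0; rewrite psumr_eq0 => [/allP z|j _]; last by rewrite !mxE -expr2 sqr_ge0.
  apply/eqP/rowP => j; have := z j (mem_index_enum _).
  by rewrite /= !mxE mulf_eq0 orbb => /eqP.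
Qed.

End ConeSeparation.

(** * Polynomials in several variables and rational functions *)
Section BoxPolynomials.
Variables (F : fieldType) (d N : nat).
Local Notation T := {ffun 'I_d -> 'I_N.+1}.

(* Tensor product of the inverse Vandermonde matrices. *)
Lemma box_coef_extract (x : 'I_d -> 'I_N.+1 -> F) :
  (forall k, injective (x k)) -> forall a : T, exists w : T -> F, forall t : T,
  \sum_(j : T) w j * \prod_k x k (j k) ^+ t k = (t == a)%:R.
Proof.
move=> injx a; pose V k := Vandermonde N.+1 (\row_j x k j).
have Vunit k : V k \in unitmx.
  rewrite unitmxE det_Vandermonde unitfE.
  apply/prodf_neq0 => i _; apply/prodf_neq0 => j ij.
  by rewrite !mxE subr_eq0 (inj_eq (injx k)) gt_eqF.
exists (fun j => \prod_k invmx (V k) (j k) (a k)) => t.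
transitivity (\sum_(j : T) \prod_k (invmx (V k) (j k) (a k) * x k (j k) ^+ t k)).
  by apply: eq_bigr => j _; rewrite big_split.
rewrite -(bigA_distr_bigA (fun k j => invmx (V k) j (a k) * x k j ^+ t k)) /=.
have E k : \sum_j invmx (V k) j (a k) * x k j ^+ t k = (t k == a k)%:R.
  have := mulmxV (Vunit k) => /matrixP/(_ (t k) (a k)).
  rewrite !mxE => <-; apply: eq_bigr => j _; rewrite mulrC; congr (_ * _).
  by rewrite !mxE.
under eq_bigr do rewrite E.
have [->|ta] := eqVneq t a.
  by rewrite big1 // => k _; rewrite eqxx.
have [k ne] : exists k, t k != a k.
  by apply/existsP; apply: contraNT ta; rewrite negb_exists => /forallP h; apply/eqP/ffunP => k; apply/eqP; have := h k; rewrite negbK.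
by rewrite (bigD1 k) //= (negbTE ne) mul0r.
Qed.

Lemma box_poly_eq0 (x : 'I_d -> 'I_N.+1 -> F) (c : T -> F) :
  (forall k, injective (x k)) ->
  (forall j : T, \sum_(t : T) c t * \prod_k x k (j k) ^+ t k = 0) ->
  forall t, c t = 0.
Proof.
move=> injx c0 a; have [w wE] := box_coef_extract injx a.
have : \sum_(j : T) w j * \sum_(t : T) c t * \prod_k x k (j k) ^+ t k = 0.
  by rewrite big1 // => j _; rewrite c0 mulr0.
under eq_bigr do rewrite mulr_sumr.
rewrite exchange_big /=.
have E t : \sum_(j : T) w j * (c t * \prod_k x k (j k) ^+ t k) = c t * (t == a)%:R.
  by rewrite -wE mulr_sumr; apply: eq_bigr => j _; rewrite mulrCA.
rewrite (eq_bigr (fun t => c t * (t == a)%:R)) => [|t _]; last exact: E.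
rewrite (bigD1 a) //= big1 ?addr0 => [|t /negbTE ->]; last by rewrite mulr0.
by rewrite eqxx mulr1.
Qed.

End BoxPolynomials.

(** A linearly independent family in [Fam] of maximal length: any member outside its row space could
    be appended. The rows are members themselves, not combinations, because [realization] uses the
    defining property of each row. *)
Lemma spanning_rows (F : fieldType) (N : nat) (Fam : 'rV[F]_N -> Prop) :
  exists (m : nat) (X : 'M[F]_(m, N)),
    [/\ row_free X, forall i, Fam (row i X) & forall v, Fam v -> (v <= X)%MS].
Proof.
pose P m := `[< exists X : 'M[F]_(m, N), row_free X /\ forall i, Fam (row i X) >].
have exP : exists m, P m.
  by exists 0; apply/asboolP; exists 0; split; [rewrite /row_free mxrank0|case].
have ubP m : P m -> (m <= N)%N.
  by move=> /asboolP [X [/eqP fX _]]; have := rank_leq_col X; rewrite fX.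
case: (ex_maxnP exP ubP) => m /asboolP [X [fX FX]] maxm.
exists m, X; split=> // v Fv; apply: contraT => nvX.
suff /maxm : P (m + 1)%N by rewrite addn1 ltnn.
apply/asboolP; exists (col_mx X v); split; last first.
  move=> i; rewrite -(splitK i); case: (fintype.split i) => j /=.
    by rewrite rowKu.
  by rewrite rowKd (ord1 j) (_ : row 0 v = v) //; apply/rowP => k; rewrite mxE.
apply: inj_row_free => u; rewrite -[u]hsubmxK mul_row_col.
set a := lsubmx u; set b := rsubmx u => ab0.
have b0 : b 0 0 = 0.
  apply/eqP; apply: contraNT nvX => b0.
  apply/submxP; exists (- (b 0 0)^-1 *: a); apply/eqP.
  rewrite -scalemxAl scaleNr -addr_eq0 -(can_eq (scalerK b0)) scaler0 scalerDr.
  by rewrite scalerA mulfV // scale1r -mul_scalar_mx -mx11_scalar addrC ab0.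
have {}b0 : b = 0 by apply/rowP => k; rewrite (ord1 k) b0 mxE.
move: ab0; rewrite b0 mul0mx addr0 => aX.
have -> : a = 0 by apply: (row_free_inj fX); rewrite mul0mx.
by rewrite row_mx0.
Qed.

Local Open Scope quotient_scope.
Lemma fraction_num_den (D : idomainType) (x : {fraction D}) :
  exists n q : D, q != 0 /\ x = tofrac n / tofrac q.
Proof.
elim/quotW: x => y; exists y.1, y.2; split; first exact: denom_ratioP.
apply/(canRL (mulfK _)); first by rewrite tofrac_eq0 denom_ratioP.
rewrite -[LHS]/(FracField.mul _ _) !piE; apply/eqmodP.
rewrite /= FracField.equivfE !numden_Ratio ?(oner_eq0, mulf_neq0, denom_ratioP) //.
by rewrite !mulr1 mulrC.
Qed.
Local Close Scope quotient_scope.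

Section Polynomials.
Variables (R : realType) (d : nat).
Local Notation C := (cplx R).
Local Notation poly_d := (mpoly d C).
Local Notation rat_d := (ratfun R d).
Local Notation box N := {ffun 'I_d -> 'I_N.+1}.

Lemma common_denominator n (f : 'M[rat_d]_n) :
  exists (q : poly_d) (P : 'M[poly_d]_n),
    q != 0 /\ forall i j, f i j = tofrac (P i j) / tofrac q.
Proof.
have /choice [a] : forall ij : 'I_n * 'I_n, exists a : poly_d * poly_d,
    a.2 != 0 /\ f ij.1 ij.2 = tofrac a.1 / tofrac a.2.
  by move=> ij; have [x [y [y0 E]]] := fraction_num_den (f ij.1 ij.2); exists (x, y).
move=> aP; exists (\prod_ij (a ij).2).
exists (\matrix_(i, j) ((a (i, j)).1 * \prod_(ij | ij != (i, j)) (a ij).2)).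
split=> [|i j]; first by apply/prodf_neq0 => ij _; case: (aP ij).
have [a0 fE] := aP (i, j).
rewrite [X in tofrac X / _]mxE [X in _ / tofrac X](bigD1 (i, j)) //=.
set b := (X in tofrac (_.2 * X)); set b' := (X in tofrac (_.1 * X)).
have bb : b' = b by [].
have b0 : b != 0 by apply/prodf_neq0 => ij _; case: (aP ij).
rewrite bb (tofracM _ b) (tofracM _ b).
rewrite fE -mulf_div divff ?mulr1 //.
by rewrite tofrac_eq0.
Qed.

Definition box_mnm N (t : box N) : multinom d := Multinom [tuple (t k : nat) | k < d].

(** For nonzero [p], [mmeasure mdeg p] is the total degree plus one; the bound thus keeps every
    exponent at most [N]. *)
Lemma meval_box N (p : poly_d) (z : 'I_d -> C) :
  (mmeasure mdeg p <= N.+1)%N ->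
  meval z p = \sum_(t : box N) mcoeff (box_mnm t) p * \prod_k z k ^+ t k.
Proof.
move=> pN; rewrite mevalE.
have inj_mnm : injective (@box_mnm N).
  by move=> s t /mnmP st; apply/ffunP => k; apply: val_inj; have := st k; rewrite !mnmE.
pose G (m : multinom d) := mcoeff m p * \prod_i z i ^+ m i.
have -> : \sum_(t : box N) mcoeff (box_mnm t) p * \prod_k z k ^+ t k
    = \sum_(m <- map (@box_mnm N) (enum {: box N})) G m.
  rewrite big_map big_enum /=; apply: eq_bigr => t _; congr (_ * _).
  by apply: eq_bigr => k _; rewrite mnmE.
rewrite -[LHS]/(\sum_(m <- msupp p) G m).
rewrite [RHS](bigID (fun m => m \in msupp p)) /= [X in _ = _ + X]big1 ?addr0; last first.
  by move=> m; rewrite mcoeff_msupp negbK => /eqP m0; rewrite /G m0 mul0r.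
rewrite -[RHS]big_filter; apply: perm_big; apply: uniq_perm.
- exact: msupp_uniq.
- by rewrite filter_uniq // map_inj_uniq // enum_uniq.
move=> m; rewrite mem_filter; case: (boolP (m \in msupp p)) => //= mp.
apply/esym/mapP.
have mk k : (m k < N.+1)%N.
  apply: leq_trans (leq_trans (msize_mdeg_lt mp) pN).
  by rewrite ltnS mdegE (bigD1 k) //= leq_addr.
exists [ffun k => Ordinal (mk k)]; first by rewrite mem_enum.
by apply/mnmP => k; rewrite mnmE ffunE.
Qed.

Lemma mpoly_eq0_grid (s : nat -> C) (p : poly_d) : injective s ->
  (forall z : 'I_d -> nat, meval (fun k => s (z k)) p = 0) -> p = 0.
Proof.
move=> injs p0; pose N := mmeasure mdeg p.
have cp0 : forall t : box N, mcoeff (box_mnm t) p = 0.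
  apply: (box_poly_eq0 (x := fun _ j => s j)) => [k i j /injs /val_inj //|j].
  by rewrite -[RHS](p0 (fun k => j k : nat)) (@meval_box N p _ (leqnSn _)).
apply/mpolyP => m; rewrite mcoeff0; apply/eqP; rewrite -[_ == _]negbK -mcoeff_msupp.
apply/negP => mp.
have mk k : (m k < N.+1)%N.
  apply: leq_trans (leqW (msize_mdeg_lt mp)).
  by rewrite ltnS mdegE (bigD1 k) //= leq_addr.
have := cp0 [ffun k => Ordinal (mk k)].
have -> : box_mnm [ffun k => Ordinal (mk k)] = m.
  by apply/mnmP => k; rewrite mnmE ffunE.
by move/eqP; rewrite -[_ == _]negbK -mcoeff_msupp mp.
Qed.

(** In C the inequality [0 < z k] makes [z k] real. Positive integer points already separate
    polynomials; homogenization and realization are carried out at positive points, where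
    conjugation is trivial. *)
Lemma mpoly_ext_pos (p q : poly_d) :
  (forall z : 'I_d -> C, (forall k, 0 < z k) -> meval z p = meval z q) -> p = q.
Proof.
move=> pq; apply/eqP; rewrite -subr_eq0; apply/eqP.
apply: (@mpoly_eq0_grid (fun n => n.+1%:R)) => [i j /eqP|z].
  by rewrite eqr_nat => /eqP [].
by rewrite mevalB pq ?subrr // => k; rewrite ltr0n.
Qed.

Lemma mpoly_neq0_pos (p : poly_d) : p != 0 ->
  exists2 z : 'I_d -> C, (forall k, 0 < z k) & meval z p != 0.
Proof.
move=> p0; apply: contrapT => H; case/eqP: p0; apply: mpoly_ext_pos => z z0.
by rewrite meval0; apply: contrapT => /eqP pz; apply: H; exists z.
Qed.

Lemma mpoly_ext_generic (p q r : poly_d) : r != 0 ->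
  (forall z : 'I_d -> C, (forall k, 0 < z k) -> meval z r != 0 -> meval z p = meval z q) ->
  p = q.
Proof.
move=> r0 pq; apply: (mulfI r0); apply: mpoly_ext_pos => z z0.
by rewrite !mevalM; have [->|rz] := eqVneq (meval z r) 0; rewrite ?mul0r // pq.
Qed.

Lemma meval_dilate (lam : C) (p : poly_d) (z : 'I_d -> C) :
  meval z (dilate lam p) = meval (fun k => lam * z k) p.
Proof.
rewrite /dilate comp_mpoly_meval; apply: meval_eq => k.
by rewrite tnth_mktuple mevalZ mevalXU.
Qed.

Lemma dilate_neq0 (lam : C) (p : poly_d) : lam != 0 -> p != 0 -> dilate lam p != 0.
Proof.
move=> l0; apply: contra_neq => dp0; apply: mpoly_ext_pos => z z0.
have := meval_dilate lam p (fun k => lam^-1 * z k).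
rewrite dp0 !meval0 => ->; apply: meval_eq => k.
by rewrite mulrA mulfV // mul1r.
Qed.

Lemma tofrac_div_eq (D : idomainType) (a b a' b' : D) : b != 0 -> b' != 0 ->
  (tofrac a / tofrac b == tofrac a' / tofrac b') = (a * b' == a' * b).
Proof.
move=> b0 b'0; rewrite -(tofrac_eq (a * b')) !tofracM.
by rewrite eqr_div ?tofrac_eq0.
Qed.

End Polynomials.

(** * Null sets *)
Section NullSets.
Variables (R : realType) (d : nat).
Hypothesis d0 : (0 < d)%N.
Local Notation box a b := [set x : 'rV[R]_d | forall k, a 0 k <= x 0 k <= b 0 k].
Local Notation vol a b := (\prod_(k < d) (b 0 k - a 0 k)).

(** Covers may be indexed by any countable type: natural numbers that are not codes receive a
    degenerate box, of volume [0] since [d] is positive. *)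
Lemma null_set_count (E : set 'rV[R]_d) :
  (forall e : R, 0 < e -> exists (I : countType) (a b : I -> 'rV[R]_d),
    [/\ forall i k, a i 0 k <= b i 0 k, E `<=` \bigcup_i box (a i) (b i) &
      forall s : seq I, uniq s -> \sum_(i <- s) vol (a i) (b i) <= e]) ->
  Defs.null_set E.
Proof.
move=> H e e0; have [I [a [b [ab Eab sab]]]] := H e e0.
exists (fun n => oapp a 0 (pickle_inv n)), (fun n => oapp b 0 (pickle_inv n)).
split=> [n k|x /Eab [i _ xi]|N].
- by case: (pickle_inv n) => //= i.
- by exists (choice.pickle i) => //=; rewrite pickleK_inv.
apply: le_trans (sab (pmap pickle_inv (iota 0 N)) _); last first.
  by apply: (pmap_uniq (@pickle_invK I)); exact: iota_uniq.
rewrite -(big_mkord predT (fun j => vol (oapp a 0 (pickle_inv j)) (oapp b 0 (pickle_inv j)))).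
rewrite /index_iota subn0; elim: (iota 0 N) => [|n s IH] /=; first by rewrite !big_nil.
rewrite big_cons /=; case: (pickle_inv n) => [i|] /=; first by rewrite big_cons lerD2l.
apply: le_trans IH; rewrite gerDr.
by rewrite (bigD1 (Ordinal d0)) //= subrr mul0r.
Qed.

Lemma null_set_bigcup (E : nat -> set 'rV[R]_d) :
  (forall n, Defs.null_set (E n)) -> Defs.null_set (\bigcup_n E n).
Proof.
move=> nE; apply: null_set_count => e e0.
have e2 n : 0 < e / 2 ^+ n.+1 by rewrite divr_gt0 // exprn_gt0.
have /choice [ab H] : forall n, exists ab : (nat -> 'rV[R]_d) * (nat -> 'rV[R]_d),
   [/\ forall j k, ab.1 j 0 k <= ab.2 j 0 k,
        E n `<=` \bigcup_j box (ab.1 j) (ab.2 j)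
      & forall N, \sum_(j < N) vol (ab.1 j) (ab.2 j) <= e / 2 ^+ n.+1].
  by move=> n; have [a [b ?]] := nE n _ (e2 n); exists (a, b).
exists (nat * nat)%type, (fun nj => (ab nj.1).1 nj.2), (fun nj => (ab nj.1).2 nj.2).
split=> [nj k|x [n _ xn]|s us].
- by have [h _ _] := H nj.1.
- have [_ h _] := H n; have [j _ xj] := h x xn.
  by exists (n, j).
pose N := (\max_(nj <- s) (maxn nj.1 nj.2)).+1.
have vol0 nj : 0 <= vol ((ab nj.1).1 nj.2) ((ab nj.1).2 nj.2).
  by apply: prodr_ge0 => k _; rewrite subr_ge0; have [h _ _] := H nj.1.
apply: (@le_trans _ _ (\sum_(nj <- [seq (n, j) | n <- iota 0 N, j <- iota 0 N])
    vol ((ab nj.1).1 nj.2) ((ab nj.1).2 nj.2))).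
  rewrite [leRHS](bigID (mem s)) ler_wpDr //; first by apply: sumr_ge0.
  rewrite -[leRHS]big_filter; rewrite le_eqVlt; apply/orP; left; apply/eqP; apply: perm_big; apply: uniq_perm => //.
    by rewrite filter_uniq // allpairs_uniq ?iota_uniq // => -[? ?] [? ?].
  move=> nj; apply/esym; rewrite mem_filter; apply: andb_idr => njs.
  have : (maxn nj.1 nj.2 <= \max_(nj <- s) maxn nj.1 nj.2)%N.
    by rewrite (big_rem nj njs) /= leq_maxl.
  rewrite geq_max => /andP[h1 h2].
  apply/allpairsP; exists nj; split; rewrite ?mem_iota ?add0n ?ltnS //.
  by case: (nj).
rewrite big_allpairs.
apply: (@le_trans _ _ (\sum_(n <- iota 0 N) e / 2 ^+ n.+1)).
  apply: ler_sum => n _; have [_ _ h] := H n; apply: le_trans (h N).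
  by rewrite -(big_mkord predT (fun j => vol ((ab n).1 j) ((ab n).2 j))) /index_iota subn0.
have -> : forall N, \sum_(n <- iota 0 N) e / 2 ^+ n.+1 = e - e / 2 ^+ N.
  move=> M; have -> : iota 0 M = index_iota 0 M by rewrite /index_iota subn0.
  elim: M => [|M IH]; first by rewrite big_nil expr0 divr1 subrr.
  rewrite big_nat_recr //= IH exprS.
  have : (2 ^+ M : R) != 0 by rewrite expf_neq0.
  by move=> h; field.
by rewrite gerBl divr_ge0 ?ltW // exprn_gt0.
Qed.

(* A half-open grid cell can meet [E] at most [m] times along a diagonal of the
   grid, which leaves O(N^(d-1)) of the N^d cells. *)
Lemma chain_free_null_set (E : set 'rV[R]_d) (m : nat) :
  (forall s : seq 'rV[R]_d, all (fun x => `[< E x >]) s ->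
     sorted (fun x y : 'rV[R]_d => [forall k, x 0 k < y 0 k]) s -> (size s <= m)%N) ->
  Defs.null_set E.
Proof.
move=> chain.
pose EM (M : nat) := [set x | E x /\ forall k, - M.+1%:R <= x 0 k < M.+1%:R].
suff nM M : Defs.null_set (EM M).
  have EE : E = \bigcup_M EM M.
    apply/seteqP; split=> [x Ex|x [M _ []] //].
    pose B := \sum_k `|x 0 k|.
    have B0 : 0 <= B by apply: sumr_ge0.
    exists (Num.truncn B) => //; split => // k.
    have xB : `|x 0 k| <= B by rewrite /B (bigD1 k) //= lerDl sumr_ge0.
    have := truncnS_gt B.
    move: xB; rewrite ler_norml => /andP[h1 h2] h3; apply/andP; split; lra.
  by rewrite EE; exact: null_set_bigcup.
apply: null_set_count => e e0.
pose k0 := Ordinal d0; pose L : R := 2 * M.+1%:R.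
have L0 : 0 < L by rewrite mulr_gt0 // ltr0n.
(* There are at most [m * (2 N)^(d-1)] bad cells, each of volume [(L / N)^d]; their total
   [m 2^(d-1) L^d / N] is below [e] for this [N]. *)
pose N := (Num.truncn (m%:R * 2 ^+ d.-1 * L ^+ d / e)).+1.
have N0 : 0 < N%:R :> R by rewrite ltr0n.
pose h := L / N%:R.
have h0 : 0 < h by rewrite divr_gt0.
pose T := {ffun 'I_d -> 'I_N}.
pose a (i : T) : 'rV[R]_d := \row_k (- M.+1%:R + h * (i k)%:R).
pose cell i x := E x /\ forall k, a i 0 k <= x 0 k < a i 0 k + h.
pose bad := [set i : T | `[< exists x, cell i x >]]%SET.
pose b i : 'rV[R]_d := \row_k (a i 0 k + if i \in bad then h else 0).
have volE i : vol (a i) (b i) = if i \in bad then h ^+ d else 0.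
  under eq_bigr do rewrite [b i _ _]mxE addrAC subrr add0r.
  rewrite prodr_const card_ord; case: ifP => // _.
  by rewrite expr0n (gtn_eqF d0).
exists T, a, b; split=> [i k|x [Ex xM]|s us].
- by rewrite [b i 0 k]mxE lerDl; case: ifP => // _; exact: ltW.
- pose y k := (x 0 k + M.+1%:R) / h.
  have y0 k : 0 <= y k by have /andP[h1 h2] := xM k; rewrite divr_ge0 ?(ltW h0) //; move: h1; rewrite -subr_ge0 opprK.
  have yN k : (Num.truncn (y k) < N)%N.
    rewrite -(ltr_nat R); apply: (@le_lt_trans _ _ (y k)); first by rewrite truncn_le.
    have /andP[_ h2] := xM k; rewrite ltr_pdivrMr // /h mulrC mulfVK ?gt_eqF //.
    by rewrite /L; lra.
  pose i : T := [ffun k => Ordinal (yN k)].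
  have ci : cell i x.
    split=> // k; rewrite mxE ffunE /=.
    have : (Num.truncn (y k))%:R <= y k by rewrite truncn_le.
    have := truncnS_gt (y k).
    rewrite -natr1; move: (Num.truncn (y k))%:R => u.
    rewrite /y ltr_pdivrMr // ler_pdivlMr // => h1 h2; apply/andP; split; lra.
  have ib : i \in bad by rewrite inE; apply/asboolP; exists x.
  exists i => //= k; have [_ /(_ k) /andP[h1 h2]] := ci.
  by rewrite h1 [b i 0 k]mxE ib ltW.
apply: (@le_trans _ _ (\sum_(i : T) vol (a i) (b i))).
  rewrite -[leRHS]big_enum [leRHS](bigID (mem s)) ler_wpDr //.
    by apply: sumr_ge0 => i _; rewrite volE; case: ifP => // _; rewrite exprn_ge0 // ltW.
  rewrite -[leRHS]big_filter; rewrite le_eqVlt; apply/orP; left; apply/eqP; apply: perm_big; apply: uniq_perm => //.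
    by rewrite filter_uniq // enum_uniq.
  by move=> i; rewrite mem_filter mem_enum andbT.
under eq_bigr do rewrite volE.
rewrite -big_mkcond /= sumr_const.
(* The key of a cell names its diagonal: the differences of its indices with the index along [k0].
   The offset [N] keeps the truncated subtraction of naturals faithful, and there are [(2 N)^(d-1)]
   keys. *)
pose K := {ffun {k : 'I_d | k != k0} -> 'I_(N + N)}.
have keyP (i : T) (k : 'I_d) : (i k + N - i k0 < N + N)%N.
  by have := ltn_ord (i k); have := ltn_ord (i k0); lia.
pose key (i : T) : K := [ffun k => Ordinal (keyP i (val k))].
have aux (x y u v : nat) : (u < N)%N -> (v < N)%N -> (x + N - u = y + N - v)%N ->
    (u = v -> x = y) /\ (u < v -> x < y)%N.
  by move: (N) => N' h1 h2 h3; lia.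
have fib (c : K) : (#|[set i in bad | key i == c]| <= m)%N.
  set A := [set i in bad | key i == c].
  have /choice [pt ptP] : forall i : T, exists x, i \in bad -> cell i x.
    move=> i; case: (boolP (i \in bad)) => [|_]; last by exists 0.
    by rewrite inE => /asboolP [x cx]; exists x.
  pose r (i j : T) := (i k0 <= j k0)%N.
  have rt : transitive r by move=> x y z; exact: leq_trans.
  pose s' := sort r (enum A).
  rewrite cardE -(size_sort r) -(size_map pt); apply: chain.
    rewrite all_map; apply/allP => i; rewrite mem_sort mem_enum inE => /andP [ib _].
    by apply/asboolP; have [] := ptP i ib.
  apply: pairwise_sorted; rewrite pairwise_map.
  have : pairwise [rel x y | (x != y) && r x y] s'.
    rewrite pairwise_relI -uniq_pairwise sort_uniq enum_uniq /=.
    by rewrite -(sorted_pairwise rt) sort_sorted // => x y; exact: leq_total.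
  apply: (@sub_in_pairwise _ (mem A)); last by apply/allP => i; rewrite mem_sort mem_enum.
  move=> i j iA jA /andP [ij rij]; rewrite /r in rij.
  have /setIdP [ib /eqP ik] := iA; have /setIdP [jb /eqP jk] := jA.
  have E1 k : (i k + N - i k0 = j k + N - j k0)%N.
    have [->|kk] := eqVneq k k0; first by rewrite !addKn.
    have := congr1 (fun g : K => val (g (exist _ k kk))) (etrans ik (esym jk)).
    by rewrite !ffunE.
  (* Distinct cells on one diagonal are strictly ordered in all coordinates at once; since cells are
     half-open, points chosen in them form a strict chain. *)
  have lt0 : (i k0 < j k0)%N.
    rewrite ltn_neqAle rij andbT; apply: contra ij => /eqP e1.
    apply/eqP/ffunP => k; apply: val_inj.
    by have [h1 _] := aux _ _ _ _ (ltn_ord (i k0)) (ltn_ord (j k0)) (E1 k); exact: h1.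
  rewrite /=; apply/forallP => k; have [_ /(_ k) /andP[_ h1]] := ptP i ib.
  have [_ /(_ k) /andP[h2 _]] := ptP j jb.
  apply: lt_le_trans h1 _; apply: le_trans h2; rewrite !mxE -addrA lerD2l.
  rewrite -[X in _ + X]mulr1 -mulrDr ler_pM2l // natr1 ler_nat.
  by have [_ h2'] := aux _ _ _ _ (ltn_ord (i k0)) (ltn_ord (j k0)) (E1 k); exact: h2'.
have cb : (#|bad| <= m * (N + N) ^ d.-1)%N.
  rewrite -sum1_card (partition_big key predT) //=.
  apply: (@leq_trans (\sum_(c : K) m)).
    apply: leq_sum => c _; rewrite sum1_card; apply: leq_trans (fib c).
    by rewrite -cardsE; apply: subset_leq_card; apply/fintype.subsetP => i; rewrite !inE.
  by rewrite sum_nat_const card_ffun card_sig card_ord cardC1 card_ord mulnC.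
apply: (@le_trans _ _ (h ^+ d * (m * (N + N) ^ d.-1)%:R)).
  rewrite -[leLHS]mulr_natr; apply: ler_wpM2l; first by rewrite exprn_ge0 // ltW.
  by rewrite ler_nat.
have -> : h ^+ d * (m * (N + N) ^ d.-1)%:R = m%:R * 2 ^+ d.-1 * L ^+ d / N%:R.
  rewrite natrM natrX natrD (_ : N%:R + N%:R = 2 * N%:R :> R); last by ring.
  rewrite (exprMn _ 2) /h expr_div_n -[X in _ / _ ^+ X](prednK d0).
  rewrite [N%:R ^+ _.+1]exprS; move: (L ^+ d) (2 ^+ d.-1) => u v.
  have : N%:R ^+ d.-1 != 0 :> R by rewrite expf_neq0 ?gt_eqF.
  have : N%:R != 0 :> R by rewrite gt_eqF.
  by move: (N%:R : R) (N%:R ^+ d.-1) => x y x0 y0; field; rewrite x0 y0.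
rewrite ler_pdivrMr // [e * _]mulrC -ler_pdivrMr // ltW //.
exact: truncnS_gt.
Qed.

Lemma prod_shift_le (x : 'I_d -> R) (e : R) : (forall k, 0 <= x k) -> 0 < e ->
  exists2 del : R, 0 < del & \prod_k (x k + del) <= \prod_k x k + e.
Proof.
move=> x0 e0; pose p : {poly R} := \prod_k ((x k)%:P + 'X).
have pE y : p.[y] = \prod_k (x k + y).
  by rewrite /p horner_prod; apply: eq_bigr => k _; rewrite !hornerE.
have := @continuous_horner R p 0.
move=> /cvgrPdist_le /(_ e e0) /nbhs_ballP [r /= r0 rp].
exists (r / 2); first by rewrite divr_gt0.
have : `|p.[0] - p.[r / 2]| <= e.
  apply: rp; rewrite /ball /= sub0r normrN gtr0_norm ?divr_gt0 //; lra.
rewrite distrC !pE => h; have := le_trans (ler_norm _) h.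
under [X in _ - X]eq_bigr do rewrite addr0.
by lra.
Qed.

Lemma card_in_interval (M : nat) (A : {set 'I_M}) (w : R) : 0 <= w ->
  (forall i j, i \in A -> j \in A -> (j : nat)%:R - (i : nat)%:R <= w) ->
  #|A|%:R <= w + 1.
Proof.
move=> w0 Aw; have [->|[i iA]] := set_0Vmem A; first by rewrite cards0 addr_ge0.
have [i0 i0A min0] := arg_minnP (fun i : 'I_M => i : nat) iA.
have [i1 i1A max1] := arg_maxnP (fun i : 'I_M => i : nat) iA.
apply: (@le_trans _ _ ((i1 : nat)%:R - (i0 : nat)%:R + 1)); last first.
  by rewrite lerD2r; exact: Aw.
have le01 : (i0 <= i1)%N := min0 _ i1A.
rewrite -natrB // natr1 ler_nat.
rewrite cardE -(size_map val) -(size_iota i0 (i1 - i0).+1); apply: uniq_leq_size.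
  by rewrite map_inj_uniq ?enum_uniq //; exact: val_inj.
move=> _ /mapP [j jA ->]; rewrite mem_enum in jA.
rewrite mem_iota; have := min0 _ jA; have := max1 _ jA => /= h1 h2.
by rewrite h2 addnS ltnS subnKC.
Qed.

(* The grid points of the cube are counted against the grid points of finitely
   many slightly enlarged boxes, extracted by compactness. *)
Lemma null_set_dense (E : set 'rV[R]_d) (c : 'rV[R]_d) (r : R) : 0 < r ->
  Defs.null_set E -> exists2 t : 'rV[R]_d, ~ E t & forall k, c 0 k <= t 0 k <= c 0 k + r.
Proof.
move=> r0 nE; apply: contrapT => noT.
pose Q := [set t : 'rV[R]_d | forall k, c 0 k <= t 0 k <= c 0 k + r].
have QE : Q `<=` E by move=> t Qt; apply: contrapT => nEt; apply: noT; exists t.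
(* A cover of total volume [e], with a further [e] spent on enlarging its boxes, amounts to at most
   half the volume [r ^+ d] of the cube. *)
pose e := r ^+ d / 4.
have e0 : 0 < e by rewrite divr_gt0 // exprn_gt0.
have [a [b [ab Eab sab]]] := nE e e0.
have e2 n : 0 < e / 2 ^+ n.+1 by rewrite divr_gt0 // exprn_gt0.
have /choice [del delP] : forall j, exists del, 0 < del /\
    \prod_(k < d) (b j 0 k - a j 0 k + del) <= vol (a j) (b j) + e / 2 ^+ j.+1.
  move=> j; have [del h1 h2] := @prod_shift_le (fun k => b j 0 k - a j 0 k) _
    (fun k => eq_ind_r is_true (ab j k) (subr_ge0 _ _)) (e2 j).
  by exists del.
(* Each side is lengthened by [del j / 3] at both ends to make the box open; the last third of
   [del j] absorbs the grid step [r / M] in the count of grid points. *)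
pose U j := [set x : 'rV[R]_d | forall k, a j 0 k - del j / 3 < x 0 k < b j 0 k + del j / 3].
have Uo j : open (U j).
  rewrite openE /= => x Ux; rewrite /interior /U.
  suff H k : nbhs x [set y : 'rV[R]_d | a j 0 k - del j / 3 < y 0 k < b j 0 k + del j / 3].
    exact: filter_forall H.
  have /andP[h1 h2] := Ux k.
  have /(_ [set u | a j 0 k - del j / 3 < u < b j 0 k + del j / 3]) :=
    @coord_continuous R 1 d 0 k x.
  apply; near=> y; apply/andP; split; near: y.
    exact: lt_nbhsr.
  exact: lt_nbhsl.
have Qc : compact Q.
  have -> : Q = [set v : 'rV[R]_d | forall k, `[c 0 k, c 0 k + r]%classic (v ord0 k)].
    by apply/seteqP; split=> x xk k; have := xk k; rewrite /= in_itv.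
  apply: (@rV_compact R d (fun k => `[c 0 k, c 0 k + r]%classic)) => k.
  exact: segment_compact.
have QU : exists J : nat, forall x, Q x -> exists2 j, (j < J)%N & U j x.
  have := Qc; rewrite compact_cover => /(_ nat setT U (fun j _ => Uo j)) [|D _ QD].
    move=> x /QE /Eab [j _ xj]; exists j => // k.
    have /andP[h1 h2] := xj k; have [h3 _] := delP j.
    by apply/andP; split; lra.
  exists (\max_(j <- D) j).+1 => x /QD [j jD Uj]; exists j => //.
  by rewrite ltnS (big_rem j jD) /= leq_maxl.
have [J QJ] := QU.
have [M M0 Mdel] : exists2 M : nat, (0 < M)%N & forall j : 'I_J, r / M%:R <= del j / 3.
  exists (\max_(j < J) Num.truncn (3 * r / del j)).+1 => // j.
  have [h3 _] := delP j; rewrite ler_pdivrMr ?ltr0n //.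
  rewrite -ler_pdivrMl ?divr_gt0 // ; apply: le_trans (ltW (truncnS_gt _)) _.
  rewrite ler_nat ltnS; apply: leq_trans (leq_bigmax j).
  by rewrite (_ : (del j / 3)^-1 * r = 3 * r / del j) //; field; rewrite gt_eqF.
have M0' : 0 < M%:R :> R by rewrite ltr0n.
pose A (j : nat) k := [set i : 'I_M | a j 0 k - del j / 3 < c 0 k + r * (i : nat)%:R / M%:R
   < b j 0 k + del j / 3]%SET.
pose L (j : nat) k := b j 0 k - a j 0 k + del j / 3 * 2.
have L0 j k : 0 <= L j k.
  by rewrite /L; have [h3 _] := delP j; have := ab j k; lra.
have cA (j : nat) k : #|A j k|%:R <= L j k * M%:R / r + 1.
  apply: card_in_interval => [|i i']; first by rewrite divr_ge0 ?mulr_ge0 // ltW.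
  rewrite !inE => /andP[h1 _] /andP[_ h2].
  rewrite ler_pdivlMr // -ler_pdivrMr //.
  have -> : ((i' : nat)%:R - (i : nat)%:R) * r / M%:R =
    (c 0 k + r * (i' : nat)%:R / M%:R) - (c 0 k + r * (i : nat)%:R / M%:R) by ring.
  by rewrite /L; lra.
have cnt : M%:R ^+ d <= \sum_(j < J) \prod_k (L j k * M%:R / r + 1).
  apply: (@le_trans _ _ (\sum_(j < J) \prod_(k < d) \sum_(i < M) (i \in A j k)%:R)); last first.
    apply: ler_sum => j _; apply: ler_prod => k _.
    rewrite -natr_sum -big_mkcond /= sum1_card cA andbT.
    exact: ler0n.
  under eq_bigr do rewrite bigA_distr_bigA.
  rewrite exchange_big /=.
  have -> : M%:R ^+ d = \sum_(i : {ffun 'I_d -> 'I_M}) 1 :> R.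
    by rewrite sumr_const card_ffun !card_ord -natrX.
  apply: ler_sum => i _.
  have [|j jJ Uj] := QJ (\row_k (c 0 k + r * (i k : nat)%:R / M%:R)).
    move=> k; rewrite mxE lerDl lerD2l divr_ge0 ?mulr_ge0 ?ler0n ?ltW //=.
    by rewrite ltr_pdivrMr // ltr_pM2l // ltr_nat.
  rewrite (bigD1 (Ordinal jJ)) //= ler_wpDr //.
    by apply: sumr_ge0 => ? _; apply: prodr_ge0 => ? _; exact: ler0n.
  rewrite big1 // => k _; rewrite inE.
  by have := Uj k; rewrite mxE => ->.
have : r ^+ d <= e + e.
  have -> : r ^+ d = (r / M%:R) ^+ d * M%:R ^+ d by rewrite -exprMn mulfVK ?gt_eqF.
  apply: le_trans (ler_wpM2l _ cnt) _; first by rewrite exprn_ge0 // divr_ge0 // ltW.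
  apply: (@le_trans _ _ (\sum_(j < J) (vol (a j) (b j) + e / 2 ^+ j.+1))).
    rewrite mulr_sumr; apply: ler_sum => j _; have [h3 h4] := delP j.
    apply: le_trans h4.
    rewrite -[X in _ ^+ X]card_ord -prodr_const -big_split /=; apply: ler_prod => k _.
    apply/andP; split.
      by rewrite mulr_ge0 ?addr_ge0 ?divr_ge0 ?mulr_ge0 ?(L0 j k) ?(ltW r0) ?ler0n.
    have -> : r / M%:R * (L j k * M%:R / r + 1) = L j k + r / M%:R.
      by field; rewrite !gt_eqF.
    by have := Mdel j; rewrite /L; lra.
  rewrite big_split lerD //.
  have -> : \sum_(j < J) e / 2 ^+ j.+1 = e - e / 2 ^+ J.
    elim: J {QJ QU Mdel cnt} => [|K IH]; first by rewrite big_ord0 expr0 divr1 subrr.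
    rewrite big_ord_recr /= IH exprS.
    have : (2 ^+ K : R) != 0 by rewrite expf_neq0.
    by move=> h; field.
  by rewrite gerBl divr_ge0 ?ltW // exprn_gt0.
have := exprn_gt0 d r0; rewrite /e; lra.
Unshelve. all: by end_near. Qed.
End NullSets.

(** * Inner products on K^q and operator power series *)
Section ComplexReal.
Variable R : realType.
Local Notation C := (cplx R).
Implicit Types (c : C) (x y : R).

Definition cr (x : R) : C := (x%:C)%C.

Lemma crD x y : cr (x + y) = cr x + cr y. Proof. exact: rmorphD. Qed.
Lemma crB x y : cr (x - y) = cr x - cr y. Proof. exact: rmorphB. Qed.
Lemma crN x : cr (- x) = - cr x. Proof. exact: rmorphN. Qed.
Lemma crM x y : cr (x * y) = cr x * cr y. Proof. exact: rmorphM. Qed.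
Lemma crX x n : cr (x ^+ n) = cr x ^+ n. Proof. exact: rmorphXn. Qed.
Lemma cr0 : cr 0 = 0. Proof. exact: rmorph0. Qed.
Lemma cr1 : cr 1 = 1. Proof. exact: rmorph1. Qed.
Lemma cr_nat n : cr n%:R = n%:R. Proof. exact: rmorph_nat. Qed.
Lemma ler_cr x y : (cr x <= cr y) = (x <= y). Proof. exact: lecR. Qed.
Lemma ltr_cr x y : (cr x < cr y) = (x < y). Proof. exact: ltcR. Qed.
Lemma cr_ge0 x : (0 <= cr x) = (0 <= x). Proof. by rewrite -cr0 ler_cr. Qed.
Lemma cr_inj : injective cr. Proof. exact: complexI. Qed.
Lemma cr_Re c : 0 <= c -> cr (complex.Re c) = c.
Proof. by case: c => a b; rewrite lecE /= => /andP [/eqP -> _]. Qed.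
Lemma Re_ge0 c : 0 <= c -> 0 <= complex.Re c.
Proof. by move=> c0; rewrite -cr_ge0 cr_Re. Qed.
Lemma norm_cr x : `|cr x| = cr `|x|. Proof.
have [x0|x0] := lerP 0 x; first by rewrite !ger0_norm ?cr_ge0.
by rewrite !ltr0_norm ?crN // -cr0 ltr_cr.
Qed.
Lemma conj_cr x : (cr x)^* = cr x. Proof. exact: conjc_real. Qed.

(** The modulus on [C] takes values in [C]; this is the real number behind it, so that estimates
    take place in a totally ordered field. *)
Definition rabs c : R := complex.Re `|c|.
Lemma cr_rabs c : cr (rabs c) = `|c|. Proof. exact: cr_Re. Qed.
Lemma rabs_ge0 c : 0 <= rabs c. Proof. exact: Re_ge0. Qed.

End ComplexReal.

(** * Real-valued norm of a dot product *)

Section DotNorm.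
Variables (R : realType) (V : lmodType (cplx R)) (ip : {dot V for Num.conj}).
Local Notation C := (cplx R).
Implicit Types u v w : V.

Definition dnorm u : R := complex.Re (sqrtC (ip u u)).

Lemma cr_dnorm u : cr (dnorm u) = sqrtC (ip u u).
Proof. by rewrite cr_Re // sqrtC_ge0 dnorm_ge0. Qed.

Lemma cr_dnorm2 u : cr (dnorm u ^+ 2) = ip u u.
Proof. by rewrite crX cr_dnorm sqrtCK. Qed.

Lemma dnorm_nneg u : 0 <= dnorm u.
Proof. by rewrite Re_ge0 // sqrtC_ge0 dnorm_ge0. Qed.

Lemma dot_conj u v : ip u v = (ip v u)^*.
Proof. by have := @hermitian_subproof _ _ _ _ ip u v; rewrite expr0 mul1r. Qed.

Lemma dot_CauchySchwarz u v : `|ip u v| ^+ 2 <= ip u u * ip v v.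
Proof.
have [->|v0] := eqVneq v 0.
  by rewrite linear0r normr0 expr0n /=; apply: mulr_ge0; exact: dnorm_ge0.
have vv : 0 < ip v v by rewrite dnorm_gt0.
(* This is [ip v v] times the component of [u] orthogonal to [v], which avoids division. *)
have := dnorm_ge0 ip (ip v v *: u - ip u v *: v).
rewrite linearBl /= !linearZl_LR /= !linearBr /= !linearZr_LR /=.
rewrite -(dot_conj v v) -(dot_conj v u) => h.
rewrite -(ler_pM2l vv) normCK -(dot_conj v u) -subr_ge0.
by move: h; congr (is_true (0 <= _)); rewrite /GRing.scale /=; ring.
Qed.

Lemma dnormD_le u v : dnorm (u + v) <= dnorm u + dnorm v.
Proof.
rewrite -ler_cr crD -ler_sqr ?nnegrE ?addr_ge0 ?cr_ge0 ?dnorm_nneg //.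
rewrite sqrrD -!crX !cr_dnorm2 linearDl /= !linearDr /=.
rewrite [leLHS](_ : _ = ip u u + (ip u v + ip v u) + ip v v); last by ring.
rewrite lerD2r lerD2l -crM (dot_conj v u).
have h : `|ip u v| <= cr (dnorm u * dnorm v).
  rewrite -ler_sqr ?nnegrE ?normr_ge0 ?cr_ge0 ?mulr_ge0 ?dnorm_nneg //.
  by rewrite crM exprMn -(crX (dnorm u)) -(crX (dnorm v)) !cr_dnorm2; exact: dot_CauchySchwarz.
have : ip u v + (ip u v)^* <= `|ip u v| *+ 2.
  have := leif_Re_Creal (ip u v); rewrite ReE => -[h1 _].
  by move: h1; rewrite ler_pdivrMr ?ltr0n // mulr_natr.
by move/le_trans; apply; rewrite lerMn2r.
Qed.

Lemma dnormZ_eq c u : dnorm (c *: u) = rabs c * dnorm u.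
Proof.
apply: (@cr_inj R); rewrite crM cr_rabs !cr_dnorm dnormZ.
by rewrite sqrtCM ?nnegrE ?exprn_ge0 ?dnorm_ge0 // sqrCK.
Qed.

Lemma dnorm0_eq : dnorm 0 = 0.
Proof. by apply: (@cr_inj R); rewrite cr_dnorm linear0r sqrtC0 cr0. Qed.

Lemma dnormN_eq u : dnorm (- u) = dnorm u.
Proof. by apply: (@cr_inj R); rewrite !cr_dnorm hnormN. Qed.

Lemma dnormB_le u v : dnorm (u - v) <= dnorm u + dnorm v.
Proof. by rewrite -(dnormN_eq v); exact: dnormD_le. Qed.

Lemma dnorm_sum_le I (r : seq I) (P : pred I) (F : I -> V) :
  dnorm (\sum_(i <- r | P i) F i) <= \sum_(i <- r | P i) dnorm (F i).
Proof.
elim/big_ind2 : _ => [|x a y b xa yb|//]; first by rewrite dnorm0_eq.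
by apply: le_trans (dnormD_le _ _) _; exact: lerD.
Qed.

Lemma dnorm_eq0P u : dnorm u = 0 -> u = 0.
Proof.
move=> u0; apply/eqP; rewrite -(dnorm_eq0 ip) -cr_dnorm2 u0 expr0n /= cr0.
exact: eqxx.
Qed.

End DotNorm.

(** * The dot product on K^q *)

Section TensorDot.
Variables (R : realType) (K : lmodType (cplx R)) (ip : {dot K for Num.conj}) (q : nat).
Local Notation C := (cplx R).

Lemma fct_sumE I (r : seq I) (P : pred I) (F : I -> 'I_q -> K) i :
  (\sum_(j <- r | P j) F j) i = \sum_(j <- r | P j) F j i.
Proof. exact: (big_morph (fun h : 'I_q -> K => h i)). Qed.

(** The same sum as [tens_ip], over a plain left module, so that K^q becomes a space with a dot
    product to which the norm estimates above apply; K may then also be C itself. *)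
Definition dot_sum (h h' : 'I_q -> K) : C := \sum_i ip (h i) (h' i).

Lemma dsum_bilinear :
  bilinear_for (GRing.Scale.Law.clone _ _ ( *%R : C -> C -> C) _)
   (GRing.Scale.Law.clone _ _ (Num.conj \; *%R : C -> C -> C) _) (dot_sum).
Proof.
split=> [h' c h1 h2|h c h1 h2]; rewrite /dot_sum.
  rewrite -[RHS]/(c * _ + _) mulr_sumr -big_split; apply: eq_bigr => i _.
  by rewrite linearDl /= linearZl_LR.
rewrite -[RHS]/(c^* * _ + _) mulr_sumr -big_split; apply: eq_bigr => i _.
by rewrite linearDr /= linearZr_LR.
Qed.

HB.instance Definition _ := bilinear_isBilinear.Build C ('I_q -> K) ('I_q -> K) C
  _ _ (dot_sum) dsum_bilinear.

Lemma dsum_herm h h' : dot_sum h h' = (-1) ^+ false * Num.conj (dot_sum h' h).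
Proof.
rewrite expr0 mul1r /dot_sum rmorph_sum; apply: eq_bigr => i _.
exact: dot_conj.
Qed.

HB.instance Definition _ := @isHermitianSesquilinear.Build C ('I_q -> K) false Num.conj
  (dot_sum) dsum_herm.

Lemma dsum_pos (h : 'I_q -> K) : h != 0 -> 0 < dot_sum h h.
Proof.
move=> h0; rewrite lt_def /dot_sum sumr_ge0 ?andbT; last by move=> i _; exact: dnorm_ge0.
apply: contra h0; rewrite psumr_eq0 => [/allP z|i _]; last exact: dnorm_ge0.
apply/eqP/funext => i; apply/eqP; rewrite -(dnorm_eq0 ip).
exact: (z i (mem_index_enum _)).
Qed.

HB.instance Definition _ := @isDotProduct.Build C ('I_q -> K) (dot_sum) dsum_pos.

Definition ten_norm (h : 'I_q -> K) : R := dnorm dot_sum h.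

Lemma tnorm_sq h : cr (ten_norm h ^+ 2) = \sum_i ip (h i) (h i).
Proof. exact: cr_dnorm2. Qed.

Lemma tnorm_sqr h : ten_norm h ^+ 2 = \sum_i dnorm ip (h i) ^+ 2.
Proof.
apply: (@cr_inj R); rewrite tnorm_sq /cr rmorph_sum; apply: eq_bigr => i _.
by rewrite -[RHS]/(cr _) cr_dnorm2.
Qed.

Lemma dnorm_coord_le h i : dnorm ip (h i) <= ten_norm h.
Proof.
rewrite -(@ler_sqr R) ?nnegrE ?dnorm_nneg // tnorm_sqr (bigD1 i) //= lerDl.
by apply: sumr_ge0 => j _; exact: sqr_ge0.
Qed.

Lemma tnorm_le_sum h : ten_norm h <= \sum_i dnorm ip (h i).
Proof.
have s0 : 0 <= \sum_i dnorm ip (h i) by apply: sumr_ge0 => i _; exact: dnorm_nneg.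
rewrite -(@ler_sqr R) ?nnegrE ?dnorm_nneg // tnorm_sqr expr2 mulr_suml.
apply: ler_sum => i _; rewrite expr2 ler_wpM2l ?dnorm_nneg //.
rewrite (bigD1 i) //= lerDl; apply: sumr_ge0 => j _; exact: dnorm_nneg.
Qed.

End TensorDot.

Section MatrixAction.
Variables (R : realType) (K : lmodType (cplx R)).
Local Notation C := (cplx R).

Definition mxact p q (A : 'M[C]_(p, q)) (h : 'I_q -> K) : 'I_p -> K :=
  fun i => \sum_j A i j *: h j.

Lemma mxactM p q r (A : 'M[C]_(p, q)) (B : 'M[C]_(q, r)) h :
  mxact (A *m B) h = mxact A (mxact B h).
Proof.
apply/funext => i; rewrite /mxact.
under [RHS]eq_bigr do rewrite scaler_sumr.
rewrite exchange_big /=; apply: eq_bigr => j _; rewrite mxE scaler_suml.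
by apply: eq_bigr => l _; rewrite scalerA.
Qed.

Lemma mxactDl p q (A B : 'M[C]_(p, q)) h : mxact (A + B) h = mxact A h + mxact B h.
Proof.
apply/funext => i; rewrite /mxact -[RHS]/(_ + _) -big_split.
by apply: eq_bigr => j _; rewrite mxE scalerDl.
Qed.

Lemma mxactZl p q c (A : 'M[C]_(p, q)) h : mxact (c *: A) h = c *: mxact A h.
Proof.
apply/funext => i; rewrite /mxact -[RHS]/(_ *: _) scaler_sumr.
by apply: eq_bigr => j _; rewrite mxE scalerA.
Qed.

Lemma mxact0l p q h : mxact (0 : 'M[C]_(p, q)) h = 0.
Proof. by apply/funext => i; rewrite /mxact big1 // => j _; rewrite mxE scale0r. Qed.

Lemma mxactNl p q (A : 'M[C]_(p, q)) h : mxact (- A) h = - mxact A h.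
Proof. by rewrite -scaleN1r mxactZl scaleN1r. Qed.

Lemma mxact_suml p q I (r : seq I) (P : pred I) (F : I -> 'M[C]_(p, q)) h :
  mxact (\sum_(i <- r | P i) F i) h = \sum_(i <- r | P i) mxact (F i) h.
Proof. by apply: (big_morph (fun A => mxact A h)) => [A B|]; [exact: mxactDl|exact: mxact0l]. Qed.

Lemma mxact1 p h : mxact (1%:M : 'M[C]_p) h = h.
Proof.
apply/funext => i; rewrite /mxact (bigD1 i) //= mxE eqxx scale1r big1 ?addr0 // => j ji.
by rewrite mxE eq_sym (negbTE ji) scale0r.
Qed.

Lemma mxact_linear p q (A : 'M[C]_(p, q)) : linear (mxact A).
Proof.
move=> c h h'; apply/funext => i; rewrite /mxact -[RHS]/(_ *: _ + _) scaler_sumr -big_split.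
apply: eq_bigr => j _; rewrite -[(c *: h + h') j]/(c *: h j + h' j).
by rewrite scalerDr !scalerA mulrC.
Qed.
HB.instance Definition _ p q (A : 'M[C]_(p, q)) := GRing.isLinear.Build C ('I_q -> K) ('I_p -> K) _ (mxact A) (mxact_linear A).

Variable ip : {dot K for Num.conj}.
Local Notation dsum := (@dot_sum R K ip _).
Local Notation tnorm := (ten_norm ip).

Lemma dsum_mxact p q (A : 'M[C]_(p, q)) h h' :
  dsum (mxact A h) h' = dsum h (mxact (adjmx A) h').
Proof.
rewrite /dot_sum /mxact.
under eq_bigr do rewrite linear_sumlz.
under [RHS]eq_bigr do rewrite linear_sumr.
rewrite exchange_big /=; apply: eq_bigr => j _; apply: eq_bigr => i _.
by rewrite linearZl_LR /= linearZr_LR /= adjmxE conjCK.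
Qed.

Lemma dsum_isometry p q (U : 'M[C]_(p, q)) h h' : adjmx U *m U = 1%:M ->
  dsum (mxact U h) (mxact U h') = dsum h h'.
Proof. by move=> UU; rewrite dsum_mxact -mxactM UU mxact1. Qed.

Lemma tnorm_isometry p q (U : 'M[C]_(p, q)) h : adjmx U *m U = 1%:M ->
  tnorm (mxact U h) = tnorm h.
Proof. by move=> UU; rewrite /ten_norm /dnorm /= dsum_isometry. Qed.

Lemma dsum_psd_ge0 p (P : 'M[C]_p) h : psdmx P -> 0 <= dsum (mxact P h) h.
Proof.
move=> /psdmx_gramP [G ->].
by rewrite mxactM dsum_mxact adjmxK; exact: dnorm_ge0.
Qed.

(** A positive semidefinite scalar matrix has the form [adjmx G *m G] and hence acts as a positive
    operator on powers of [K]; inequalities between Gram matrices thus pass to operators. *)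
Lemma tnorm_mxact_le p q r (A : 'M[C]_(p, r)) (B : 'M[C]_(q, r)) h :
  psdmx (adjmx B *m B - adjmx A *m A) -> tnorm (mxact A h) <= tnorm (mxact B h).
Proof.
move=> /dsum_psd_ge0 P0; have := P0 h.
rewrite mxactDl mxactNl linearBl /= subr_ge0 !mxactM !dsum_mxact !adjmxK => le.
rewrite -ler_cr !cr_dnorm ler_sqrtC ?nnegrE ?dnorm_ge0 //.
by rewrite /= !dsum_mxact.
Qed.

Lemma mxact_bounded p q (A : 'M[C]_(p, q)) :
  exists2 c : R, 0 <= c & forall h, tnorm (mxact A h) <= c * tnorm h.
Proof.
exists (\sum_i \sum_j rabs (A i j)).
  by apply: sumr_ge0 => i _; apply: sumr_ge0 => j _; exact: rabs_ge0.
move=> h; apply: le_trans (tnorm_le_sum _ _) _; rewrite mulr_suml.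
apply: ler_sum => i _; apply: le_trans (dnorm_sum_le _ _ _ _) _; rewrite mulr_suml.
apply: ler_sum => j _; rewrite dnormZ_eq ler_wpM2l ?rabs_ge0 //.
exact: dnorm_coord_le.
Qed.

End MatrixAction.

Lemma sum_support (I : eqType) (V : nmodType) (s1 s2 : seq I) (F : I -> V) :
  uniq s1 -> uniq s2 -> (forall x, F x != 0 -> (x \in s1) = (x \in s2)) ->
  \sum_(x <- s1) F x = \sum_(x <- s2) F x.
Proof.
move=> u1 u2 H.
have red s : uniq s -> \sum_(x <- s) F x = \sum_(x <- [seq x <- s | F x != 0]) F x.
  move=> us; rewrite big_filter (bigID (fun x => F x != 0)) /= [X in _ + X]big1 ?addr0 //.
  by move=> x; rewrite negbK => /eqP.
rewrite (red s1) // (red s2) //; apply: perm_big; apply: uniq_perm; rewrite ?filter_uniq //.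
by move=> x; rewrite !mem_filter; case: (boolP (F x != 0)) => //= /H.
Qed.

(** * Multi-indices, boxes and geometric sums *)

Section MultiIndices.
Variable d : nat.
Local Notation midx := {ffun 'I_d -> nat}.

Definition tdeg (t : midx) : nat := (\sum_k t k)%N.
Definition mincr (k : 'I_d) (t : midx) : midx := [ffun l => (t l + (l == k))%N].
Definition mdecr (k : 'I_d) (t : midx) : midx := [ffun l => (t l - (l == k))%N].
Definition midx0 : midx := [ffun=> 0%N].

Lemma mincrK k : cancel (mincr k) (mdecr k).
Proof. by move=> t; apply/ffunP => l; rewrite !ffunE addnK. Qed.

Lemma mdecrK k (t : midx) : t k != 0%N -> mincr k (mdecr k t) = t.
Proof.
move=> tk; apply/ffunP => l; rewrite !ffunE subnK //.
by case: eqP => // ->; rewrite lt0n.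
Qed.

Lemma mincr_neq0 k (t : midx) : mincr k t k != 0%N.
Proof. by rewrite ffunE eqxx addn1. Qed.

Lemma tdeg_mincr k t : tdeg (mincr k t) = (tdeg t).+1.
Proof.
rewrite /tdeg; under eq_bigr do rewrite ffunE.
rewrite big_split /= [X in (_ + X)%N](bigD1 k) //= eqxx.
by rewrite [X in (_ + (_ + X))%N]big1 ?addn0 ?addn1 // => l /negbTE ->.
Qed.

Lemma tdeg0 : tdeg midx0 = 0%N.
Proof. by rewrite /tdeg big1 // => k _; rewrite ffunE. Qed.

Lemma tdeg_eq0 t : tdeg t = 0%N -> t = midx0.
Proof.
move/eqP; rewrite sum_nat_eq0 => /forallP h; apply/ffunP => k; rewrite ffunE.
by have := h k => /eqP.
Qed.

Lemma leq_tdeg (t : midx) k : (t k <= tdeg t)%N.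
Proof. by rewrite /tdeg (bigD1 k) //= leq_addr. Qed.

Definition membed N (s : {ffun 'I_d -> 'I_N.+1}) : midx := [ffun k => s k : nat].

Lemma membed_inj N : injective (@membed N).
Proof.
by move=> x y /ffunP xy; apply/ffunP => k; apply: val_inj; have := xy k; rewrite !ffunE.
Qed.

Definition mbox (N : nat) : {fset midx} :=
  [fset membed s | s in enum {: {ffun 'I_d -> 'I_N.+1}}]%fset.

Lemma big_mbox (V : nmodType) N (F : midx -> V) :
  \sum_(t <- mbox N) F t = \sum_(s : {ffun 'I_d -> 'I_N.+1}) F (membed s).
Proof. by rewrite big_imfset /= ?undup_id ?enum_uniq ?big_enum // => x y _ _; exact: membed_inj. Qed.

Lemma mem_mbox N t : (t \in mbox N) = [forall k, (t k <= N)%N].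
Proof.
apply/imfsetP/forallP => [[s _ ->] k|tN]; first by rewrite ffunE -ltnS.
exists [ffun k => Ordinal (tN k : t k < N.+1)%N]; first by rewrite mem_enum.
by apply/ffunP => k; rewrite !ffunE.
Qed.

(** An index in the support of [F] has degree [j < N], so its increment in direction [k] is still in
    the box, and [mdecr k] recovers it from that increment only. *)
Lemma mbox_shift (V : nmodType) (F : midx -> V) j N k : (j < N)%N ->
  (forall t, tdeg t != j -> F t = 0) ->
  \sum_(t <- mbox N) F t = \sum_(t <- mbox N | t k != 0%N) F (mdecr k t).
Proof.
move=> jN F0; rewrite -[RHS]big_filter -[RHS](big_map (mdecr k) predT F).
apply: sum_support => [||t Ft]; first exact: fset_uniq.
  rewrite map_inj_in_uniq ?filter_uniq ?fset_uniq // => s t.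
  rewrite !mem_filter => /andP [s0 _] /andP [t0 _] st.
  by rewrite -(mdecrK s0) st mdecrK.
have tj : tdeg t = j by apply/eqP; apply: contraNT Ft => /F0 ->.
have -> : t \in mbox N by rewrite mem_mbox; apply/forallP => l; apply: leq_trans (leq_tdeg t l) _; rewrite tj ltnW.
apply/esym/mapP; exists (mincr k t); last by rewrite mincrK.
rewrite mem_filter mincr_neq0 mem_mbox; apply/forallP => l.
by apply: leq_trans (leq_tdeg _ l) _; rewrite tdeg_mincr tj.
Qed.

(** After enlarging [J] to a box the sum factors into [d] geometric sums. *)
Lemma sum_geom_tdeg (R : realType) (s : R) (J : seq midx) : 0 <= s < 1 -> uniq J ->
  \sum_(t <- J) s ^+ tdeg t <= (1 - s)^-1 ^+ d.
Proof.
move=> /andP [s0 s1] uJ.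
pose N := (\max_(t <- J) tdeg t)%N.
apply: (@le_trans _ _ (\sum_(t <- mbox N) s ^+ tdeg t)).
  rewrite [leRHS](bigID (mem J)) ler_wpDr //; first by apply: sumr_ge0 => t _; exact: exprn_ge0.
  rewrite -[leRHS]big_filter le_eqVlt; apply/orP; left; apply/eqP; apply: perm_big.
  apply: uniq_perm; rewrite ?filter_uniq ?fset_uniq // => t.
  apply/esym; rewrite mem_filter; apply: andb_idr => tJ.
  rewrite mem_mbox; apply/forallP => k; apply: leq_trans (leq_tdeg t k) _.
  by rewrite /N (big_rem t tJ) /= leq_maxl.
rewrite big_mbox.
under eq_bigr => t _.
  rewrite /tdeg -prodrXr; under eq_bigr do rewrite ffunE; over.
rewrite -(bigA_distr_bigA (fun _ (i : 'I_N.+1) => s ^+ i)) prodr_const card_ord.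
rewrite lerXn2r ?nnegrE ?invr_ge0 ?subr_ge0 ?(ltW s1) //.
  by apply: sumr_ge0 => i _; exact: exprn_ge0.
have s1' : 0 < 1 - s by rewrite subr_gt0.
rewrite -[leLHS]/(\sum_(j < N.+1) s ^+ j) -[leRHS]div1r ler_pdivlMr //.
have := subrX1 s N.+1; have := exprn_ge0 N.+1 s0.
move: (s ^+ N.+1) (\sum_(j < N.+1) s ^+ j) => x y; nra.
Qed.

End MultiIndices.

(** * Taylor coefficients of the resolvent of U Z *)

Section TaylorCoefficients.
Variables (R : realType) (d q n : nat).
Local Notation C := (cplx R).
Local Notation midx := {ffun 'I_d -> nat}.
Variables (kap : 'I_q -> 'I_d) (U : 'M[C]_q) (b : 'M[C]_(q, n)).
Hypothesis UU : adjmx U *m U = 1%:M.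

Definition blockproj (k : 'I_d) : 'M[C]_q := diag_mx (\row_i (kap i == k)%:R).

Lemma blockprojE p k (A : 'M[C]_(q, p)) i j :
  (blockproj k *m A) i j = (kap i == k)%:R * A i j.
Proof. by rewrite mul_diag_mx !mxE. Qed.

Lemma blockproj_sum p (A : 'M[C]_(q, p)) : \sum_k blockproj k *m A = A.
Proof.
apply/matrixP => i j; rewrite summxE (bigD1 (kap i)) //= blockprojE eqxx mul1r.
by rewrite big1 ?addr0 // => k /negbTE nk; rewrite blockprojE eq_sym nk mul0r.
Qed.

(* Taylor coefficients of (1 + U Z)^-1 b with Z = diag(zeta_(kap i)), by total
   degree: [tcoef j t] is the coefficient of zeta^t in (- U Z)^j b. *)
Fixpoint tcoef (j : nat) (t : midx) : 'M[C]_(q, n) :=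
  if j is j'.+1 then
    - (U *m \sum_(k | t k != 0%N) blockproj k *m tcoef j' (mdecr k t))
  else if t == midx0 d then b else 0.

Lemma tcoef_supp j t : tdeg t != j -> tcoef j t = 0.
Proof.
elim: j t => [|j IH] t tj /=.
  by case: eqP => // t0; move: tj; rewrite t0 tdeg0.
rewrite big1 ?mulmx0 ?oppr0 // => k tk; rewrite IH ?mulmx0 //.
by apply: contraNneq tj => tj; rewrite -(mdecrK tk) tdeg_mincr tj.
Qed.

Definition sqnorm p (y : 'cV[C]_p) : C := (adjmx y *m y) 0 0.

Lemma sqnormE p (y : 'cV[C]_p) : sqnorm y = \sum_i `|y i 0| ^+ 2.
Proof.
by rewrite /sqnorm mxE; apply: eq_bigr => i _; rewrite adjmxE mulrC -normCK.
Qed.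

Lemma sqnorm0 p : sqnorm (0 : 'cV[C]_p) = 0.
Proof. by rewrite /sqnorm mulmx0 mxE. Qed.

Lemma sqnormN p (y : 'cV[C]_p) : sqnorm (- y) = sqnorm y.
Proof. by rewrite !sqnormE; apply: eq_bigr => i _; rewrite mxE normrN. Qed.

Lemma sqnorm_isometry (y : 'cV[C]_q) : sqnorm (U *m y) = sqnorm y.
Proof. by rewrite /sqnorm adjmxM mulmxA -[_ *m U]mulmxA UU mulmx1. Qed.

Lemma sqnorm_proj_sum (y : 'I_d -> 'cV[C]_q) (P : pred 'I_d) :
  sqnorm (\sum_(k | P k) blockproj k *m y k) = \sum_(k | P k) sqnorm (blockproj k *m y k).
Proof.
under [RHS]eq_bigr do rewrite sqnormE.
rewrite sqnormE exchange_big /=; apply: eq_bigr => i _.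
under [RHS]eq_bigr do rewrite blockprojE.
have -> : (\sum_(k | P k) blockproj k *m y k) i 0 = \sum_(k | P k) (kap i == k)%:R * y k i 0.
  by rewrite summxE; apply: eq_bigr => k _; rewrite blockprojE.
have z k : kap i != k -> (kap i == k)%:R * y k i 0 = 0 by move=> /negbTE ->; rewrite mul0r.
case: (boolP (P (kap i))) => Pi.
  rewrite (bigD1 (kap i)) //= [X in _ + X]big1 => [|k /andP [_ nk]]; last by rewrite z // eq_sym.
  rewrite [RHS](bigD1 (kap i)) //= [X in _ = _ + X]big1 => [|k /andP [_ nk]]; last first.
    by rewrite z ?normr0 ?expr0n // eq_sym.
  by rewrite !addr0.
have nP k : P k -> kap i != k by apply: contraTneq => <-.
rewrite [RHS]big1 => [|k /nP nk]; last by rewrite z // normr0 expr0n.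
by rewrite big1 ?normr0 ?expr0n // => k /nP nk; rewrite z.
Qed.

Lemma sqnorm_proj (y : 'cV[C]_q) : \sum_k sqnorm (blockproj k *m y) = sqnorm y.
Proof. by rewrite -(sqnorm_proj_sum (fun=> y)) blockproj_sum. Qed.

(** [U] is isometric and the block projections are orthogonal, so the recursion only redistributes
    the mass of level [j] over the indices of degree [j + 1]: the total never changes. *)
Lemma tcoef_sqnorm (y : 'cV[C]_n) j N : (j <= N)%N ->
  \sum_(t <- mbox d N) sqnorm (tcoef j t *m y) = sqnorm (b *m y).
Proof.
elim: j => [|j IH] jN /=.
  rewrite (bigD1_seq (midx0 d)) ?fset_uniq //=; last first.
    by rewrite mem_mbox; apply/forallP => k; rewrite ffunE.
  by rewrite eqxx big1 ?addr0 // => t /negbTE ->; rewrite mul0mx sqnorm0.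
rewrite -(IH (ltnW jN)).
transitivity (\sum_(t <- mbox d N) \sum_(k | t k != 0%N)
    sqnorm (blockproj k *m (tcoef j (mdecr k t) *m y))).
  apply: eq_bigr => t _.
  rewrite -(sqnorm_proj_sum (fun k => tcoef j (mdecr k t) *m y)).
  rewrite mulNmx sqnormN -mulmxA sqnorm_isometry mulmx_suml.
  by under eq_bigr do rewrite -mulmxA.
rewrite (exchange_big_dep predT) //= -[RHS](eq_bigr _ (fun t _ => sqnorm_proj _)).
rewrite [RHS]exchange_big /=; apply: eq_bigr => k _.
rewrite [RHS](mbox_shift k jN) // => t tj.
by rewrite tcoef_supp // mul0mx mulmx0 sqnorm0.
Qed.

(** A single coefficient is bounded by the total mass of its level. The bound is uniform in [t], so
    that the series is dominated by a geometric one. *)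
Lemma tcoef_psd j t : psdmx (adjmx b *m b - adjmx (tcoef j t) *m tcoef j t).
Proof.
split; first by rewrite adjmx_hermsym adjmxB !adjmxM !adjmxK.
move=> y; rewrite mulmxBr mulmxBl !mulmxA -!adjmxM -2!mulmxA mxE [X in _ + X]mxE.
rewrite subr_ge0 -/(sqnorm (b *m y)) -/(sqnorm (tcoef j t *m y)).
have sq0 p (z : 'cV[C]_p) : 0 <= sqnorm z by exact: adjmx_self_ge0.
have [/eqP tj|tj] := boolP (tdeg t == j); last by rewrite tcoef_supp // mul0mx sqnorm0.
rewrite -(tcoef_sqnorm y (leqnn j)) (bigD1_seq t) ?fset_uniq //=.
  by rewrite lerDl sumr_ge0.
by rewrite mem_mbox; apply/forallP => k; rewrite -tj leq_tdeg.
Qed.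

End TaylorCoefficients.

(** * Monomials in commuting operators *)

Section OperatorMonomials.
Variables (R : realType) (d : nat) (K : lmodType (cplx R)).
Local Notation C := (cplx R).
Local Notation midx := {ffun 'I_d -> nat}.
Variables (T : 'I_d -> {linear K -> K}).
Hypothesis Tcomm : forall k l x, T k (T l x) = T l (T k x).

Definition opmon (t : midx) : K -> K :=
  \big[(fun g h : K -> K => g \o h)/idfun]_(k < d) iter (t k) (T k).

Lemma iter_comm (f g : K -> K) m x : (forall y, f (g y) = g (f y)) ->
  iter m f (g x) = g (iter m f x).
Proof. by move=> fg; elim: m => //= m ->. Qed.

Lemma opmon_mincr k t x : opmon (mincr k t) x = T k (opmon t x).
Proof.
have H (r : seq 'I_d) : uniq r ->
  (\big[(fun g h : K -> K => g \o h)/idfun]_(l <- r) iter (mincr k t l) (T l)) x =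
  if k \in r then T k ((\big[(fun g h : K -> K => g \o h)/idfun]_(l <- r) iter (t l) (T l)) x)
  else (\big[(fun g h : K -> K => g \o h)/idfun]_(l <- r) iter (t l) (T l)) x.
  elim: r => [|l r IH] /=; first by rewrite !big_nil.
  move=> /andP [lr /IH {}IH]; rewrite !big_cons /= IH in_cons ffunE.
  have [->|kl] := eqVneq k l; first by rewrite addn1 (negbTE lr).
  rewrite addn0 /=; case: ifP => // _.
  by rewrite iter_comm // => y; rewrite Tcomm.
by rewrite /opmon (H _ (index_enum_uniq _)) mem_index_enum.
Qed.

Lemma opmon0 x : opmon (midx0 d) x = x.
Proof.
rewrite /opmon; elim: (index_enum _) => [|l r IH]; first by rewrite big_nil.
by rewrite big_cons /= ffunE IH.
Qed.

Lemma opmon_linear t : linear (opmon t).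
Proof.
move=> c x y; rewrite /opmon; elim: (index_enum _) => [|l r IH]; first by rewrite !big_nil.
rewrite !big_cons /= IH; elim: (t l) => //= m ->; exact: linearP.
Qed.
HB.instance Definition _ t := GRing.isLinear.Build C K K _ (opmon t) (opmon_linear t).

Lemma opmon_norm (ip : {dot K for Num.conj}) (s : R) t x : 0 <= s ->
  (forall k x, dnorm ip (T k x) <= s * dnorm ip x) ->
  dnorm ip (opmon t x) <= s ^+ tdeg t * dnorm ip x.
Proof.
move=> s0 Ts; rewrite /opmon /tdeg.
elim: (index_enum _) => [|l r IH]; first by rewrite !big_nil expr0 mul1r.
rewrite !big_cons /= exprD -mulrA; apply: le_trans (_ : s ^+ t l * dnorm ip _ <= _).
  set y := (_ : K -> K) x; elim: (t l) => [|m IHm] /=; first by rewrite mul1r.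
  apply: le_trans (Ts _ _) _; rewrite exprS -mulrA ler_wpM2l //; exact: IHm.
by rewrite ler_wpM2l // exprn_ge0.
Qed.

Variables (q n : nat) (kap : 'I_q -> 'I_d) (U : 'M[C]_q) (b : 'M[C]_(q, n)).

Definition tmap p (t : midx) (h : 'I_p -> K) : 'I_p -> K := fun i => opmon t (h i).

Lemma tmap_linear p t : linear (@tmap p t).
Proof. by move=> c h h'; apply/funext => i; rewrite /tmap -[RHS]/(_ *: _ + _) linearP. Qed.
HB.instance Definition _ p t := GRing.isLinear.Build C ('I_p -> K) ('I_p -> K) _
  (@tmap p t) (@tmap_linear p t).

Lemma tmap_mxact p r t (A : 'M[C]_(p, r)) h : tmap t (mxact A h) = mxact A (tmap t h).
Proof.
apply/funext => i; rewrite /tmap /mxact linear_sum; apply: eq_bigr => j _.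
by rewrite linearZ.
Qed.

(* U Z(T) on K^q, where Z(T) acts as T_(kap i) on the i-th coordinate *)
Definition colmap (h : 'I_q -> K) : 'I_q -> K := mxact U (fun i => T (kap i) (h i)).

Lemma colmap_linear : linear colmap.
Proof.
move=> c h h'; rewrite /colmap -linearP; congr (mxact U _).
by apply/funext => i; rewrite -[RHS]/(_ *: _ + _) -linearP.
Qed.
HB.instance Definition _ := GRing.isLinear.Build C ('I_q -> K) ('I_q -> K) _
  colmap colmap_linear.

Lemma mxact_blockproj k (h : 'I_q -> K) i :
  mxact (blockproj R kap k) h i = if kap i == k then h i else 0.
Proof.
rewrite /mxact (bigD1 i) //= !mxE eqxx mulr1n big1 ?addr0 => [|j ji].
  by case: eqP => _; rewrite ?scale1r ?scale0r.
by rewrite !mxE [i == j]eq_sym (negbTE ji) mulr0n scale0r.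
Qed.

Lemma colmap_tmap t (A : 'M[C]_(q, n)) x :
  colmap (tmap t (mxact A x)) =
  \sum_k tmap (mincr k t) (mxact (U *m blockproj R kap k *m A) x).
Proof.
have E k : tmap (mincr k t) (mxact (U *m blockproj R kap k *m A) x) =
    mxact U (mxact (blockproj R kap k) (tmap (mincr k t) (mxact A x))).
  by rewrite -mulmxA !mxactM !tmap_mxact.
under eq_bigr do rewrite E.
rewrite -linear_sum; congr (mxact U _); apply/funext => i.
rewrite fct_sumE (bigD1 (kap i)) //= big1 ?addr0 => [|k nk]; rewrite mxact_blockproj.
  by rewrite eqxx /tmap opmon_mincr.
by rewrite eq_sym (negbTE nk).
Qed.

(** Operator form of the recursion of [tcoef]: commutativity of [T] collects all words of length [j]
    with the same multi-index. *)
Lemma colmap_iter j N x : (j <= N)%N ->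
  iter j (fun h => - colmap h) (mxact b x) =
  \sum_(t <- mbox d N) tmap t (mxact (tcoef kap U b j t) x).
Proof.
elim: j => [|j IH] jN.
  rewrite /= (bigD1_seq (midx0 d)) ?fset_uniq //=; last first.
    by rewrite mem_mbox; apply/forallP => k; rewrite ffunE.
  rewrite eqxx [X in _ + X]big1 ?addr0 => [|t /negbTE ->]; last by rewrite mxact0l linear0.
  by apply/funext => i; rewrite /tmap opmon0.
rewrite iterS IH ?(ltnW jN) // linear_sum /= -sumrN.
pose F k t := tmap (mincr k t) (mxact (- (U *m blockproj R kap k *m tcoef kap U b j t)) x).
transitivity (\sum_(t <- mbox d N) \sum_k F k t).
  apply: eq_bigr => t _; rewrite colmap_tmap -sumrN; apply: eq_bigr => k _.
  by rewrite /F mxactNl linearN.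
rewrite exchange_big /=.
transitivity (\sum_k \sum_(t <- mbox d N | t k != 0%N) F k (mdecr k t)).
  apply: eq_bigr => k _; apply: mbox_shift jN _ => t tj.
  by rewrite /F tcoef_supp // mulmx0 oppr0 mxact0l linear0.
rewrite (exchange_big_dep predT) //=; apply: eq_bigr => t _.
rewrite mulmx_sumr -sumrN mxact_suml linear_sum; apply: eq_bigr => k tk.
by rewrite /F mdecrK // mulmxA.
Qed.

End OperatorMonomials.

Lemma expr_small (R : realType) (s c e : R) : 0 <= s < 1 -> 0 <= c -> 0 < e ->
  exists N : nat, s ^+ N * c <= e.
Proof.
move=> /andP [s0 s1] c0 e0.
have cc : 0 < c + 1 by rewrite ltr_wpDl.
have h : `|s| < 1 by rewrite ger0_norm.
have := cvg_expr h => /cvgrPdist_lt /(_ (e / (c + 1))) [|N _ /(_ N (leqnn N))].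
  by rewrite divr_gt0.
rewrite /= sub0r normrN ger0_norm ?exprn_ge0 // ltr_pdivlMr // => lt.
exists N; apply: le_trans (ltW lt).
by rewrite ler_wpM2l ?exprn_ge0 // lerDl.
Qed.

(** * Summation of the power series at a commuting tuple of strict contractions *)

Section PowerSeriesSum.
Variables (R : realType) (d : nat) (K : lmodType (cplx R)) (ip : {dot K for Num.conj}).
Local Notation C := (cplx R).
Local Notation midx := {ffun 'I_d -> nat}.
Local Notation tnorm := (ten_norm ip).
Local Notation dsum := (@dot_sum R K ip _).
Variables (T : 'I_d -> {linear K -> K}) (s : R).
Hypothesis Tcomm : forall k l x, T k (T l x) = T l (T k x).
Hypothesis s01 : 0 <= s < 1.
(** The contraction constant is written as a square: for degrees above [N] one factor [s] gives the
    decay [s ^+ N], the other a convergent geometric series. *)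
Hypothesis Ts : forall k x, dnorm ip (T k x) <= s ^+ 2 * dnorm ip x.
Variables (q n : nat) (kap : 'I_q -> 'I_d) (U : 'M[C]_q) (b : 'M[C]_(q, n)).
Hypothesis UU : adjmx U *m U = 1%:M.
Local Notation X := (colmap T kap U).
Local Notation hc t := (tcoef kap U b (tdeg t) t).

Let s0 : 0 <= s. Proof. by have /andP[] := s01. Qed.
Let s1 : s < 1. Proof. by have /andP[] := s01. Qed.

Lemma ten_norm_le (p : nat) (c : R) (h h' : 'I_p -> K) : 0 <= c ->
  (forall i, dnorm ip (h i) <= c * dnorm ip (h' i)) -> tnorm h <= c * tnorm h'.
Proof.
move=> c0 hh'; rewrite -(@ler_sqr R) ?nnegrE ?mulr_ge0 ?dnorm_nneg //.
rewrite exprMn !tnorm_sqr mulr_sumr; apply: ler_sum => i _.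
by rewrite -exprMn ler_sqr ?nnegrE ?mulr_ge0 ?dnorm_nneg.
Qed.

Lemma colmap_norm h : tnorm (X h) <= s ^+ 2 * tnorm h.
Proof. by rewrite /colmap tnorm_isometry //; apply: ten_norm_le => [|i]; rewrite ?exprn_ge0. Qed.

Lemma tmap_norm p t (h : 'I_p -> K) : tnorm (tmap T t h) <= (s ^+ 2) ^+ tdeg t * tnorm h.
Proof.
apply: ten_norm_le => [|i]; first by rewrite !exprn_ge0.
by apply: opmon_norm => //; rewrite exprn_ge0.
Qed.

Lemma iter_colmap_linear j : linear (iter j (fun h => - X h)).
Proof.
by move=> c x y; elim: j => //= j ->; rewrite linearP opprD scalerN.
Qed.

Lemma iter_colmap_norm j h : tnorm (iter j (fun h => - X h) h) <= (s ^+ 2) ^+ j * tnorm h.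
Proof.
elim: j => [|j IH] /=; first by rewrite mul1r.
rewrite /ten_norm dnormN_eq exprS -mulrA; apply: le_trans (colmap_norm _) _.
by rewrite ler_wpM2l ?exprn_ge0.
Qed.

Variables (x : 'I_n -> K) (H : 'I_q -> K).
Hypothesis HE : H = mxact b x - X H.

Lemma resolvent_norm : tnorm H <= (1 - s)^-1 * tnorm (mxact b x).
Proof.
have s1' : 0 < 1 - s by rewrite subr_gt0.
rewrite mulrC ler_pdivlMr //.
have : tnorm H <= tnorm (mxact b x) + s ^+ 2 * tnorm H.
  rewrite {1}HE; apply: le_trans (dnormB_le _ _ _) _; rewrite lerD2l; exact: colmap_norm.
have := dnorm_nneg dsum H; rewrite -/(tnorm H).
move: (tnorm H) (tnorm _) => y z y0 h; have := mulr_ge0 y0 (mulr_ge0 s0 (ltW s1')).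
by move: h; rewrite expr2; nra.
Qed.

Lemma resolvent_partial N :
  H - \sum_(j < N) iter j (fun h => - X h) (mxact b x) = iter N (fun h => - X h) H.
Proof.
elim: N => [|N IH]; first by rewrite big_ord0 subr0.
rewrite big_ord_recr opprD addrA IH iterSr.
rewrite [X in iter N _ X - _ = _]HE.
have lin := iter_colmap_linear N.
have := lin 1 (mxact b x) (- X H); rewrite !scale1r => ->.
by rewrite addrAC /= subrr add0r.
Qed.

(** [tcoef j t] vanishes unless [j] is the degree of [t], so the terms of degree at most [N] regroup
    into the first [N + 1] terms of the Neumann series. *)
Lemma taylor_partial N (J : {fset midx}) : (mbox d N `<=` J)%fset ->
  \sum_(t <- J | (tdeg t <= N)%N) tmap T t (mxact (hc t) x) =
  \sum_(j < N.+1) iter j (fun h => - X h) (mxact b x).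
Proof.
move=> /fsubsetP NJ.
transitivity (\sum_(j < N.+1) \sum_(t <- mbox d N) tmap T t (mxact (tcoef kap U b j t) x)); last first.
  by apply: eq_bigr => j _; rewrite (colmap_iter Tcomm kap U b x (N := N)) // -ltnS.
rewrite exchange_big /= -[LHS]big_filter.
transitivity (\sum_(t <- [seq t <- mbox d N | (tdeg t <= N)%N]) tmap T t (mxact (hc t) x)).
  apply: sum_support; rewrite ?filter_uniq ?fset_uniq // => t _.
  rewrite !mem_filter; case: leqP => //= tN.
  have tb : t \in mbox d N by rewrite mem_mbox; apply/forallP => k; exact: leq_trans (leq_tdeg t k) tN.
  by rewrite tb; exact: NJ.
rewrite big_filter big_mkcond; apply: eq_bigr => t _.
case: leqP => tN.
  rewrite (bigD1 (Ordinal (tN : (tdeg t < N.+1)%N))) //= big1 ?addr0 // => j jt.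
  rewrite tcoef_supp ?mxact0l ?linear0 //.
  by apply: contra jt => /eqP tj; apply/eqP/val_inj.
rewrite big1 // => j _; rewrite tcoef_supp ?mxact0l ?linear0 //.
by rewrite gtn_eqF // (leq_trans _ tN) // ltnS -ltnS.
Qed.

Lemma taylor_estimate N (J : {fset midx}) : (mbox d N `<=` J)%fset ->
  tnorm (\sum_(t <- J) tmap T t (mxact (hc t) x) - H) <=
  s ^+ N * ((1 - s)^-1 ^+ d + (1 - s)^-1) * tnorm (mxact b x).
Proof.
move=> NJ; set B := tnorm (mxact b x).
have B0 : 0 <= B by exact: dnorm_nneg.
rewrite (bigID (fun t : midx => (tdeg t <= N)%N)) /= (taylor_partial NJ).
rewrite addrAC -[X in X + _]opprB resolvent_partial addrC.
apply: le_trans (dnormB_le _ _ _) _; rewrite mulrDr mulrDl; apply: lerD.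
  apply: le_trans (dnorm_sum_le _ _ _ _) _.
  apply: (@le_trans _ _ (\sum_(t <- J) s ^+ N * s ^+ tdeg t * B)).
    rewrite [leRHS](bigID (fun t : midx => (tdeg t <= N)%N)) /=.
    rewrite ler_wpDl //; first by apply: sumr_ge0 => t _; rewrite !mulr_ge0 ?exprn_ge0.
    apply: ler_sum => t; rewrite -ltnNge => tN.
    apply: le_trans (tmap_norm _ _) _; apply: ler_pM; rewrite ?exprn_ge0 ?dnorm_nneg //.
      rewrite -exprM mul2n -addnn exprD ler_wpM2r ?exprn_ge0 //.
      by rewrite ler_wiXn2l ?(ltW s1) // ltnW.
    exact/tnorm_mxact_le/tcoef_psd.
  rewrite -mulr_suml -mulr_sumr; apply: ler_wpM2r => //.
  by apply: ler_wpM2l; rewrite ?exprn_ge0 // sum_geom_tdeg ?fset_uniq.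
apply: le_trans (iter_colmap_norm _ _) _.
rewrite -mulrA; apply: ler_pM; rewrite ?exprn_ge0 ?dnorm_nneg //; last exact: resolvent_norm.
rewrite -exprM ler_wiXn2l ?(ltW s1) // mul2n -addnn; lia.
Qed.

(** Taylor coefficients of [2 b^* (1 + U Z)^-1 b - b^* b]; the subtracted constant contributes at
    [midx0] alone. [real_value] is the same expression at operators, with [H] in the role of the
    resolvent applied to [b x]. *)
Definition real_coef (t : midx) : 'M[C]_n :=
  2%:R *: (adjmx b *m hc t) - (if t == midx0 d then adjmx b *m b else 0).

Definition real_value : 'I_n -> K :=
  2%:R *: mxact (adjmx b) H - mxact (adjmx b *m b) x.

Lemma real_partial (J : {fset midx}) : midx0 d \in J ->
  \sum_(t <- J) mxact (real_coef t) (tmap T t x) - real_value =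
  2%:R *: mxact (adjmx b) (\sum_(t <- J) tmap T t (mxact (hc t) x) - H).
Proof.
move=> J0; apply/eqP; rewrite subr_eq; apply/eqP.
rewrite [mxact _ (_ - H)]linearB /= scalerBr /real_value addrA subrK.
rewrite linear_sum scaler_sumr.
have -> : mxact (adjmx b *m b) x = \sum_(t <- J)
    mxact (if t == midx0 d then adjmx b *m b else 0) (tmap T t x).
  rewrite (bigD1_seq (midx0 d)) ?fset_uniq //= eqxx big1 ?addr0 => [|t /negbTE ->]; last exact: mxact0l.
  by congr mxact; apply/funext => i; rewrite /tmap opmon0.
rewrite -sumrB; apply: eq_bigr => t _ /=.
by rewrite /real_coef mxactDl mxactNl mxactZl mxactM tmap_mxact.
Qed.

(** With [b x = H + X H] the sum collapses to [2 (|H|^2 - |X H|^2)], which is nonnegative because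
    [X] is a contraction. *)
Lemma real_value_accretive : 0 <= dsum real_value x + dsum x real_value.
Proof.
have bx : mxact b x = H + X H by rewrite {1}HE subrK.
rewrite /real_value !linearBl !linearBr /= !linearZl_LR !linearZr_LR /=.
rewrite conjC_nat !mxactM !dsum_mxact !adjmxK.
rewrite -[dsum x (mxact _ H)]/(dsum x (mxact (adjmx b) H)).
have E y : dsum x (mxact (adjmx b) y) = dsum (mxact b x) y by rewrite dsum_mxact.
rewrite !E bx !linearDl /= !linearDr /=.
have le : dsum (X H) (X H) <= dsum H H.
  rewrite -!cr_dnorm2 ler_cr ler_sqr ?nnegrE ?dnorm_nneg //.
  apply: le_trans (colmap_norm _) _; rewrite ler_piMl ?dnorm_nneg //.
  by rewrite exprn_ile1 // ltW.
move: le; rewrite -subr_ge0 => le.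
have := addr_ge0 le le; congr (is_true (_ <= _)).
set a := dsum H H; set c := dsum (X H) (X H); set e := dsum H (X H); set f := dsum (X H) H.
rewrite /GRing.scale /=. ring.
Qed.

End PowerSeriesSum.

(** * Bessmertnyi functions are Herglotz-Agler and Cayley inner *)
Section Pencils.
Variables (R : realType) (d n m : nat).
Local Notation C := (cplx R).
Local Notation poly_d := (mpoly d C).
Variable A : 'I_d -> 'M[C]_(n + m).

Definition schur (F : comUnitRingType) (M : 'M[F]_(n + m)) : 'M[F]_n :=
  ulsubmx M - ursubmx M *m invmx (drsubmx M) *m dlsubmx M.

Definition pencil_at (z : 'I_d -> C) : 'M[C]_(n + m) := \sum_k z k *: A k.

Definition ppencil : 'M[poly_d]_(n + m) :=
  \sum_k mpolyX C (mnm1 k) *: map_mx (@mpolyC d C) (A k).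

Definition pdelta : poly_d := \det (drsubmx ppencil).

(** The adjugate replaces the inverse, which leaves a polynomial numerator over the common
    denominator [pdelta]. *)
Definition pschur : 'M[poly_d]_n :=
  pdelta *: ulsubmx ppencil - ursubmx ppencil *m \adj (drsubmx ppencil) *m dlsubmx ppencil.

Lemma pencil_ppencil : pencil A = map_mx (@tofrac _) ppencil.
Proof.
rewrite /pencil /ppencil; apply/matrixP => i j.
rewrite [RHS]mxE !summxE rmorph_sum; apply: eq_bigr => k _.
by rewrite !mxE /rconst /rvar -tofracM.
Qed.

Lemma meval_ppencil z : map_mx (meval z) ppencil = pencil_at z.
Proof.
apply/matrixP => i j; rewrite mxE !summxE rmorph_sum; apply: eq_bigr => k _.
by rewrite !mxE rmorphM /= mevalXU mevalC.
Qed.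

Lemma det_pencil : \det (drsubmx (pencil A)) = tofrac pdelta.
Proof. by rewrite pencil_ppencil -map_drsubmx det_map_mx. Qed.

Lemma schur_adj (F : fieldType) (M : 'M[F]_(n + m)) : \det (drsubmx M) != 0 ->
  \det (drsubmx M) *: schur M = \det (drsubmx M) *: ulsubmx M
    - ursubmx M *m \adj (drsubmx M) *m dlsubmx M.
Proof.
move=> d0; rewrite /schur scalerBr; congr (_ - _).
rewrite /invmx unitmxE unitfE d0 -scalemxAr -scalemxAl scalerA mulfV // scale1r.
by [].
Qed.

Lemma schur_pencil i j : pdelta != 0 ->
  schur (pencil A) i j = tofrac (pschur i j) / tofrac pdelta.
Proof.
move=> d0; have t0 : \det (drsubmx (pencil A)) != 0 by rewrite det_pencil tofrac_eq0.
have := schur_adj t0 => /matrixP /(_ i j); rewrite det_pencil in t0 *.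
rewrite mxE => E; rewrite -[LHS](mulKf t0) E mulrC; congr (_ / _).
rewrite pencil_ppencil -map_drsubmx -map_ursubmx -map_dlsubmx -map_ulsubmx -map_mx_adj.
by rewrite -map_mxZ -!map_mxM -map_mxB mxE.
Qed.

Lemma meval_pdelta z : meval z pdelta = \det (drsubmx (pencil_at z)).
Proof. by rewrite -meval_ppencil -map_drsubmx det_map_mx. Qed.

Lemma meval_pschur z i j : \det (drsubmx (pencil_at z)) != 0 ->
  meval z (pschur i j) = meval z pdelta * schur (pencil_at z) i j.
Proof.
move=> d0; have := schur_adj d0 => /matrixP /(_ i j).
rewrite -meval_pdelta mxE => ->; rewrite -meval_ppencil.
have -> : meval z (pschur i j) = map_mx (meval z) pschur i j by rewrite [RHS]mxE.
rewrite /pschur map_mxB map_mxZ !map_mxM map_mx_adj.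
by rewrite map_drsubmx map_ursubmx map_dlsubmx map_ulsubmx.
Qed.

End Pencils.

Lemma det_neq0_ker (F : fieldType) (m : nat) (M : 'M[F]_m) :
  (forall y : 'cV[F]_m, M *m y = 0 -> y = 0) -> \det M != 0.
Proof.
move=> kerM; apply/negP; rewrite -det_tr => /det0P [v v0 vM].
case/eqP: v0; apply: trmx_inj; rewrite trmx0; apply: kerM.
by apply: trmx_inj; rewrite trmx_mul trmxK vM trmx0.
Qed.

Lemma adjmx_inv (R : realType) p (M : 'M[cplx R]_p) : adjmx (invmx M) = invmx (adjmx M).
Proof. by rewrite /adjmx map_invmx trmx_inv. Qed.

(** * Factored pencils and their realization over the polydisk *)

Section GramPencil.
Variables (R : realType) (d n m : nat).
Local Notation C := (cplx R).
Variable G : 'I_d -> 'M[C]_(n + m).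
Local Notation A := (fun k => adjmx (G k) *m G k).
Local Notation q := #|{: 'I_d * 'I_(n + m)}|.
Local Notation pencil_at := (pencil_at A).

(** All factors [G k] are stacked in [gstack], and [gcol] records the variable of each row: the
    pencil becomes [gstack^* Z gstack] with [Z] diagonal in the variables. *)
Definition gcol (i : 'I_q) : 'I_d := (enum_val i).1.
Definition gstack : 'M[C]_(q, n + m) := \matrix_(i, j) G (enum_val i).1 (enum_val i).2 j.
Definition zdiag (z : 'I_d -> C) : 'M[C]_q := diag_mx (\row_i z (gcol i)).
Local Notation W1 := (lsubmx gstack).
Local Notation W2 := (rsubmx gstack).

Lemma zdiagE z p (M : 'M[C]_(q, p)) i j : (zdiag z *m M) i j = z (gcol i) * M i j.
Proof. by rewrite mul_diag_mx !mxE. Qed.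

Lemma gstack_pencil z : adjmx gstack *m zdiag z *m gstack = pencil_at z.
Proof.
apply/matrixP => a b; rewrite -mulmxA mxE summxE.
under [RHS]eq_bigr do rewrite !mxE mulr_sumr.
rewrite pair_big /= (reindex (enum_val : 'I_q -> 'I_d * 'I_(n + m))) /=; last first.
  by apply: onW_bij; exact: enum_val_bij.
by apply: eq_bigr => i _; rewrite zdiagE !mxE mulrCA.
Qed.

Lemma pencil_at_block z : pencil_at z = block_mx
  (adjmx W1 *m zdiag z *m W1) (adjmx W1 *m zdiag z *m W2)
  (adjmx W2 *m zdiag z *m W1) (adjmx W2 *m zdiag z *m W2).
Proof.
rewrite -gstack_pencil -[in LHS](hsubmxK gstack) -mul_col_row; congr (_ *m _).
by rewrite /adjmx map_row_mx tr_row_mx mul_col_mx.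
Qed.

Hypothesis delta0 : pdelta A != 0.

(** A vector killed by [W2] is killed by [A_22(z)] for every [z], while [pdelta] is nonzero at some
    point. *)
Lemma W2_inj (y : 'cV[C]_m) : W2 *m y = 0 -> y = 0.
Proof.
move=> Wy; have [z _ dz] := mpoly_neq0_pos delta0.
rewrite meval_pdelta pencil_at_block block_mxKdr in dz.
have u : adjmx W2 *m zdiag z *m W2 \in unitmx by rewrite unitmxE unitfE.
by apply: (can_inj (mulKmx u)); rewrite mulmx0 -(mulmxA _ W2 y) Wy mulmx0.
Qed.

Lemma W2_gram_unit : adjmx W2 *m W2 \in unitmx.
Proof.
rewrite unitmxE unitfE; apply: det_neq0_ker => y yy.
apply: W2_inj; apply: adjmx_self_eq0.
by rewrite adjmxM -mulmxA [_ *m (_ *m y)]mulmxA yy mulmx0 mxE.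
Qed.

Lemma Re_sum I (r : seq I) (F : I -> C) :
  complex.Re (\sum_(i <- r) F i) = \sum_(i <- r) complex.Re (F i).
Proof. by apply: (big_morph (@complex.Re R)) => // -[a b] [c e]. Qed.

Lemma zdiag_form z p (v : 'cV[C]_p) (M : 'M[C]_(q, p)) :
  (adjmx v *m (adjmx M *m zdiag z *m M) *m v) 0 0 = \sum_i z (gcol i) * `|(M *m v) i 0| ^+ 2.
Proof.
have -> : adjmx v *m (adjmx M *m zdiag z *m M) *m v = adjmx (M *m v) *m (zdiag z *m (M *m v)).
  by rewrite adjmxM !mulmxA.
rewrite mxE; apply: eq_bigr => i _; rewrite zdiagE adjmxE mulrCA.
by rewrite [_^* * _]mulrC -normCK.
Qed.

Lemma Re_mulcr (c : C) (x : R) : complex.Re (c * cr x) = complex.Re c * x.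
Proof. by case: c => a b /=; rewrite mulr0 subr0. Qed.

(** The real part of the form of [A_22(z)] at [y] is a sum of squares with weights [Re z_k > 0]; a
    kernel vector therefore satisfies [W2 *m y = 0]. *)
Lemma pencil_dr_neq0 (z : 'I_d -> C) : (forall k, 0 < complex.Re (z k)) ->
  \det (drsubmx (pencil_at z)) != 0.
Proof.
move=> z0; rewrite pencil_at_block block_mxKdr; apply: det_neq0_ker => y yy.
have form := zdiag_form z y W2; rewrite -mulmxA yy mulmx0 mxE in form.
apply: W2_inj; apply/matrixP => i j; rewrite (ord1 j) [RHS]mxE.
have /eqP := congr1 (@complex.Re R) form; rewrite eq_sym Re_sum.
under eq_bigr do rewrite -cr_rabs -crX Re_mulcr.
rewrite psumr_eq0 => [/allP /(_ i (mem_index_enum _)) /=|l _]; last first.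
  by rewrite mulr_ge0 ?sqr_ge0 // ltW.
rewrite mulf_eq0 gt_eqF //= expf_eq0 /= => /eqP r0.
by apply/eqP; rewrite -normr_eq0 -cr_rabs r0 cr0.
Qed.

Lemma zdiagD1 z : zdiag z + 1%:M = zdiag (fun k => z k + 1).
Proof. by apply/matrixP => i j; rewrite !mxE; case: eqP => _; rewrite ?mulr1n // !mulr0n addr0. Qed.

(** Orthogonal projection onto the range of [W2]; [Urefl] is the reflection in that range and [bvec]
    the part of [W1] orthogonal to it. They serve as the unitary [U] and the vector [b] of the
    realization. *)
Definition P2 : 'M[C]_q := W2 *m invmx (adjmx W2 *m W2) *m adjmx W2.
Definition Urefl : 'M[C]_q := 2%:R *: P2 - 1%:M.
Definition bvec : 'M[C]_(q, n) := (1%:M - P2) *m W1.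

Lemma P2_adj : adjmx P2 = P2.
Proof.
rewrite /P2 !adjmxM adjmxK mulmxA; congr (_ *m _ *m _).
by rewrite adjmx_inv adjmxM adjmxK.
Qed.

Lemma P2_idem : P2 *m P2 = P2.
Proof.
rewrite /P2 !mulmxA -[_ *m adjmx W2 *m W2]mulmxA -[_ *m invmx _ *m (_ *m _)]mulmxA.
by rewrite (mulVmx W2_gram_unit) mulmx1.
Qed.

Lemma P2_W2 : P2 *m W2 = W2.
Proof. by rewrite /P2 -mulmxA -mulmxA (mulVmx W2_gram_unit) mulmx1. Qed.

Lemma Urefl_isometry : adjmx Urefl *m Urefl = 1%:M.
Proof.
rewrite /Urefl adjmxB adjmxZ adjmx1 P2_adj conjC_nat.
rewrite mulmxBl !mulmxBr -!scalemxAl -!scalemxAr P2_idem mulmx1 !mul1mx scalerA.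
apply/matrixP => i j; rewrite !mxE; ring.
Qed.

Section Point.
Variable z : 'I_d -> C.
Hypothesis dr0 : \det (drsubmx (pencil_at z)) != 0.

(** The pencil maps the block column of the identity over [schurY] to the Schur complement over
    zero; [etamx] is the image of this column under [gstack]. *)
Definition schurY : 'M[C]_(m, n) :=
  - (invmx (adjmx W2 *m zdiag z *m W2) *m (adjmx W2 *m zdiag z *m W1)).
Definition etamx : 'M[C]_(q, n) := W1 + W2 *m schurY.

Lemma W2_etamx : adjmx W2 *m zdiag z *m etamx = 0.
Proof.
have := dr0; rewrite pencil_at_block block_mxKdr => d0.
have u : adjmx W2 *m zdiag z *m W2 \in unitmx by rewrite unitmxE unitfE.
by rewrite /etamx /schurY mulmxDr !mulmxN mulmxA (mulKVmx u) subrr.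
Qed.

Lemma W1_etamx : adjmx W1 *m zdiag z *m etamx = schur (pencil_at z).
Proof.
rewrite /schur pencil_at_block block_mxKul block_mxKur block_mxKdl block_mxKdr.
by rewrite /etamx /schurY mulmxDr !mulmxN !mulmxA.
Qed.

Lemma schur_gram : schur (pencil_at z) = adjmx etamx *m zdiag z *m etamx.
Proof.
rewrite {1}/etamx adjmxD adjmxM !mulmxDl -!mulmxA [adjmx W2 *m _]mulmxA W2_etamx mulmx0 addr0.
by rewrite mulmxA W1_etamx.
Qed.

(* [(z + 1) / 2 = 1 / (1 - zeta)] at the Cayley transform [zeta] of [z]. *)
Definition hsol : 'M[C]_(q, n) := 2%:R^-1 *: (zdiag (fun k => z k + 1) *m etamx).

(** Since [z - 1 = zeta (z + 1)], this reads [(1 + U Z(zeta)) hsol = bvec]. It follows from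
    [P2 Z eta = 0] and [(1 - P2) eta = bvec]. *)
Lemma hsol_eq : hsol + Urefl *m (2%:R^-1 *: (zdiag (fun k => z k - 1) *m etamx)) = bvec.
Proof.
have P2z : P2 *m (zdiag z *m etamx) = 0.
  by rewrite /P2 -mulmxA [adjmx W2 *m (_ *m _)]mulmxA W2_etamx mulmx0.
have -> : zdiag (fun k => z k - 1) = zdiag z - 1%:M.
  by apply/matrixP => i j; rewrite !mxE; case: eqP => _; rewrite ?mulr1n // !mulr0n subr0.
have P2e : P2 *m etamx = etamx - bvec.
  by rewrite /bvec mulmxBl mul1mx opprB /etamx mulmxDr mulmxA P2_W2 addrC [W1 + _]addrC -addrA subrKC addrC.
have E : P2 *m (2%:R^-1 *: ((zdiag z - 1%:M) *m etamx)) = - (2%:R^-1 *: (etamx - bvec)).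
  by rewrite -scalemxAr mulmxBl mul1mx mulmxBr P2z sub0r P2e scalerN.
rewrite /Urefl mulmxBl mul1mx -scalemxAl E /hsol -zdiagD1 mulmxDl mulmxBl !mul1mx.
move: (zdiag z *m etamx) etamx bvec => x y w; apply/matrixP => i j; rewrite !mxE.
by field.
Qed.

Lemma schur_hsol : schur (pencil_at z) = 2%:R *: (adjmx bvec *m hsol) - adjmx bvec *m bvec.
Proof.
have bb : adjmx bvec *m etamx = adjmx bvec *m bvec.
  rewrite /etamx mulmxDr /bvec adjmxM adjmxB adjmx1 P2_adj.
  rewrite -[_ *m (W2 *m _)]mulmxA [(1%:M - P2) *m (W2 *m _)]mulmxA mulmxBl mul1mx P2_W2 subrr mul0mx mulmx0 addr0.
  rewrite -!mulmxA; congr (_ *m _); rewrite mulmxA; congr (_ *m _).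
  by rewrite mulmxBl mul1mx mulmxBr mulmx1 P2_idem subrr subr0.
have bz : adjmx bvec *m (zdiag z *m etamx) = schur (pencil_at z).
  rewrite /bvec adjmxM adjmxB adjmx1 P2_adj -mulmxA mulmxBl mul1mx.
  by rewrite /P2 -[_ *m adjmx W2 *m _]mulmxA [adjmx W2 *m (_ *m _)]mulmxA W2_etamx mulmx0 subr0 mulmxA W1_etamx.
rewrite /hsol -scalemxAr scalerA mulfV ?pnatr_eq0 // scale1r.
by rewrite -zdiagD1 mulmxDl mul1mx mulmxDr bz bb addrK.
Qed.

End Point.
End GramPencil.

(** * Operators on a Hilbert space and their Cayley transforms *)

Section HilbertSpace.
Variables (R : realType) (K : completeNormedModType (cplx R)) (ip : {dot K for Num.conj}).
Local Notation C := (cplx R).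
Hypothesis hip : hilbert_norm ip.

Lemma hilbert_dnorm (x : K) : `|x| = cr (dnorm ip x).
Proof. by rewrite cr_dnorm hip sqrCK. Qed.

Lemma tens_norm_ten_norm n (h : 'I_n -> K) : tens_norm h = cr (ten_norm ip h).
Proof. by rewrite cr_dnorm /tens_norm /= /dot_sum; congr sqrtC; apply: eq_bigr => i _; rewrite hip. Qed.

Lemma cauchy_seq_lim (u : nat -> K) (s c : R) : 0 <= s < 1 -> 0 <= c ->
  (forall M N, (N <= M)%N -> dnorm ip (u N - u M) <= s ^+ N * c) ->
  exists l, forall e, 0 < e -> \forall N \near \oo, dnorm ip (l - u N) <= e.
Proof.
move=> s01 c0 uc.
have cu : cauchy (u @ \oo).
  apply: cauchy_exP => e e0.
  have e1 : 0 < complex.Re e by rewrite -(ltr_cr 0) cr0 cr_Re // ltW.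
  have [N NP] := expr_small s01 c0 (divr_gt0 e1 (ltr0n R 2)).
  exists (u N); exists N => // M /= NM; rewrite -ball_normE /ball_ /= hilbert_dnorm.
  rewrite -(cr_Re (ltW e0)) ltr_cr; apply: le_lt_trans (uc _ _ NM) _.
  by apply: le_lt_trans NP _; lra.
have /cvg_ex [l /cvgrPdist_le ul] : cvg (u @ \oo) by apply: cauchy_cvg.
exists l => e e0; have := ul (cr e); rewrite -cr0 ltr_cr => /(_ e0).
by apply: filterS => N; rewrite hilbert_dnorm ler_cr.
Qed.

(** Contraction principle for [h -> y - X h]. Completeness is given for [K], so limits are taken
    coordinate by coordinate and reassembled. *)
Lemma fixed_point q (X : {linear ('I_q -> K) -> ('I_q -> K)}) (s : R) (y : 'I_q -> K) :
  0 <= s < 1 -> (forall h, ten_norm ip (X h) <= s * ten_norm ip h) ->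
  exists H, H = y - X H.
Proof.
move=> s01 Xs; have /andP [s0 s1] := s01.
pose u N : 'I_q -> K := iter N (fun h => y - X h) 0.
have du N M : ten_norm ip (u N - u (N + M)%N) <= s ^+ N * ten_norm ip (u M).
  elim: N => [|N IH]; first by rewrite add0n sub0r expr0 mul1r /ten_norm dnormN_eq.
  rewrite addSn /u !iterS -/(u _) -/(u _) opprB addrC addrA subrK -linearB.
  apply: le_trans (Xs _) _; rewrite exprS -mulrA ler_wpM2l //.
  by rewrite /ten_norm -dnormN_eq opprB; exact: IH.
have bu M : ten_norm ip (u M) <= (1 - s)^-1 * ten_norm ip y.
  rewrite mulrC ler_pdivlMr ?subr_gt0 //; elim: M => [|M IH].
    by rewrite /u /= /ten_norm dnorm0_eq mul0r dnorm_nneg.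
  have h1 : ten_norm ip (u M.+1) <= ten_norm ip y + s * ten_norm ip (u M).
    rewrite /u iterS -/(u _); apply: le_trans (dnormB_le _ _ _) _; rewrite lerD2l.
    exact: Xs.
  by move: h1 IH; rewrite -/(ten_norm ip _); move: (ten_norm _ _) (ten_norm _ y) (ten_norm _ _) => a b c; nra.
pose c := (1 - s)^-1 * ten_norm ip y.
have c0 : 0 <= c by rewrite mulr_ge0 ?dnorm_nneg // invr_ge0 subr_ge0 ltW.
have /choice [H HP] : forall i, exists l, forall e, 0 < e ->
    \forall N \near \oo, dnorm ip (l - u N i) <= e.
  move=> i; apply: (cauchy_seq_lim s01 c0) => M N NM.
  apply: le_trans (dnorm_coord_le ip (u N - u M) i) _.
  rewrite -(subnKC NM); apply: le_trans (du _ _) _.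
  by rewrite ler_wpM2l ?exprn_ge0.
exists H; apply/eqP; rewrite -subr_eq0; apply/eqP/(dnorm_eq0P (ip := dot_sum ip (q := q))).
apply/eqP; rewrite eq_le dnorm_nneg andbT -/(ten_norm ip _).
apply/ler_addgt0Pr => e e0; rewrite add0r.
have e1 : 0 < e / (2 * q.+1%:R) by rewrite divr_gt0 // mulr_gt0 // ltr0n.
have nH : \forall N \near \oo, forall i, dnorm ip (H i - u N i) <= e / (2 * q.+1%:R).
  by apply: filter_forall => i; exact: HP.
have tH N : (forall i, dnorm ip (H i - u N i) <= e / (2 * q.+1%:R)) -> ten_norm ip (H - u N) <= e / 2.
  move=> h; apply: le_trans (tnorm_le_sum _ _) _.
  apply: (@le_trans _ _ (\sum_(i < q) e / (2 * q.+1%:R))); first by apply: ler_sum => i _; exact: h.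
  have -> : e / 2 = (e / (2 * q.+1%:R)) *+ q.+1.
    by rewrite -[RHS]mulr_natr; field; rewrite nat1r pnatr_eq0.
  by rewrite sumr_const card_ord ler_wpMn2l // ltW.
have [N _ NP] := nH.
have -> : H - (y - X H) = (H - u N.+1) + X (H - u N).
  rewrite /u iterS -/(u _) [X (H - u N)]linearB !opprB -addrA; congr (_ + _).
  by rewrite [RHS]addrC addrA subrK.
apply: le_trans (dnormD_le _ _ _) _.
have h1 := tH _ (NP N (leqnn N)); have h2 := tH _ (NP N.+1 (leqnSn N)).
have h3 := Xs (H - u N); have := dnorm_nneg (dot_sum ip (q := q)) (H - u N).
rewrite -!/(ten_norm ip _); move: h1 h2 h3.
move: (ten_norm _ _) (ten_norm _ _) (ten_norm _ _) => a b c' ? ? ? ?; nra.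
Qed.

Section CayleyOperator.
Variable A : {linear K -> K}.
Hypothesis bA : bounded_op A.
Hypothesis sA : strictly_accretive ip A.

Let a u : R := 2 * complex.Re (ip (A u) u).

Lemma re_form u : ip (A u) u + ip u (A u) = cr (a u).
Proof.
rewrite (dot_conj ip u (A u)) /a; case: (ip (A u) u) => x y.
by apply/eqP; rewrite eq_complex /= subrr eqxx andbT; apply/eqP; ring.
Qed.

Lemma dnorm_comb al be u : dnorm ip (cr al *: A u + cr be *: u) ^+ 2 =
  al ^+ 2 * dnorm ip (A u) ^+ 2 + al * be * a u + be ^+ 2 * dnorm ip u ^+ 2.
Proof.
apply: (@cr_inj R); have := re_form u; move: (a u) => au re.
have E x : cr (dnorm ip x) * cr (dnorm ip x) = ip x x by rewrite -crM -expr2 cr_dnorm2.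
rewrite cr_dnorm2 !crD !expr2 !crM -re !E.
rewrite linearDl /= !linearDr /= !linearZl_LR /= !linearZr_LR /= !conj_cr.
by rewrite /GRing.scale /=; ring.
Qed.

Lemma dnorm_plus u : dnorm ip (A u + u) ^+ 2 = dnorm ip (A u) ^+ 2 + a u + dnorm ip u ^+ 2.
Proof. by have := dnorm_comb 1 1 u; rewrite cr1 !scale1r !expr1n !mul1r. Qed.

Lemma dnorm_minus u : dnorm ip (A u - u) ^+ 2 = dnorm ip (A u) ^+ 2 - a u + dnorm ip u ^+ 2.
Proof.
have := dnorm_comb 1 (-1) u.
by rewrite crN cr1 scale1r scaleN1r sqrrN !expr1n !mul1r mulN1r.
Qed.

Lemma accretive_bounds : exists s N : R, [/\ 0 < s, 1 <= N,
  forall u, s * dnorm ip u ^+ 2 <= a u & forall u, dnorm ip (A u + u) <= N * dnorm ip u].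
Proof.
have [M MP] := bA; have [s s0 sP] := sA.
exists s, (`|M| + 1); split => //.
- by rewrite lerDr.
- by move=> u; have := sP u; rewrite re_form -cr_dnorm2 -[(s%:C)%C]/(cr s) -crM ler_cr.
- move=> u; apply: le_trans (dnormD_le _ _ _) _; rewrite mulrDl mul1r lerD2r.
  have := MP u; rewrite !hilbert_dnorm -[(M%:C)%C]/(cr M) -crM ler_cr => h.
  by apply: le_trans h _; rewrite ler_wpM2r ?dnorm_nneg // ler_norm.
Qed.

Lemma cayley_bijective : bijective (fun u : K => A u + u).
Proof.
have [s [N [s0 N1 as_ BN]]] := accretive_bounds.
have N0 : 0 < N by apply: lt_le_trans N1.
have inj : injective (fun u : K => A u + u).
  move=> u v /eqP; rewrite -subr_eq0 => /eqP uv.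
  have E : A (u - v) + (u - v) = 0 by rewrite linearB addrACA -opprD.
  apply/eqP; rewrite -subr_eq0; apply/eqP/(dnorm_eq0P (ip := ip)).
  have := dnorm_plus (u - v); rewrite E dnorm0_eq expr0n /=.
  have := as_ (u - v); have := sqr_ge0 (dnorm ip (A (u - v))).
  have := sqr_ge0 (dnorm ip (u - v)) => h1 h2 h3 h4.
  apply/eqP; rewrite -sqrf_eq0; apply/eqP.
  have := mulr_ge0 (ltW s0) h1; lra.
suff surj y : exists u, A u + u = y.
  have /choice [g gP] := surj; exists g => [u|y]; last exact: gP.
  by apply: inj; rewrite gP.
(* Surjectivity by the iteration [u -> u - tau ((A + 1) u - y)]. As [|(A + 1) u| <= N |u|] and the
   real part of [A + 1] is at least [1], the choice [tau = 1 / N^2] makes it contractive: the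
   squared factor is at most [1 - tau <= (1 - tau / 2)^2]. *)
pose tau := (N ^+ 2)^-1.
have tau0 : 0 < tau by rewrite invr_gt0 exprn_gt0.
have tauN : tau * N ^+ 2 = 1 by rewrite mulVf // expf_neq0 // gt_eqF.
have tau1 : tau <= 1 by rewrite invf_le1 ?exprn_gt0 // exprn_ege1.
pose Xf (h : 'I_1 -> K) : 'I_1 -> K := fun i => cr tau *: A (h i) + cr (tau - 1) *: h i.
have Xlin : linear Xf.
  move=> c h h'; apply/funext => i; rewrite /Xf -[RHS]/(_ *: _ + _).
  rewrite -[(c *: h + h') i]/(c *: h i + h' i) linearP !scalerDr !scalerA.
  by rewrite addrACA mulrC [cr (tau - 1) * c]mulrC.
pose X : {linear ('I_1 -> K) -> ('I_1 -> K)} :=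
  HB.pack Xf (GRing.isLinear.Build C ('I_1 -> K) ('I_1 -> K) _ Xf Xlin).
have [|h|H HE] := @fixed_point 1 X (1 - tau / 2) (fun=> cr tau *: y).
- by apply/andP; split; lra.
- apply: ten_norm_le => [|i]; first by lra.
  rewrite -(@ler_sqr R) ?nnegrE ?mulr_ge0 ?dnorm_nneg //; last by lra.
  rewrite /X /= /Xf dnorm_comb exprMn.
  have := dnorm_plus (h i); have := BN (h i); have := as_ (h i).
  have := dnorm_nneg ip (A (h i) + h i); have := dnorm_nneg ip (h i).
  move: (dnorm ip (h i)) (dnorm ip (A (h i) + h i)) (dnorm ip (A (h i))) (a (h i)) => u b w v.
  move=> u0 b0 sv bu be.
  have bb : b ^+ 2 <= N ^+ 2 * u ^+ 2 by rewrite -exprMn ler_sqr ?nnegrE // mulr_ge0 // ltW.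
  have v0 : 0 <= v by apply: le_trans sv; rewrite mulr_ge0 ?sqr_ge0 // ltW.
  have h1 : tau ^+ 2 * b ^+ 2 <= tau * u ^+ 2.
    rewrite expr2 -mulrA ler_pM2l //; apply: le_trans (ler_wpM2l (ltW tau0) bb) _.
    by rewrite mulrA tauN mul1r.
  rewrite be in h1; have := mulr_ge0 (ltW tau0) v0.
  have := mulr_ge0 (sqr_ge0 tau) (sqr_ge0 u).
  have := sqr_ge0 u; rewrite !expr2 in h1 *; nra.
exists (H 0).
have := congr1 (fun h => h ord0) HE; rewrite -[(_ - X H) ord0]/(cr tau *: y - Xf H ord0) /Xf.
rewrite crB cr1 scalerBl scale1r => /eqP.
rewrite opprD addrA opprB addrCA addrC -subr_eq subrr => /eqP E.
apply: (@scalerI _ _ (cr tau)); first by rewrite -cr0 (inj_eq (@cr_inj R)) gt_eqF.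
apply/eqP; rewrite eq_sym -subr_eq0; apply/eqP; rewrite E scalerDr opprD addrA.
by [].
Qed.

Lemma cayley_opE u : cayley_op A (A u + u) = A u - u.
Proof.
rewrite /cayley_op (_ : 'pinv_(fun=> 0) _ _ _ = u) //.
have inj : {in [set: K] &, injective (fun u : K => A u + u)}.
  by move=> v w _ _; exact: (bij_inj cayley_bijective).
exact: (@pinvKV K K (fun=> 0) [set: K] _ inj u (in_setT u)).
Qed.

Lemma cayley_contraction : exists2 s : R, 0 <= s < 1 &
  forall x, dnorm ip (cayley_op A x) <= s * dnorm ip x.
Proof.
have [s [N [s0 N1 as_ BN]]] := accretive_bounds.
have N0 : 0 < N by apply: lt_le_trans N1.
(* One has [|(A - 1) u|^2 = |(A + 1) u|^2 - 2 a(u)] and [a(u) >= s |u|^2 >= (s / N^2) |(A + 1)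
   u|^2]. The maximum with [0] makes the square root meaningful. *)
pose k := Num.max 0 (1 - 2 * s / N ^+ 2).
have k0 : 0 <= k by rewrite le_max lexx.
have k1 : k < 1 by rewrite gt_max ltr01 gtrBl divr_gt0 ?exprn_gt0 ?mulr_gt0.
exists (Num.sqrt k).
  by rewrite sqrtr_ge0 /= -sqrtr1 ltr_sqrt.
move=> x; have [g _ gB] := cayley_bijective; rewrite -(gB x) cayley_opE.
move: (g x) => u; rewrite -(@ler_sqr R) ?nnegrE ?mulr_ge0 ?dnorm_nneg ?sqrtr_ge0 //.
rewrite exprMn sqr_sqrtr //.
have le : 1 - 2 * s / N ^+ 2 <= k by rewrite le_max lexx orbT.
apply: le_trans (ler_wpM2r (sqr_ge0 _) le).
have := dnorm_plus u; have := dnorm_minus u; have := BN u; have := as_ u.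
have := dnorm_nneg ip (A u + u); have := dnorm_nneg ip u.
move: (dnorm ip u) (dnorm ip (A u + u)) (dnorm ip (A u - u)) (dnorm ip (A u)) (a u) => x0 b c w v.
move=> x00 b0 sv bx -> be.
have bb : b ^+ 2 <= N ^+ 2 * x0 ^+ 2 by rewrite -exprMn ler_sqr ?nnegrE // mulr_ge0 // ltW.
have h : 2 * s / N ^+ 2 * b ^+ 2 <= 2 * s * x0 ^+ 2.
  rewrite -[leLHS]mulrA ler_wpM2l ?mulr_ge0 ?(ltW s0) //.
  by rewrite ler_pdivrMl ?exprn_gt0.
rewrite mulrBl mul1r; lra.
Qed.

Lemma cayley_op_linear : linear (cayley_op A).
Proof.
have [g _ gB] := cayley_bijective => c x y.
rewrite -(gB x) -(gB y).
have -> : c *: (A (g x) + g x) + (A (g y) + g y) = A (c *: g x + g y) + (c *: g x + g y).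
  by rewrite linearP scalerDr addrACA.
rewrite !cayley_opE linearP scalerBr opprD addrACA.
by [].
Qed.

End CayleyOperator.

(** Every [x] is [(A + 1) (A' + 1) u], and both compositions send it to [(A - 1) (A' - 1) u]. *)
Lemma cayley_op_comm (A A' : {linear K -> K}) x :
  bounded_op A -> bounded_op A' -> strictly_accretive ip A -> strictly_accretive ip A' ->
  (forall y, A (A' y) = A' (A y)) ->
  cayley_op A (cayley_op A' x) = cayley_op A' (cayley_op A x).
Proof.
move=> bA bA' sA sA' cAA.
have [g _ gB] := cayley_bijective bA sA; have [g' _ gB'] := cayley_bijective bA' sA'.
pose u := g' (g x).
have xE : x = A (A' u + u) + (A' u + u) by rewrite /u gB' gB.
have xE' : x = A' (A u + u) + (A u + u).
  by rewrite xE !linearD /= cAA addrACA -!addrA; congr (_ + _); rewrite !addrA; congr (_ + _); rewrite addrC.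
rewrite {1}xE' cayley_opE // xE cayley_opE //.
rewrite (_ : A' (A u + u) - (A u + u) = A (A' u - u) + (A' u - u)); last first.
  by rewrite linearD linearB /= cAA opprD addrACA.
rewrite cayley_opE //.
rewrite (_ : A (A' u + u) - (A' u + u) = A' (A u - u) + (A u - u)); last first.
  by rewrite linearD linearB /= cAA opprD addrACA.
rewrite cayley_opE // !linearB /= cAA.
by rewrite addrACA.
Qed.

End HilbertSpace.

Section UniformRealization.
Variables (R : realType) (d : nat) (K : lmodType (cplx R)) (ip : {dot K for Num.conj}).
Local Notation C := (cplx R).
Local Notation tnorm := (ten_norm ip).
Variables (T : 'I_d -> {linear K -> K}) (s : R).
Hypothesis Tcomm : forall k l x, T k (T l x) = T l (T k x).
Hypothesis s01 : 0 <= s < 1.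
Hypothesis Ts : forall k x, dnorm ip (T k x) <= s ^+ 2 * dnorm ip x.
Variables (q n : nat) (kap : 'I_q -> 'I_d) (U : 'M[C]_q) (b : 'M[C]_(q, n)).
Hypothesis UU : adjmx U *m U = 1%:M.

(** The index [N] is chosen before [x]: this is convergence in operator norm, as the functional
    calculus requires. *)
Lemma real_estimate (e : R) : 0 < e -> exists N, forall J : {fset {ffun 'I_d -> nat}},
  (mbox d N `<=` J)%fset -> forall x H, H = mxact b x - colmap T kap U H ->
  tnorm (\sum_(t <- J) mxact (real_coef kap U b t) (tmap T t x) - real_value b x H) <= e * tnorm x.
Proof.
move=> e0.
have [c c0 cb] := mxact_bounded ip b; have [c' c0' cb'] := mxact_bounded ip (adjmx b).
pose M := (1 - s)^-1 ^+ d + (1 - s)^-1.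
have M0 : 0 <= M by have /andP [h1 h2] := s01; rewrite addr_ge0 ?exprn_ge0 ?invr_ge0 ?subr_ge0 ?(ltW h2).
have [|N NP] := expr_small s01 _ e0 (c := 2 * c' * M * c); first by rewrite !mulr_ge0.
exists N => J NJ x H HE.
have J0 : midx0 d \in J.
  by apply: (fsubsetP NJ); rewrite mem_mbox; apply/forallP => k; rewrite ffunE.
rewrite real_partial // /ten_norm dnormZ_eq.
have -> : rabs (2%:R : C) = 2 by rewrite /rabs normr_nat -cr_nat.
have h1 := cb' (\sum_(t <- J) tmap T t (mxact (tcoef kap U b (tdeg t) t) x) - H).
have h2 := taylor_estimate Tcomm s01 Ts UU HE NJ.
have h3 := cb x.
have h4 := dnorm_nneg (dot_sum ip (q := n)) x.
have h5 : 0 <= s ^+ N by have /andP [h _] := s01; rewrite exprn_ge0.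
apply: le_trans (ler_wpM2r h4 NP).
rewrite -/(tnorm _) -/(tnorm _) -!mulrA.
rewrite [leRHS](_ : _ = 2 * (c' * (s ^+ N * M * (c * tnorm x)))); last by rewrite /ten_norm; ring.
rewrite ler_pM2l //; apply: le_trans h1 _; rewrite ler_wpM2l //.
by apply: le_trans h2 _; rewrite -/M ler_wpM2l // mulr_ge0.
Qed.

End UniformRealization.

(** * C as a one-dimensional space with scalar operators *)

Section ScalarDot.
Variable R : realType.
Local Notation C := (cplx R).

Definition scal_ip (x y : C^o) : C := x * y^*.

Lemma scal_ip_bilinear :
  bilinear_for (GRing.Scale.Law.clone _ _ ( *%R : C -> C -> C) _)
   (GRing.Scale.Law.clone _ _ (Num.conj \; *%R : C -> C -> C) _) scal_ip.
Proof.
split=> [y c x1 x2|x c y1 y2]; rewrite /scal_ip.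
  by rewrite -[RHS]/(c * _ + _) mulrDl -mulrA.
by rewrite -[RHS]/(c^* * _ + _) rmorphD rmorphM mulrDr mulrCA.
Qed.
HB.instance Definition _ := bilinear_isBilinear.Build C C^o C^o C _ _ scal_ip scal_ip_bilinear.

Lemma scal_ip_herm x y : scal_ip x y = (-1) ^+ false * Num.conj (scal_ip y x).
Proof. by rewrite expr0 mul1r /scal_ip rmorphM /= conjCK mulrC. Qed.
HB.instance Definition _ := @isHermitianSesquilinear.Build C C^o false Num.conj
  scal_ip scal_ip_herm.

Lemma scal_ip_pos (x : C^o) : x != 0 -> 0 < scal_ip x x.
Proof. by move=> x0; rewrite /scal_ip -normCK exprn_gt0 // normr_gt0. Qed.
HB.instance Definition _ := @isDotProduct.Build C C^o scal_ip scal_ip_pos.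

Lemma dnorm_scal (x : C^o) : dnorm scal_ip x = rabs x.
Proof. by apply: (@cr_inj R); rewrite cr_dnorm /= /scal_ip -normCK sqrCK // cr_rabs. Qed.

Definition scal_op (z : C) (x : C^o) : C^o := z * x.
Lemma scal_op_linear z : linear (scal_op z).
Proof. by move=> c x y; rewrite /scal_op mulrDr -[c *: x]/(c * x) mulrCA. Qed.
HB.instance Definition _ z := GRing.isLinear.Build C C^o C^o _ (scal_op z) (scal_op_linear z).

Lemma opmon_scal d (z : 'I_d -> C) t (x : C^o) :
  opmon (fun k => scal_op (z k)) t x = (\prod_k z k ^+ t k) * x.
Proof.
rewrite /opmon; elim: (index_enum _) => [|l r IH]; first by rewrite !big_nil mul1r.
rewrite !big_cons /= IH -mulrA; elim: (t l) => [|m IHm] /=; first by rewrite mul1r.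
by rewrite IHm exprS -mulrA.
Qed.

Lemma uniform_bound d (c : 'I_d -> R) : (forall k, 0 <= c k < 1) ->
  exists2 s : R, 0 <= s < 1 & forall k, c k <= s ^+ 2.
Proof.
move=> c01; pose M := \big[Num.max/0]_k c k.
have M0 : 0 <= M by rewrite /M; apply: bigmax_ge_id.
have M1 : M < 1 by apply/bigmax_ltP; split=> // k _; have /andP [] := c01 k.
exists (Num.sqrt M); first by rewrite sqrtr_ge0 /= -sqrtr1 ltr_sqrt.
by move=> k; rewrite sqr_sqrtr //; exact: le_bigmax.
Qed.

Lemma mx_cvg_totally (I : choiceType) n (u : {fset I} -> 'M[C]_n) (L : 'M[C]_n) :
  (forall e : R, 0 < e -> exists A : {fset I}, forall J, (A `<=` J)%fset ->
     forall i j, rabs ((u J - L) i j) <= e) ->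
  u @ totally --> L.
Proof.
move=> H; have tF := @totally_filter I; apply/cvg_ballP => e e0.
have e1 : 0 < complex.Re e / 2 by rewrite divr_gt0 // -(ltr_cr 0) cr0 cr_Re // ltW.
have [A AP] := H _ e1; exists A => // J /= AJ; split => // i j.
have := AP J AJ i j; rewrite -ball_normE /ball_ /= distrC -cr_rabs -ler_cr !mxE => h.
apply: le_lt_trans h _; rewrite -[ltRHS](cr_Re (ltW e0)) ltr_cr; lra.
Qed.

End ScalarDot.

(** * Complex differentiability of polynomial maps *)

Section Differentiability.
Variables (R : realType) (d : nat).
Local Notation C := (cplx R).

Lemma differentiable_big_add (V W : normedModType C) I (r : seq I) (F : I -> V -> W) z :
  (forall i, differentiable (F i) z) -> differentiable (fun x => \sum_(i <- r) F i x) z.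
Proof.
move=> dF; elim: r => [|i r IH].
  rewrite (_ : (fun x => _) = cst 0); first exact: differentiable_cst.
  by apply/funext => x; rewrite big_nil.
rewrite (_ : (fun x => _) = F i + (fun x => \sum_(i <- r) F i x)).
  exact: differentiableD.
by apply/funext => x; rewrite big_cons.
Qed.

Lemma differentiable_big_mul (V : normedModType C) I (r : seq I) (F : I -> V -> C) z :
  (forall i, differentiable (F i) z) -> differentiable (fun x => \prod_(i <- r) F i x) z.
Proof.
move=> dF; elim: r => [|i r IH].
  rewrite (_ : (fun x => _) = cst 1); first exact: differentiable_cst.
  by apply/funext => x; rewrite big_nil.
rewrite (_ : (fun x => _) = F i * (fun x => \prod_(i <- r) F i x)).
  exact: differentiableM.
by apply/funext => x; rewrite big_cons.
Qed.

Lemma differentiable_meval (p : mpoly d C) (z : 'rV[C]_d) :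
  differentiable (fun x : 'rV[C]_d => meval (fun k => x 0 k) p : C) z.
Proof.
(* Powers are unfolded into products over lists of length [m i], so that one product lemma covers
   both levels. *)
rewrite (_ : (fun x => _) = (fun x : 'rV[C]_d =>
    \sum_(m <- msupp p) mcoeff m p * \prod_(i <- index_enum _) \prod_(j <- nseq (m i) tt) (x 0 i))); last first.
  apply/funext => x; rewrite mevalE; apply: eq_bigr => m _; congr (_ * _).
  by apply: eq_bigr => i _; elim: (m i) => [|k IH]; rewrite /= ?big_nil ?expr0 // big_cons exprS IH.
apply: differentiable_big_add => m.
apply: (@differentiableM _ _ (cst (mcoeff m p : C))); first exact: differentiable_cst.
apply: differentiable_big_mul => i; apply: differentiable_big_mul => j.
exact: differentiable_coord.
Qed.

Lemma differentiable_mx n (g : 'rV[C]_d -> 'M[C]_n) (z : 'rV[C]_d) :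
  (forall i j, differentiable (fun x => g x i j : C) z) -> differentiable g z.
Proof.
move=> dg.
rewrite (_ : g = (fun x => \sum_(i <- index_enum _) \sum_(j <- index_enum _) g x i j *: delta_mx i j)).
  apply: differentiable_big_add => i; apply: differentiable_big_add => j.
  by apply: differentiableZl; exact: dg.
by apply/funext => x; rewrite [LHS]matrix_sum_delta.
Qed.

End Differentiability.

(** * The Schur complement on the polyhalfplane and at its boundary *)

Section Forward.
Variables (R : realType) (d n m : nat).
Hypothesis d0 : (0 < d)%N.
Local Notation C := (cplx R).
Variable G : 'I_d -> 'M[C]_(n + m).
Local Notation A := (fun k => adjmx (G k) *m G k).
Local Notation W1 := (lsubmx (gstack G)).
Local Notation W2 := (rsubmx (gstack G)).
Hypothesis delta0 : pdelta A != 0.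
Local Notation zfun z := (fun k => z 0 k : C).
Local Notation kap := (@gcol d n m).

Definition schur_fun (z : 'rV[C]_d) : 'M[C]_n :=
  \matrix_(i, j) (meval (zfun z) (pschur A i j) / meval (zfun z) (pdelta A)).

Lemma schur_funE (z : 'rV[C]_d) : meval (zfun z) (pdelta A) != 0 ->
  schur_fun z = schur (pencil_at A (zfun z)).
Proof.
move=> dz; apply/matrixP => i j; rewrite mxE meval_pschur -?meval_pdelta //.
by rewrite mulrAC mulfV // mul1r.
Qed.

Lemma pdelta_halfplane (z : 'rV[C]_d) : polyhalfplane z -> meval (zfun z) (pdelta A) != 0.
Proof. by move=> z0; rewrite meval_pdelta pencil_dr_neq0. Qed.

Lemma schur_fun_represents (f : 'M[ratfun R d]_n) : f = schur (pencil A) ->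
  represents f schur_fun.
Proof.
move=> -> z /pdelta_halfplane dz i j p q; rewrite schur_pencil // => E qz.
have q0 : q != 0 by apply: contraNneq qz => ->; rewrite meval0.
move/eqP: E; rewrite tofrac_div_eq // => /eqP E.
rewrite mxE; apply/eqP; rewrite eqr_div //; apply/eqP.
by rewrite -!mevalM E.
Qed.

Lemma schur_fun_differentiable (z : 'rV[C]_d) : meval (zfun z) (pdelta A) != 0 ->
  differentiable schur_fun z.
Proof.
move=> dz; apply: differentiable_mx => i j.
rewrite (_ : (fun x => _) = (fun x : 'rV[C]_d => meval (zfun x) (pschur A i j) : C) *
    (fun x : 'rV[C]_d => (meval (zfun x) (pdelta A) : C)^-1)).
  apply: differentiableM; first exact: differentiable_meval.
  by apply: differentiableV => //; exact: differentiable_meval.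
by apply/funext => x; rewrite mxE.
Qed.

Lemma schur_fun_holomorphic : holomorphic_on (@polyhalfplane R d) schur_fun.
Proof. by move=> z /pdelta_halfplane; exact: schur_fun_differentiable. Qed.

Lemma zdiag_adj (z : 'I_d -> C) : adjmx (@zdiag R d n m z) = zdiag n m (fun k => (z k)^*).
Proof.
apply/matrixP => i j; rewrite adjmxE !mxE eq_sym.
by case: eqVneq => [->|_]; rewrite ?mulr1n // !mulr0n conjC0.
Qed.

(** From [f = eta^* Z eta]. The middle factor is positive on the polyhalfplane and zero at imaginary
    points, which gives both the positive real part and the boundary condition. *)
Lemma schur_fun_re (z : 'rV[C]_d) : meval (zfun z) (pdelta A) != 0 ->
  schur_fun z + adjmx (schur_fun z) = adjmx (etamx G (zfun z)) *m
    zdiag n m (fun k => z 0 k + (z 0 k)^*) *m etamx G (zfun z).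
Proof.
move=> dz; have dz' := dz; rewrite meval_pdelta in dz'.
rewrite schur_funE // schur_gram // !adjmxM adjmxK zdiag_adj mulmxA -mulmxDl -mulmxDr.
congr (_ *m _ *m _); apply/matrixP => i j; rewrite !mxE.
by case: eqP => _; rewrite ?mulr1n // !mulr0n addr0.
Qed.

Lemma schur_fun_psd (z : 'rV[C]_d) : polyhalfplane z -> psdmx (schur_fun z + adjmx (schur_fun z)).
Proof.
move=> z0; rewrite schur_fun_re ?pdelta_halfplane //.
have w0 k : 0 <= z 0 k + (z 0 k)^*.
  have := z0 k; case: (z 0 k) => x y /= x0.
  rewrite lecE /= subrr eqxx /=; lra.
split; last by move=> x; rewrite zdiag_form sumr_ge0 // => i _; rewrite mulr_ge0 ?exprn_ge0.
rewrite adjmx_hermsym !adjmxM adjmxK zdiag_adj mulmxA; apply/eqP; congr (_ *m _ *m _).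
congr (zdiag n m _); apply/funext => k.
by rewrite rmorphD /= conjCK addrC.
Qed.

(** Since [A(i t) = i A(t)], the zeros on the imaginary space are those of the determinant of the
    Hermitian matrix [A_22(t)] at real [t]. *)
Lemma pencil_imag (t : 'rV[R]_d) :
  (meval (zfun (imag_point t)) (pdelta A) == 0) =
  (\det (drsubmx (pencil_at A (fun k => cr (t 0 k)))) == 0).
Proof.
rewrite meval_pdelta.
have -> : pencil_at A (zfun (imag_point t)) = (0 +i* 1)%C *: pencil_at A (fun k => cr (t 0 k)).
  rewrite /pencil_at scaler_sumr; apply: eq_bigr => k _; rewrite scalerA; congr (_ *: _).
  by rewrite mxE; apply/eqP; rewrite eq_complex /=; apply/andP; split; apply/eqP; ring.
rewrite (_ : drsubmx (_ *: _) = (0 +i* 1)%C *: drsubmx (pencil_at A (fun k => cr (t 0 k)))); last by apply/matrixP => i j; rewrite !mxE.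
rewrite detZ mulf_eq0 expf_eq0.
by rewrite [X in _ && X](_ : _ = false) ?andbF // eq_complex /= oner_eq0 andbF.
Qed.

Definition real_form (t : 'rV[R]_d) (y : 'cV[C]_m) : C :=
  \sum_i cr (t 0 (kap i)) * `|(W2 *m y) i 0| ^+ 2.

Lemma real_formE t y :
  real_form t y = (adjmx y *m (drsubmx (pencil_at A (fun k => cr (t 0 k)))) *m y) 0 0.
Proof. by rewrite pencil_at_block block_mxKdr zdiag_form. Qed.

Lemma real_form_lt (t t' : 'rV[R]_d) (y : 'cV[C]_m) : (forall k, t 0 k < t' 0 k) -> y != 0 ->
  real_form t y < real_form t' y.
Proof.
move=> tt y0; rewrite -subr_gt0 /real_form -sumrB.
have W0 : W2 *m y != 0 by apply: contraNneq y0 => /(W2_inj delta0) ->.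
have [i Wi] : exists i, (W2 *m y) i 0 != 0.
  apply/existsP; apply: contraNT W0; rewrite negb_exists => /forallP h.
  by apply/eqP/matrixP => i j; rewrite (ord1 j) [RHS]mxE; apply/eqP; have := h i; rewrite negbK.
rewrite (bigD1 i) //= ltr_wpDr //.
  apply: sumr_ge0 => j _; rewrite -mulrBl mulr_ge0 ?exprn_ge0 // subr_ge0 ler_cr.
  exact: ltW.
by rewrite -mulrBl mulr_gt0 ?exprn_gt0 ?normr_gt0 // subr_gt0 ltr_cr.
Qed.

(* The dimension of a subspace on which the form at [t] is nonnegative grows
   with every zero of the determinant met along an increasing chain. *)
Lemma zero_chain_size (s : seq 'rV[R]_d) t k (X : 'M[C]_(m, k)) :
  (forall c : 'cV[C]_k, X *m c = 0 -> c = 0) ->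
  (forall c : 'cV[C]_k, 0 <= real_form t (X *m c)) ->
  path (fun x y : 'rV[R]_d => [forall k, x 0 k < y 0 k]) t s ->
  all (fun x : 'rV[R]_d => \det (drsubmx (pencil_at A (fun k => cr (x 0 k)))) == 0) s ->
  (k + size s <= m)%N.
Proof.
elim: s t k X => [|t' s IH] t k X Xinj Xpos /=.
  move=> _ _; rewrite addn0.
  have : row_free X^T.
    apply: inj_row_free => v vX; apply: trmx_inj; rewrite trmx0; apply: Xinj.
    by apply: trmx_inj; rewrite trmx_mul trmxK vX trmx0.
  by move=> /eqP <-; exact: rank_leq_col.
move=> /andP [/forallP tt' pth] /andP [/eqP dt' als].
have [y y0 Hy] : exists2 y : 'cV[C]_m, y != 0 &
    drsubmx (pencil_at A (fun k => cr (t' 0 k))) *m y = 0.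
  apply: contrapT => H; have := @det_neq0_ker _ _ (drsubmx (pencil_at A (fun k => cr (t' 0 k)))).
  rewrite dt' eqxx => H'; have : false; last by [].
  apply: H' => y yy; apply/eqP; apply: contraT => y0; exfalso; apply: H.
  by exists y.
have Hadj : adjmx (drsubmx (pencil_at A (fun k => cr (t' 0 k)))) = drsubmx (pencil_at A (fun k => cr (t' 0 k))).
  rewrite pencil_at_block block_mxKdr !adjmxM adjmxK zdiag_adj mulmxA; congr (_ *m _ *m _).
  by congr (zdiag n m _); apply/funext => l; rewrite conj_cr.
(* [y] lies in the kernel of the Hermitian matrix at [t'], so it can be added to the subspace
   without changing the form. *)
have formD c (a : C) : real_form t' (X *m c + a *: y) = real_form t' (X *m c).
  rewrite !real_formE; set H := drsubmx _ in Hy Hadj *.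
  have Hy' : adjmx y *m H = 0 by rewrite -Hadj -adjmxM Hy adjmx0.
  rewrite adjmxD adjmxZ mulmxDr -scalemxAr -[_ *m H *m y]mulmxA Hy mulmx0 scaler0 addr0.
  by rewrite !mulmxDl -!scalemxAl Hy' mul0mx scaler0 addr0.
rewrite -addSnnS -addn1; apply: (IH t' (k + 1)%N (row_mx X y)) => // c; rewrite -[c]vsubmxK mul_row_col.
all: set c1 := usubmx c; set c2 := dsubmx c.
all: have yc : y *m c2 = c2 0 0 *: y by rewrite [c2 in LHS]mx11_scalar mul_mx_scalar.
- rewrite yc => E.
  (* Were [y] in the range of [X], its form would be nonnegative at [t] and, being strictly
     increasing, positive at [t'], where it is zero. *)
  have a0 : c2 0 0 = 0.
    apply/eqP; apply: contraT => a0.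
    have yX : y = X *m (- (c2 0 0)^-1 *: c1).
      rewrite -scalemxAr; apply: (scalerI a0); rewrite scalerA mulrN mulfV // scaleN1r.
      by apply/eqP; rewrite -addr_eq0 addrC E.
    have := real_form_lt tt' y0; rewrite [real_form t' y]real_formE -mulmxA Hy mulmx0 mxE.
    by rewrite {1}yX => /(le_lt_trans (Xpos _)); rewrite ltxx.
  have -> : c2 = 0 by apply/matrixP => i j; rewrite (ord1 i) (ord1 j) a0 mxE.
  have -> : c1 = 0 by apply: Xinj; move: E; rewrite a0 scale0r addr0.
  by rewrite col_mx0.
- rewrite yc formD; have [->|X0] := eqVneq (X *m c1) 0.
    by rewrite real_formE mulmx0 mxE.
  by apply: le_trans (Xpos c1) _; apply/ltW/real_form_lt.
Qed.

Lemma zero_set_null :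
  Defs.null_set [set t : 'rV[R]_d | meval (zfun (imag_point t)) (pdelta A) = 0].
Proof.
apply: (chain_free_null_set d0 (m := m)) => s als srt.
case: s als srt => [//|t s] /= /andP [Et als] pth.
have pr x : `[< [set t : 'rV[R]_d | meval (zfun (imag_point t)) (pdelta A) = 0] x >] ->
    \det (drsubmx (pencil_at A (fun k => cr (x 0 k)))) == 0.
  by move=> /asboolP /= /eqP; rewrite pencil_imag.
(* A point strictly below the first zero, with the zero subspace, starts the induction. *)
pose t0 : 'rV[R]_d := \row_k (t 0 k - 1).
apply: (@zero_chain_size (t :: s) t0 0 0).
- by move=> c _; apply/matrixP => -[].
- by move=> c; rewrite mul0mx real_formE mulmx0 mxE.
- by rewrite /= pth andbT; apply/forallP => k; rewrite mxE gtrBl ltr01.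
- rewrite /= pr //=; apply: sub_all als => x; exact: pr.
Qed.

Lemma schur_fun_cayley_inner : cayley_inner schur_fun.
Proof.
split; [exact: schur_fun_holomorphic|exact: schur_fun_psd|].
move=> e e0; have [a [b [ab E s]]] := zero_set_null e0.
exists a, b; split=> // t /= nt; apply: E => /=; apply: contrapT => /eqP dt; apply: nt.
exists (schur_fun (imag_point t)).
  move=> alpha _; apply: cvg_within_filter.
  exact: (differentiable_continuous (schur_fun_differentiable dt)).
rewrite schur_fun_re //.
have -> : zdiag n m (fun k => imag_point t 0 k + (imag_point t 0 k)^*) = 0 :> 'M[C]__.
  apply/matrixP => i j; rewrite !mxE; case: eqP => _; rewrite ?mulr0n // mulr1n.
  by apply/eqP; rewrite eq_complex /= addr0 subrr !eqxx.
by rewrite mulmx0 mul0mx.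
Qed.

End Forward.

Lemma Re_gt0_conj (R : realType) (c : cplx R) : (0 < complex.Re c) = (0 < c + c^*).
Proof.
case: c => a b; rewrite ltcE /= subrr eqxx /=.
by apply/idP/idP; lra.
Qed.

Lemma cayley_Re (R : realType) (z : cplx R) : `|z| < 1 -> 0 < complex.Re ((1 + z) / (1 - z)).
Proof.
move=> z1; have z0 : 1 - z != 0.
  by rewrite subr_eq0; apply: contraTneq z1 => <-; rewrite normr1 ltxx.
have z0' : 1 - z^* != 0 by rewrite -(rmorph1 Num.conj) -rmorphB /= conjC_eq0.
rewrite Re_gt0_conj rmorphM rmorphD rmorph1 fmorphV rmorphB rmorph1 /=.
have -> : (1 + z) / (1 - z) + (1 + z^*) / (1 - z^*) = 2%:R * (1 - `|z| ^+ 2) / `|1 - z| ^+ 2.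
  by rewrite !normCK rmorphB rmorph1 /=; field; apply/andP.
rewrite divr_gt0 ?exprn_gt0 ?normr_gt0 // mulr_gt0 ?ltr0n // subr_gt0.
by rewrite expr_lt1.
Qed.

(** * The Schur complement in the Herglotz-Agler class *)

Section ForwardAgler.
Variables (R : realType) (d n m : nat).
Hypothesis d0 : (0 < d)%N.
Local Notation C := (cplx R).
Variable G : 'I_d -> 'M[C]_(n + m).
Local Notation A := (fun k => adjmx (G k) *m G k).
Hypothesis delta0 : pdelta A != 0.
Local Notation kap := (@gcol d n m).
Local Notation U := (Urefl G).
Local Notation b := (bvec G).

Lemma cayley_point_halfplane (zeta : 'rV[C]_d) : polydisk zeta -> polyhalfplane (cayley_point zeta).
Proof. by move=> zd k; rewrite mxE cayley_Re. Qed.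

(** A point of the polydisk is a commuting tuple of strict contractions on C; the operator estimate
    for this tuple, applied to the basis vectors [x j], gives convergence entry by entry. *)
Lemma schur_fun_power_series :
  power_series_on_polydisk (schur_fun G \o @cayley_point R d) (real_coef kap U b).
Proof.
move=> zeta zd; apply: mx_cvg_totally => e e0.
pose z := cayley_point zeta.
have zE k : zeta 0 k * (z 0 k + 1) = z 0 k - 1.
  have h : 1 - zeta 0 k != 0.
    by rewrite subr_eq0; apply: contraTneq (zd k) => <-; rewrite normr1 ltxx.
  by rewrite /z mxE; field.
have zp : polyhalfplane z by exact: cayley_point_halfplane.
have dz : meval (fun k => z 0 k) (pdelta A) != 0 by exact: (pdelta_halfplane delta0).
have dz' := dz; rewrite meval_pdelta in dz'.
have [s s01 sz] : exists2 s : R, 0 <= s < 1 & forall k, rabs (zeta 0 k) <= s ^+ 2.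
  by apply: uniform_bound => k; rewrite rabs_ge0 /= -ltr_cr cr_rabs cr1.
pose x (j i : 'I_n) : C^o := (i == j)%:R.
pose M := 1 + \sum_j ten_norm (@scal_ip R) (x j).
have M0 : 0 < M by rewrite ltr_wpDr ?ltr01 // sumr_ge0 // => j _; exact: dnorm_nneg.
have Tc k l (y : C^o) : scal_op (zeta 0 k) (scal_op (zeta 0 l) y) = scal_op (zeta 0 l) (scal_op (zeta 0 k) y).
  by rewrite /scal_op mulrCA.
have Ts k (y : C^o) : dnorm (@scal_ip R) (scal_op (zeta 0 k) y) <= s ^+ 2 * dnorm (@scal_ip R) y.
  rewrite (dnormZ_eq (@scal_ip R) (zeta 0 k) y) ler_wpM2r ?dnorm_nneg //.
have eM : 0 < e / M by rewrite divr_gt0.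
have [N NP] := real_estimate (T := fun k => scal_op (zeta 0 k)) Tc s01 Ts kap b (Urefl_isometry delta0) eM.
exists (mbox d N) => J NJ i j.
pose H (l : 'I_#|{: 'I_d * 'I_(n + m)}|) : C^o := hsol G (fun k => z 0 k) l j.
have mxx p (B : 'M[C]_(p, n)) l : mxact B (x j) l = B l j.
  rewrite /mxact (bigD1 j) //= /x eqxx big1 ?addr0 => [|k /negbTE kj]; last by rewrite kj scaler0.
  exact: mulr1.
have HE : H = mxact b (x j) - colmap (fun k => scal_op (zeta 0 k)) kap U H.
  apply/funext => l; rewrite -[RHS]/(mxact b (x j) l - colmap (fun k => scal_op (zeta 0 k)) kap U H l) mxx.
  rewrite -(hsol_eq delta0 dz') mxE -addrA [X in _ = _ + X](_ : _ = 0) ?addr0 //.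
  apply/eqP; rewrite subr_eq0; apply/eqP; rewrite mxE /colmap /mxact; apply: eq_bigr => l' _.
  congr (_ * _); rewrite mxE zdiagE -zE /scal_op /H /hsol [in RHS]mxE zdiagE.
  by rewrite /= [RHS]mulrCA -!mulrA.
have := NP J NJ (x j) H HE.
set y := (X in ten_norm _ X) => h.
have yE : y i = (partial_sum (fun t : {ffun 'I_d -> nat} => (\prod_k zeta 0 k ^+ t k) *: real_coef kap U b t) J
     - (schur_fun G \o @cayley_point R d) zeta) i j.
  rewrite /y -[LHS]/((\sum_(t <- J) _) i - real_value _ _ _ i) fct_sumE [RHS]mxE.
  congr (_ + _).
    rewrite /partial_sum summxE -[RHS](big_seq_fsetE _ J xpredT (fun t => ((\prod_k zeta 0 k ^+ t k) *: real_coef kap U b t) i j)) /=.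
    apply: eq_bigr => t _; rewrite mxE -[in RHS]mxx /mxact mulr_sumr; apply: eq_bigr => l _.
    by rewrite /tmap opmon_scal -[LHS]/(_ * _) -[in RHS]/(_ * (_ * _)) mulrCA.
  rewrite mxE; congr (- _).
  rewrite /= schur_funE ?[cayley_point _]/z // (schur_hsol delta0 dz').
  rewrite [RHS]mxE [in RHS]mxE [in X in _ = _ + X]mxE -[LHS]/(2 * mxact (adjmx b) H i - mxact (adjmx b *m b) (x j) i).
  by rewrite mxx; congr (2 * _ - _); rewrite mxE.
rewrite -yE -dnorm_scal; apply: le_trans (dnorm_coord_le _ _ _) _; apply: le_trans h _.
rewrite mulrAC ler_pdivrMr // ler_pM2l // /M (bigD1 j) //= addrCA lerDl.
by rewrite addr_ge0 ?ler01 // sumr_ge0 // => l _; exact: dnorm_nneg.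
Qed.

Lemma schur_fun_herglotz_agler : herglotz_agler (schur_fun G).
Proof.
split; first exact: schur_fun_holomorphic.
move=> K ip hip A' bA cA sA.
pose T k : {linear K -> K} := HB.pack (cayley_op (A' k))
  (GRing.isLinear.Build C K K _ (cayley_op (A' k)) (cayley_op_linear hip (bA k) (sA k))).
have Tcomm k l x : T k (T l x) = T l (T k x) by exact: cayley_op_comm.
have /boolp.choice [c cP] : forall k, exists c : R, 0 <= c < 1 /\
    forall x, dnorm ip (T k x) <= c * dnorm ip x.
  move=> k; have [s s01 sP] := cayley_contraction hip (bA k) (sA k).
  by exists s.
have [s s01 sc] := uniform_bound (fun k => (cP k).1).
have Ts k x : dnorm ip (T k x) <= s ^+ 2 * dnorm ip x.
  by apply: le_trans ((cP k).2 x) _; rewrite ler_wpM2r ?dnorm_nneg.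
have UU := Urefl_isometry delta0.
have s201 : 0 <= s ^+ 2 < 1.
  by have /andP [s0 s1] := s01; rewrite exprn_ge0 // expr_lt1.
have /boolp.choice [H HP] : forall x : 'I_n -> K, exists H, H = mxact b x - colmap T kap U H.
  move=> x; apply: (fixed_point hip (mxact b x) s201) => h.
  exact: colmap_norm.
exists (fun x => real_value b x (H x)); last first.
  by move=> x; exact: (real_value_accretive s01 Ts UU (HP x)).
exists (real_coef kap U b); first exact: schur_fun_power_series.
move=> e e0; have [N NP] := real_estimate Tcomm s01 Ts kap b UU e0.
exists (mbox d N) => // J NJ h.
rewrite !(tens_norm_ten_norm hip) -[(e%:C)%C]/(cr e) -crM ler_cr.
have := NP J NJ h (H h) (HP h); congr (is_true (ten_norm ip (_ - _) <= _)).
rewrite /partial_sum.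
exact: (big_seq_fsetE _ J xpredT (fun t => mxact (real_coef kap U b t) (tmap T t h))).
Qed.

End ForwardAgler.

(** Homogeneity is demanded for every representation [p / q] of an entry; it is transferred from a
    fixed representation [a / b] by evaluation where [b] is nonzero. *)
Lemma dilate_fraction (R : realType) (d : nat) (c : cplx R) (a b p q : mpoly d (cplx R)) :
  b != 0 -> a * q = p * b ->
  (forall z, meval z b != 0 -> meval (fun k => c * z k) b != 0 /\
     meval (fun k => c * z k) a * meval z b = c * meval z a * meval (fun k => c * z k) b) ->
  dilate c p * b = mpolyC d c * a * dilate c q.
Proof.
move=> b0 E H; apply: (mpoly_ext_generic b0) => z _ bz; have [bcz Ez] := H z bz.
move: (meval_dilate c p z) (meval_dilate c q z) (mevalC z c : meval z (mpolyC d c) = c).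
move: (dilate c p) (dilate c q) (mpolyC d c) => p' q' c' p'E q'E c'E.
rewrite !mevalM p'E q'E c'E; apply: (mulfI bcz).
have := congr1 (meval (fun k => c * z k)) E; rewrite !mevalM => Ec.
by rewrite mulrA [_ * meval _ p]mulrC -Ec mulrAC Ez; ring.
Qed.

(** * Homogeneity of the Schur complement *)

Section ForwardHomogeneous.
Variables (R : realType) (d n m : nat).
Local Notation C := (cplx R).
Variable A : 'I_d -> 'M[C]_(n + m).

Lemma pencil_atZ (c : C) z : pencil_at A (fun k => c * z k) = c *: pencil_at A z.
Proof. by rewrite /pencil_at scaler_sumr; apply: eq_bigr => k _; rewrite scalerA. Qed.

Lemma schurZ (c : C) (M : 'M[C]_(n + m)) : \det (drsubmx M) != 0 -> c != 0 ->
  schur (c *: M) = c *: schur M.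
Proof.
rewrite -unitfE -unitmxE => u c0; rewrite /schur.
have -> : ulsubmx (c *: M) = c *: ulsubmx M by apply/matrixP => i j; rewrite !mxE.
have -> : ursubmx (c *: M) = c *: ursubmx M by apply/matrixP => i j; rewrite !mxE.
have -> : dlsubmx (c *: M) = c *: dlsubmx M by apply/matrixP => i j; rewrite !mxE.
have -> : drsubmx (c *: M) = c *: drsubmx M by apply/matrixP => i j; rewrite !mxE.
rewrite invmxZ ?unitmxZ ?unitfE // -!scalemxAl -!scalemxAr -scalemxAl.
by rewrite [c *: (c^-1 *: _)]scalerA mulfV // scale1r scalerBr.
Qed.

Lemma schur_homogeneous (delta0 : pdelta A != 0) : homogeneous1 (schur (pencil A)).
Proof.
move=> c c0 i j p q q0 E.
have E' := E; rewrite schur_pencil // in E'; move/eqP: E'; rewrite tofrac_div_eq // => /eqP E'.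
rewrite schur_pencil // /rconst mulrA -tofracM; apply/eqP.
rewrite tofrac_div_eq ?dilate_neq0 //; apply/eqP.
apply: (dilate_fraction delta0 E') => z dz.
have dz' := dz; rewrite meval_pdelta in dz'.
have dcz : \det (drsubmx (pencil_at A (fun k => c * z k))) != 0.
  rewrite pencil_atZ (_ : drsubmx (_ *: _) = c *: drsubmx (pencil_at A z)); last by apply/matrixP => k l; rewrite !mxE.
  by rewrite detZ mulf_neq0 // expf_neq0.
split; first by rewrite meval_pdelta.
by rewrite (meval_pschur i j dcz) (meval_pschur i j dz') pencil_atZ (schurZ dz' c0) mxE; ring.
Qed.

End ForwardHomogeneous.

Lemma bessmertnyi_forward (R : realType) (d n : nat) (f : 'M[ratfun R d]_n) : (0 < d)%N ->
  bessmertnyi f -> [/\ rat_herglotz_agler f, homogeneous1 f & rat_cayley_inner f].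
Proof.
move=> d0 [m [A [Apsd dA fE]]].
have /boolp.choice [G GE] : forall k, exists G : 'M[cplx R]_(n + m), A k = adjmx G *m G.
  by move=> k; have [G] := psdmx_gramP (Apsd k); exists G.
have AE : A = fun k => adjmx (G k) *m G k by apply/funext => k; exact: GE.
rewrite AE in dA fE; rewrite det_pencil tofrac_eq0 in dA.
have {}fE : f = schur (pencil (fun k => adjmx (G k) *m G k)) by [].
split.
- exists (schur_fun G); [exact: schur_fun_represents|exact: schur_fun_herglotz_agler].
- by rewrite fE; exact: schur_homogeneous.
- exists (schur_fun G); [exact: schur_fun_represents|exact: schur_fun_cayley_inner].
Qed.

(** * The Hilbert space C^r *)
(* C^r with its Euclidean norm; the norm of 'cV[C]_r itself is the sup norm. *)
Definition ell2 (R : realType) (r : nat) : Type := 'cV[cplx R]_r.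
HB.instance Definition _ (R : realType) (r : nat) := GRing.Lmodule.copy (ell2 R r) 'cV[cplx R]_r.

Section Ell2.
Variables (R : realType) (r : nat).
Local Notation C := (cplx R).
Local Notation E := (ell2 R r).

Definition ell2_ip (x y : E) : C := (adjmx (y : 'cV[C]_r) *m (x : 'cV[C]_r)) 0 0.

Lemma ell2_ip_bilinear :
  bilinear_for (GRing.Scale.Law.clone _ _ ( *%R : C -> C -> C) _)
   (GRing.Scale.Law.clone _ _ (Num.conj \; *%R : C -> C -> C) _) ell2_ip.
Proof.
split=> [y c x1 x2|x c y1 y2]; rewrite /ell2_ip.
  by rewrite mulmxDr -scalemxAr mxE [X in X + _]mxE.
by rewrite adjmxD adjmxZ mulmxDl -scalemxAl mxE [X in X + _]mxE.
Qed.
HB.instance Definition _ := bilinear_isBilinear.Build C E E C _ _ ell2_ip ell2_ip_bilinear.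

Lemma ell2_ip_herm x y : ell2_ip x y = (-1) ^+ false * Num.conj (ell2_ip y x).
Proof. by rewrite expr0 mul1r /ell2_ip -adjmxE adjmxM adjmxK. Qed.
HB.instance Definition _ := @isHermitianSesquilinear.Build C E false Num.conj
  ell2_ip ell2_ip_herm.

Lemma ell2_ip_pos (x : E) : x != 0 -> 0 < ell2_ip x x.
Proof.
move=> x0; rewrite lt_def adjmx_self_ge0 andbT.
by apply: contraNneq x0 => /adjmx_self_eq0 ->.
Qed.
HB.instance Definition _ := @isDotProduct.Build C E ell2_ip ell2_ip_pos.

Definition ell2_norm (x : E) : C := cr (dnorm ell2_ip x).

Lemma ell2_normD x y : ell2_norm (x + y) <= ell2_norm x + ell2_norm y.
Proof. by rewrite -crD ler_cr dnormD_le. Qed.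

Lemma ell2_normZ (c : C) x : ell2_norm (c *: x) = `|c| * ell2_norm x.
Proof. by rewrite /ell2_norm dnormZ_eq crM cr_rabs. Qed.

Lemma ell2_norm_eq0 x : ell2_norm x = 0 -> x = 0.
Proof. by move=> h; apply: (dnorm_eq0P (ip := ell2_ip)); apply: (@cr_inj R); rewrite cr0. Qed.

HB.instance Definition _ := @Lmodule_isNormed.Build C E ell2_norm ell2_normD ell2_normZ ell2_norm_eq0.

Lemma ell2_normE (x : E) : `|x| = cr (dnorm ell2_ip x). Proof. by []. Qed.

Lemma ell2_coord_le (x : E) i : rabs ((x : 'cV[C]_r) i 0) <= dnorm ell2_ip x.
Proof.
rewrite -ler_sqr ?nnegrE ?rabs_ge0 ?dnorm_nneg // -ler_cr cr_dnorm2 crX cr_rabs.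
rewrite /= /ell2_ip mxE (bigD1 i) //= adjmxE mulrC -normCK lerDl.
by apply: sumr_ge0 => j _; rewrite adjmxE mulrC -normCK exprn_ge0.
Qed.

Lemma Re_le_rabs (c : C) : `|complex.Re c| <= rabs c.
Proof.
case: c => a b /=; rewrite /rabs /= -sqrtr_sqr ler_sqrt ?addr_ge0 ?sqr_ge0 //.
by rewrite lerDl sqr_ge0.
Qed.

Lemma Im_le_rabs (c : C) : `|complex.Im c| <= rabs c.
Proof.
case: c => a b /=; rewrite /rabs /= -sqrtr_sqr ler_sqrt ?addr_ge0 ?sqr_ge0 //.
by rewrite lerDr sqr_ge0.
Qed.

Lemma rabs_le_ReIm (c : C) : rabs c <= `|complex.Re c| + `|complex.Im c|.
Proof.
case: c => a b /=; rewrite -ler_sqr ?nnegrE ?rabs_ge0 ?addr_ge0 //.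
rewrite /rabs /= sqr_sqrtr ?addr_ge0 ?sqr_ge0 // sqrrD !real_normK ?num_real //.
by rewrite lerD2r lerDl mulrn_wge0 // mulr_ge0.
Qed.

Lemma ell2_norm_le (x : E) :
  dnorm ell2_ip x <= \sum_i (`|complex.Re ((x : 'cV[C]_r) i 0)| + `|complex.Im ((x : 'cV[C]_r) i 0)|).
Proof.
have s0 : 0 <= \sum_i (`|complex.Re ((x : 'cV[C]_r) i 0)| + `|complex.Im ((x : 'cV[C]_r) i 0)|).
  by apply: sumr_ge0 => i _; rewrite addr_ge0.
rewrite -ler_sqr ?nnegrE ?dnorm_nneg // -ler_cr cr_dnorm2 /= /ell2_ip mxE.
rewrite expr2 mulr_suml /cr rmorph_sum; apply: ler_sum => i _.
rewrite -[leRHS]/(cr _) adjmxE mulrC -normCK -cr_rabs -crX ler_cr expr2.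
have h := rabs_le_ReIm ((x : 'cV[C]_r) i 0).
apply: ler_pM; rewrite ?rabs_ge0 //; apply: le_trans h _.
by rewrite (bigD1 i) //= lerDl sumr_ge0 // => j _; rewrite addr_ge0.
Qed.

(** Real and imaginary parts of the coordinates are Lipschitz for the norm, so they converge in R;
    conversely these finitely many limits control the norm. *)
Lemma ell2_complete (F : set_system E) : ProperFilter F -> cauchy F -> cvg F.
Proof.
move=> FF /cauchy_ballP Fc.
have coordcvg (h : E -> R) : (forall x y : E, `|h x - h y| <= dnorm ell2_ip (x - y)) -> cvg (h @ F).
  move=> hlip; apply: R_complete; apply/cauchy_ballP => e e0.
  have := Fc (cr e); rewrite -cr0 ltr_cr => /(_ e0) H.
  have [[A B] [/= FA FB] AB] := H; exists (h @` A, h @` B) => /=.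
    by split; [apply: filterS FA|apply: filterS FB] => x Ax; exists x.
  move=> [_ _] [/= [x Ax <-] [y By <-]].
  have := AB (x, y) (conj Ax By); rewrite -!ball_normE /ball_ /= ltr_cr => h1.
  by apply: le_lt_trans (hlip _ _) h1.
pose re (i : 'I_r) (x : E) : R := complex.Re ((x : 'cV[C]_r) i 0).
pose im (i : 'I_r) (x : E) : R := complex.Im ((x : 'cV[C]_r) i 0).
have reB i x y : re i (x - y) = re i x - re i y.
  by rewrite /re !mxE; case: (x i 0) (y i 0) => a b [a' b'].
have imB i x y : im i (x - y) = im i x - im i y.
  by rewrite /im !mxE; case: (x i 0) (y i 0) => a b [a' b'].
have cre i : cvg (re i @ F).
  apply: coordcvg => x y; rewrite -reB; apply: le_trans (ell2_coord_le (x - y) i); exact: Re_le_rabs.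
have cim i : cvg (im i @ F).
  apply: coordcvg => x y; rewrite -imB; apply: le_trans (ell2_coord_le (x - y) i); exact: Im_le_rabs.
apply/cvg_ex; pose l : E := \col_i (lim (re i @ F) +i* lim (im i @ F))%C.
exists l; apply/cvgrPdist_le => e e0.
have r0 : 0 < complex.Re e by rewrite -(ltr_cr 0) cr0 cr_Re // ltW.
have d0 : 0 < complex.Re e / (2 * r.+1%:R) by rewrite divr_gt0 // mulr_gt0 // ltr0n.
have nre : \forall x \near F, forall i, `|lim (re i @ F) - re i x| <= complex.Re e / (2 * r.+1%:R).
  apply: filter_forall => i; by have /cvgrPdist_le/(_ _ d0) := cre i.
have nim : \forall x \near F, forall i, `|lim (im i @ F) - im i x| <= complex.Re e / (2 * r.+1%:R).
  apply: filter_forall => i; by have /cvgrPdist_le/(_ _ d0) := cim i.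
near=> x; rewrite ell2_normE -(cr_Re (ltW e0)) ler_cr.
apply: le_trans (ell2_norm_le _) _.
have -> : complex.Re e = (complex.Re e / (2 * r.+1%:R) + complex.Re e / (2 * r.+1%:R)) *+ r.+1.
  by rewrite -[RHS]mulr_natr; field; rewrite nat1r pnatr_eq0.
apply: (@le_trans _ _ (\sum_(i < r) (complex.Re e / (2 * r.+1%:R) + complex.Re e / (2 * r.+1%:R)))).
  apply: ler_sum => i _; apply: lerD.
    rewrite -/(re i _) reB /re mxE /=; by have := near nre x; apply.
  rewrite -/(im i _) imB /im mxE /=; by have := near nim x; apply.
rewrite sumr_const card_ord ler_wpMn2l // addr_ge0 // ltW //.
Unshelve. all: by end_near. Qed.

HB.instance Definition _ := Uniform_isComplete.Build E ell2_complete.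

Lemma ell2_hilbert : hilbert_norm (ell2_ip : {dot E for Num.conj}).
Proof. by move=> x; rewrite ell2_normE -crX cr_dnorm2. Qed.

End Ell2.

(** * Duality over the cone of positive semidefinite matrices *)
Section SemidefiniteAlternative.
Variable R : realType.
Local Notation C := (cplx R).

(** Separation takes place over the reals, so a complex matrix is flattened into real and imaginary
    parts; [dualvec Z] then represents the functional [M -> Re tr (M Z)]. *)
Definition rvec r (M : 'M[C]_r) : 'rV[R]_(r * r + r * r) :=
  row_mx (mxvec (map_mx (@complex.Re R) M)) (mxvec (map_mx (@complex.Im R) M)).

Definition unrvec r (v : 'rV[R]_(r * r + r * r)) : 'M[C]_r :=
  \matrix_(i, j) (vec_mx (lsubmx v) i j +i* vec_mx (rsubmx v) i j)%C.

Lemma rvecK r : cancel (@rvec r) (@unrvec r).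
Proof.
move=> M; apply/matrixP => i j; rewrite mxE row_mxKl row_mxKr !mxvecK !mxE.
by case: (M i j).
Qed.

Lemma unrvecK r : cancel (@unrvec r) (@rvec r).
Proof.
move=> v; rewrite -[RHS]hsubmxK /rvec; congr row_mx; rewrite -[RHS]vec_mxK; congr mxvec.
  by apply/matrixP => i j; rewrite !mxE.
by apply/matrixP => i j; rewrite !mxE.
Qed.

Lemma unrvecD r (u v : 'rV[R]_(r * r + r * r)) : unrvec (u + v) = unrvec u + unrvec v.
Proof. by apply/matrixP => i j; rewrite !mxE; apply/eqP; rewrite eq_complex /= !eqxx. Qed.

Lemma unrvecZ r s (v : 'rV[R]_(r * r + r * r)) : unrvec (s *: v) = cr s *: unrvec v.
Proof.
apply/matrixP => i j; rewrite !mxE; apply/eqP; rewrite eq_complex /= !mul0r subr0 addr0.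
by rewrite !eqxx.
Qed.

Lemma unrvec_entry r (v : 'rV[R]_(r * r + r * r)) j :
  exists k l, `|v 0 j| <= rabs (unrvec v k l).
Proof.
rewrite -{1}(unrvecK v) /rvec; case: (fintype.splitP j) => i ji.
  have -> : j = lshift _ i by apply: val_inj.
  rewrite row_mxEl; case/mxvec_indexP: i {ji} => k l; exists k, l.
  by rewrite mxvecE [map_mx _ _ _ _]mxE Re_le_rabs.
have -> : j = rshift _ i by apply: val_inj.
rewrite row_mxEr; case/mxvec_indexP: i {ji} => k l; exists k, l.
by rewrite mxvecE [map_mx _ _ _ _]mxE Im_le_rabs.
Qed.

Definition dualvec r (Z : 'M[C]_r) : 'cV[R]_(r * r + r * r) :=
  (row_mx (mxvec (map_mx (@complex.Re R) Z^T)) (mxvec (- map_mx (@complex.Im R) Z^T)))^T.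

Lemma rvec_dual r (M Z : 'M[C]_r) : (rvec M *m dualvec Z) 0 0 = complex.Re (\tr (M *m Z)).
Proof.
rewrite /rvec /dualvec tr_row_mx mul_row_col mxE.
have E (A B : 'M[R]_r) : (mxvec A *m (mxvec B)^T) 0 0 = \sum_i \sum_j A i j * B i j.
  rewrite mxE pair_big /= (reindex _ (curry_mxvec_bij _ _)) /=.
  by apply: eq_bigr => -[i j] _; rewrite mxE !mxvecE.
rewrite !E -big_split /mxtrace Re_sum; apply: eq_bigr => i _.
rewrite mxE Re_sum -big_split /=; apply: eq_bigr => j _; rewrite !mxE.
by case: (M i j) (Z j i) => a b [a' b'] /=; ring.
Qed.

Lemma dualvec_surj r (e : 'cV[R]_(r * r + r * r)) : exists Z : 'M[C]_r, e = dualvec Z.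
Proof.
exists (\matrix_(i, j) (vec_mx (lsubmx e^T) j i +i* - vec_mx (rsubmx e^T) j i)%C).
apply: trmx_inj; rewrite trmxK -[LHS]hsubmxK; congr row_mx; rewrite -[LHS]vec_mxK; congr mxvec.
  by apply/matrixP => i j; rewrite !mxE.
by apply/matrixP => i j; rewrite !mxE opprK.
Qed.

Lemma tr_psd_ge0 r (M Z : 'M[C]_r) : psdmx M -> psdmx Z -> 0 <= \tr (M *m Z).
Proof.
move=> /psdmx_gramP [G ->] /psdmx_gramP [H ->].
rewrite -mulmxA mxtrace_mulC -2!mulmxA [X in \tr X]mulmxA.
have -> : G *m adjmx H *m (H *m adjmx G) = adjmx (H *m adjmx G) *m (H *m adjmx G).
  by rewrite adjmxM adjmxK.
rewrite /mxtrace sumr_ge0 // => i _; rewrite mxE sumr_ge0 // => j _.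
by rewrite adjmxE mulrC -normCK exprn_ge0.
Qed.

(** Turns control of the trace into control of the sup norm, in which the coercivity of
    [cone_separation] is stated. *)
Lemma psd_entry_le r (M : 'M[C]_r) i j : psdmx M -> `|M i j| <= \tr M.
Proof.
move=> /psdmx_gramP [G ->]; rewrite mxE; apply: le_trans (ler_norm_sum _ _ _) _.
have trE : \tr (adjmx G *m G) = \sum_l \sum_i `|G l i| ^+ 2.
  rewrite exchange_big; apply: eq_bigr => k _; rewrite mxE; apply: eq_bigr => l _.
  by rewrite adjmxE mulrC -normCK.
rewrite trE; apply: ler_sum => l _; rewrite adjmxE normrM norm_conjC.
have [->|ij] := eqVneq i j.
  by rewrite -expr2 (bigD1 j) //= lerDl sumr_ge0 // => k _; rewrite exprn_ge0.
rewrite (bigD1 i) //= (bigD1 j) 1?eq_sym //= addrA.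
apply: ler_wpDr; first by rewrite sumr_ge0 // => k _; rewrite exprn_ge0.
have -> : `|G l i| * `|G l j| = (`|G l i| * `|G l j| *+ 2) / 2 by rewrite -mulr_natr mulfK ?pnatr_eq0.
rewrite ler_pdivrMr ?ltr0n //.
have sq : `|G l i| * `|G l j| *+ 2 <= `|G l i| ^+ 2 + `|G l j| ^+ 2.
  rewrite -subr_ge0 addrAC -sqrrB real_exprn_even_ge0 // realB ?ger0_real //.
apply: le_trans sq _; rewrite ler_peMr ?ler1n // addr_ge0 ?exprn_ge0 //.
Qed.

Lemma psdmx1 r : psdmx (1%:M : 'M[C]_r).
Proof. by have := psdmx_gram (1%:M : 'M[C]_r); rewrite adjmx1 mulmx1. Qed.

Lemma tr_ge0 r (M : 'M[C]_r) : psdmx M -> 0 <= \tr M.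
Proof. by move=> pM; have := tr_psd_ge0 pM (psdmx1 r); rewrite mulmx1. Qed.

Definition psd_dual r : set 'M[C]_r :=
  [set Z | forall M, psdmx M -> 0 <= complex.Re (\tr (M *m Z))].

Lemma tr_delta r (M : 'M[C]_r) i j : \tr (M *m delta_mx i j) = M j i.
Proof.
rewrite /mxtrace (bigD1 j) //= big1 => [|k kj].
  rewrite addr0 mxE (bigD1 i) //= big1 ?addr0 => [|l li]; first by rewrite mxE !eqxx mulr1.
  by rewrite mxE (negbTE li) mulr0.
by rewrite mxE big1 // => l _; rewrite mxE (negbTE kj) andbF mulr0.
Qed.

(** The cone is the intersection of the half-spaces given by its dual, Hermitian symmetry included;
    hence it is closed. *)
Lemma psd_bidual r (M : 'M[C]_r) :
  psdmx M <-> forall Z, psd_dual Z -> 0 <= complex.Re (\tr (M *m Z)).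
Proof.
split=> [pM Z SZ|H]; first exact: SZ.
have hM (N : 'M[C]_r) i j : psdmx N -> N i j = (N j i)^*.
  by move=> [+ _]; rewrite adjmx_hermsym => /eqP {1}->; rewrite adjmxE.
(* A functional that lies in the dual together with its negative gives a linear equation on [M]; two
   such families express [M i j = (M j i)^*]. *)
have H0 Z : (forall N, psdmx N -> complex.Re (\tr (N *m Z)) = 0) -> complex.Re (\tr (M *m Z)) = 0.
  move=> Z0; apply/eqP; rewrite eq_le; apply/andP; split; last by apply: H => N /Z0 ->.
  have := H (- Z); rewrite mulmxN linearN /= => H'.
  have : 0 <= complex.Re (- \tr (M *m Z)).
    by apply: H' => N /Z0; rewrite mulmxN linearN /=; case: (\tr (N *m Z)) => a b /= ->; rewrite oppr0.
  by case: (\tr _) => a b /=; rewrite oppr_ge0.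
have herm : M \is hermsymmx.
  rewrite adjmx_hermsym; apply/eqP/matrixP => i j; rewrite adjmxE.
  have e1 := H0 (delta_mx j i - delta_mx i j).
  have e2 := H0 ((0 +i* 1)%C *: (delta_mx j i + delta_mx i j)).
  move: e1 e2; rewrite mulmxBr linearB -scalemxAr linearZ mulmxDr linearD /= !tr_delta => e1 e2.
  have {}e1 : complex.Re (M i j) + complex.Re (- M j i) = 0.
    apply: e1 => N /hM E; rewrite mulmxBr linearB /= !tr_delta (E i j).
    by case: (N j i) => a b /=; rewrite subrr.
  have {}e2 : complex.Re ((0 +i* 1)%C * \tr (M *m delta_mx j i + M *m delta_mx i j)) = 0.
    apply: e2 => N /hM E; rewrite -scalemxAr linearZ mulmxDr linearD /= !tr_delta (E i j).
    by case: (N j i) => a b /=; ring.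
  rewrite linearD /= !tr_delta in e2.
  move: e1 e2; case: (M i j) (M j i) => a b [a' b'] /= e1 e2.
  by apply/eqP; rewrite eq_complex /=; apply/andP; split; apply/eqP; lra.
split=> // x.
have xM : (adjmx x *m M *m x) 0 0 = \tr (M *m (x *m adjmx x)).
  by rewrite mulmxA mxtrace_mulC mulmxA /mxtrace big_ord1.
have re : 0 <= complex.Re (\tr (M *m (x *m adjmx x))).
  apply: H => N pN; have : psdmx (x *m adjmx x) by rewrite -{1}[x]adjmxK; exact: psdmx_gram.
  by move/(tr_psd_ge0 pN)/Re_ge0.
rewrite xM -(cr_Re (c := \tr _)) ?cr_ge0 // -xM.
have cc : (adjmx x *m M *m x) 0 0 = ((adjmx x *m M *m x) 0 0)^*.
  rewrite -adjmxE !adjmxM adjmxK; move: herm; rewrite adjmx_hermsym => /eqP <-.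
  by rewrite mulmxA.
move: re cc; rewrite -xM; case: ((adjmx x *m M *m x) 0 0) => a b /= a0 /eqP.
rewrite eq_complex /= eqxx /= lecE /= a0 andbT => /eqP bb; apply/eqP; lra.
Qed.

Lemma closed_psd r : closed [set v : 'rV[R]_(r * r + r * r) | psdmx (unrvec v)].
Proof.
have -> : [set v | psdmx (unrvec v)] = \bigcap_(Z in @psd_dual r) [set v | 0 <= (v *m dualvec Z) 0 0].
  have E (v : 'rV_(r * r + r * r)) Z : (v *m dualvec Z) 0 0 = complex.Re (\tr (unrvec v *m Z)).
    by rewrite -rvec_dual unrvecK.
  by apply/seteqP; split=> v /=; rewrite psd_bidual => H Z SZ; have := H Z SZ; rewrite /= E.
apply: closed_bigI => Z _.
have -> : [set v : 'rV[R]_(r * r + r * r) | 0 <= (v *m dualvec Z) 0 0] =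
  (fun v : 'rV[R]_(r * r + r * r) => (v *m dualvec Z) 0 0) @^-1` [set y | 0 <= y] by [].
apply: preimage_closed; last exact: closed_ge.
move=> v _; move: v.
rewrite (_ : (fun _ => _) = fun v : 'rV[R]_(r * r + r * r) => \sum_i v 0 i * dualvec Z i 0); last by apply/funext => w; rewrite mxE.
have addc : continuous (fun x : R * R => x.1 + x.2) by move=> x; exact: (@add_continuous R).
apply: continuous_big => // i _ v.
by apply: (@continuousM _ _ (fun v : 'rV[R]_(r * r + r * r) => v 0 i) (fun=> dualvec Z i 0)); [exact: coord_continuous|exact: cst_continuous].
Qed.

(* Farkas alternative over the cone of positive semidefinite matrices; the
   coercivity hypothesis makes the image of the cone closed. *)
Lemma psd_alternative D r (Lam : {linear 'M[C]_D -> 'M[C]_r}) (W H : 'M[C]_r) :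
  (forall K, adjmx (Lam K) = Lam (adjmx K)) ->
  (forall K, psdmx K -> \tr K <= \tr (Lam K *m W)) -> adjmx H = H ->
  (exists2 K, psdmx K & H = Lam K) \/
  exists Q : 'M[C]_r, [/\ adjmx Q = Q, forall K, psdmx K -> 0 <= \tr (Lam K *m Q)
    & \tr (H *m Q) < 0].
Proof.
move=> LamA coer Hh.
pose f v := rvec (Lam (@unrvec D v)).
have flin : linear f.
  move=> c u v; rewrite /f unrvecD unrvecZ linearP; apply: (can_inj (@unrvecK r)).
  by rewrite rvecK unrvecD unrvecZ !rvecK.
pose fl : {linear _ -> _} := HB.pack f (GRing.isLinear.Build R _ _ _ f flin).
pose X := lin1_mx f.
have XE v : v *m X = rvec (Lam (unrvec v)) := mul_rV_lin1 fl v.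
case: (@cone_separation R _ _ [set v | psdmx (@unrvec D v)] X (dualvec W) 1 (rvec H)).
- exact: closed_psd.
- rewrite /= (_ : unrvec 0 = 0); first by split=> [|x]; rewrite ?adjmx_hermsym ?adjmx0 // mulmx0 mul0mx mxE.
  by apply/matrixP => i j; rewrite !mxE.
- move=> u v /= pu pv; rewrite unrvecD.
  have := @psdmx_sum R D bool (index_enum _) predT (fun b : bool => if b then unrvec u else unrvec v).
  by rewrite big_bool; apply=> -[].
- by move=> s v s0 /= pv; rewrite unrvecZ; apply: psdmxZ; rewrite ?cr_ge0.
- move=> v /= pv; rewrite mul1r XE rvec_dual.
  have tr0 := tr_ge0 pv.
  rewrite -ler_cr cr_Re; last exact: le_trans tr0 (coer _ pv).
  apply: le_trans (coer _ pv); rewrite -(cr_Re tr0) ler_cr.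
  rewrite [X in X <= _](mx_normrE v); apply/bigmax_leP; split; first exact: Re_ge0.
  move=> [i j] _ /=; rewrite (ord1 i) {i}; have [k [l le]] := unrvec_entry v j.
  apply: le_trans le _; rewrite -ler_cr cr_rabs cr_Re //; exact: psd_entry_le.
- by case=> v pv E; left; exists (unrvec v) => //; rewrite -[LHS]rvecK E XE rvecK.
- case=> e eK eH; right; have [Z eZ] := dualvec_surj e; rewrite {}eZ in eK eH.
  (* The separating functional is [Re tr (M Z)], which on Hermitian [M] equals [tr (M Q)] for the
     Hermitian part [Q] of [Z]. *)
  pose Q := 2^-1 *: (Z + adjmx Z).
  have trQ M : adjmx M = M -> \tr (M *m Q) = cr (complex.Re (\tr (M *m Z))).
    move=> hM; rewrite /Q -scalemxAr linearZ /= mulmxDr linearD /=.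
    have -> : \tr (M *m adjmx Z) = (\tr (M *m Z))^*.
      rewrite -[in LHS]hM -adjmxM mxtrace_mulC -[LHS]/(\sum_i _) rmorph_sum.
      by apply: eq_bigr => i _; rewrite adjmxE.
    case: (\tr _) => a b; rewrite -[(_ +i* _)%C^*]/((a +i* - b)%C).
    have -> : (a +i* b + a +i* - b)%C = 2 * cr a :> C.
      by rewrite mulr_natl mulr2n; apply/eqP; rewrite eq_complex /= subrr addr0 !eqxx.
    by rewrite mulrA mulVf ?pnatr_eq0 // mul1r.
  exists Q; split.
  + by rewrite /Q adjmxZ adjmxD adjmxK addrC conj_Creal // rpredV realn.
  + move=> K pK; rewrite trQ; last by rewrite LamA; move: pK => [+ _]; rewrite adjmx_hermsym => /eqP <-.
    by rewrite cr_ge0 -rvec_dual -[K]rvecK -XE; apply: eK; rewrite /= rvecK.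
  + by rewrite trQ // -cr0 ltr_cr -rvec_dual.
Qed.

End SemidefiniteAlternative.

(** * Sums of terms K_k - M_k K_k M_k^* with K_k positive semidefinite *)

Section AglerDecomposition.
Variables (R : realType) (d n r : nat).
Local Notation C := (cplx R).
Variable M : 'I_d -> 'M[C]_r.
Variable W : 'M[C]_r.
(** A strict Lyapunov weight common to all [M k]: it supplies the coercivity that closes the image
    of the cone, and later the perturbation that makes the certificate strict. *)
Hypothesis Wcoer : forall k, psdmx (W - adjmx (M k) *m W *m M k - 1%:M).
Hypothesis Wherm : adjmx W = W.
Variables al be : 'M[C]_(r, n).
Local Notation H := (be *m adjmx al + al *m adjmx be).

Let D := (d * r)%N.
(** [E k] reads off the [k]-th block of length [r]: a [d]-tuple of positive matrices is encoded by
    the diagonal blocks of one positive matrix, and the alternative over a single cone applies. *)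
Let E (k : 'I_d) : 'M[C]_(r, D) := \matrix_(i, l) (l == mxvec_index k i)%:R.

Let E_orth k l : E k *m adjmx (E l) = (if k == l then 1%:M else 0).
Proof.
apply/matrixP => i j; rewrite mxE (bigD1 (mxvec_index k i)) //= big1 => [|x xi].
  rewrite addr0 adjmxE !mxE eqxx mul1r conjC_nat.
  have [g gK _] := curry_mxvec_bij d r.
  have -> : (mxvec_index k i == mxvec_index l j) = (k == l) && (i == j).
    apply/eqP/andP => [e|[/eqP -> /eqP ->] //].
    have := gK (k, i) isT; have := gK (l, j) isT; rewrite /= e => -> [-> ->].
    by rewrite !eqxx.
  by case: (k == l); rewrite mxE.
by rewrite mxE (negbTE xi) mul0r.
Qed.

Let E_sum : \sum_k adjmx (E k) *m E k = 1%:M.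
Proof.
apply/matrixP => x y; case/mxvec_indexP: x => k i; rewrite summxE (bigD1 k) //= big1 => [|l lk].
  rewrite addr0 mxE (bigD1 i) //= big1 => [|j ji]; rewrite adjmxE !mxE.
    by rewrite addr0 eqxx conjC1 mul1r eq_sym.
  rewrite [_ == mxvec_index k j](_ : _ = false) ?conjC0 ?mul0r //.
  have := E_orth k k => /matrixP /(_ i j); rewrite eqxx mxE (bigD1 (mxvec_index k i)) //=.
  rewrite big1 => [|x xi]; last by rewrite mxE (negbTE xi) mul0r.
  rewrite addr0 adjmxE !mxE eqxx mul1r conjC_nat [i == j]eq_sym (negbTE ji).
  by move/eqP; rewrite pnatr_eq0 eqb0 => /negbTE.
rewrite mxE big1 // => j _; rewrite adjmxE !mxE.
rewrite [_ == mxvec_index l j](_ : _ = false) ?conjC0 ?mul0r //.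
have := E_orth k l => /matrixP /(_ i j); rewrite eq_sym (negbTE lk) mxE (bigD1 (mxvec_index k i)) //=.
rewrite big1 => [|x xi]; last by rewrite mxE (negbTE xi) mul0r.
rewrite addr0 adjmxE !mxE eqxx mul1r conjC_nat.
by move/eqP; rewrite pnatr_eq0 eqb0 => /negbTE.
Qed.

Let lam (K : 'M[C]_D) : 'M[C]_r := \sum_k (E k *m K *m adjmx (E k)
   - M k *m (E k *m K *m adjmx (E k)) *m adjmx (M k)).

Let lam_linear : linear lam.
Proof.
move=> c A B; rewrite /lam scaler_sumr -big_split; apply: eq_bigr => k _ /=.
rewrite !(mulmxDr, mulmxDl) -!scalemxAr -!scalemxAl -!scalemxAr -!scalemxAl scalerBr opprD.
by rewrite addrACA.
Qed.
Let Lam : {linear 'M[C]_D -> 'M[C]_r} :=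
  HB.pack lam (GRing.isLinear.Build C 'M[C]_D 'M[C]_r _ lam lam_linear).

Let lam_adj K : adjmx (lam K) = lam (adjmx K).
Proof.
rewrite /lam adjmx_sum; apply: eq_bigr => k _.
by rewrite adjmxB !adjmxM !adjmxK !mulmxA.
Qed.

Let step_tr k (K Q : 'M[C]_r) :
  \tr ((K - M k *m K *m adjmx (M k)) *m Q) = \tr (K *m (Q - adjmx (M k) *m Q *m M k)).
Proof.
rewrite mulmxBl mulmxBr [LHS]linearB [RHS]linearB /=; congr (_ - _).
by rewrite -!mulmxA mxtrace_mulC !mulmxA.
Qed.

Let lam_coercive K : psdmx K -> \tr K <= \tr (lam K *m W).
Proof.
move=> pK; have -> : \tr K = \sum_k \tr (E k *m K *m adjmx (E k)).
  rewrite -[K in LHS]mul1mx -E_sum mulmx_suml linear_sum; apply: eq_bigr => k _.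
  by rewrite -mulmxA mxtrace_mulC.
rewrite /lam mulmx_suml linear_sum /=; apply: ler_sum => k _; rewrite step_tr.
rewrite -subr_ge0 -{2}[_ *m adjmx (E k)]mulmx1 -linearB -mulmxBr /=.
by apply: tr_psd_ge0 => //; rewrite -{1}[E k]adjmxK; exact: psdmx_congr.
Qed.

Lemma positive_certificate :
  (exists K : 'I_d -> 'M[C]_r, (forall k, psdmx (K k)) /\
    H = \sum_k (K k - M k *m K k *m adjmx (M k))) \/
  exists (Q : 'M[C]_r) (e : R), [/\ 0 < e, adjmx Q = Q,
    forall k, psdmx (Q - adjmx (M k) *m Q *m M k - (cr e)%:M) & \tr (H *m Q) < 0].
Proof.
have hH : adjmx H = H by rewrite adjmxD !adjmxM !adjmxK addrC.
case: (psd_alternative (Lam := Lam) lam_adj lam_coercive hH).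
  case=> K pK HE; left; exists (fun k => E k *m K *m adjmx (E k)); split; last exact: HE.
  move=> k.
  by rewrite -{1}[E k]adjmxK; exact: psdmx_congr.
case=> Q [hQ pQ nQ]; right.
have trreal (A B : 'M[C]_r) : adjmx A = A -> adjmx B = B -> \tr (A *m B) = cr (complex.Re (\tr (A *m B))).
  move=> hA hB; have : \tr (A *m B) = (\tr (A *m B))^*.
    rewrite -{1}hA -{1}hB -adjmxM mxtrace_mulC -[LHS]/(\sum_i _) rmorph_sum.
    by apply: eq_bigr => i _; rewrite adjmxE.
  case: (\tr _) => a b /eqP; rewrite eq_complex /= eqxx /= => /eqP bb.
  by apply/eqP; rewrite eq_complex /= eqxx /=; apply/eqP; lra.
have pQk k : psdmx (Q - adjmx (M k) *m Q *m M k).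
  split; first by rewrite adjmx_hermsym adjmxB !adjmxM adjmxK hQ mulmxA.
  (* The rank-one matrix [x x^*] placed in block [k] tests the certificate one variable at a
     time. *)
  move=> x; have := pQ (adjmx (E k) *m (x *m adjmx x) *m E k); rewrite -[GRing.Linear.sort Lam _]/(lam _).
  have -> : lam (adjmx (E k) *m (x *m adjmx x) *m E k) =
      x *m adjmx x - M k *m (x *m adjmx x) *m adjmx (M k).
    rewrite /lam (bigD1 k) //= big1 => [|l lk].
      have -> : E k *m (adjmx (E k) *m (x *m adjmx x) *m E k) *m adjmx (E k) = x *m adjmx x.
        by rewrite !mulmxA E_orth eqxx mul1mx -!mulmxA E_orth eqxx mulmx1.
      by rewrite addr0.
    have -> : E l *m (adjmx (E k) *m (x *m adjmx x) *m E k) = 0.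
      by rewrite !mulmxA E_orth (negbTE lk) !mul0mx.
    by rewrite !mul0mx mulmx0 mul0mx subrr.
  rewrite step_tr => h; have {}h : 0 <= \tr (x *m adjmx x *m (Q - adjmx (M k) *m Q *m M k)).
    by apply: h; apply: psdmx_congr; rewrite -{1}[x]adjmxK; exact: psdmx_gram.
  by rewrite -mulmxA mxtrace_mulC /mxtrace big_ord1 in h.
pose a := - complex.Re (\tr (H *m Q)); pose w := complex.Re (\tr (H *m W)).
have a0 : 0 < a by rewrite oppr_gt0 -ltr_cr cr0 -trreal.
(* Small enough that [e w <= a / 2]: adding [e W] makes the inequality for [Q] strict and keeps
   [tr (H Q)] negative. *)
pose e := a / (2 * (`|w| + 1)).
have w1 : 0 < 2 * (`|w| + 1) by rewrite mulr_gt0 // ltr_wpDl.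
have e0 : 0 < e by rewrite divr_gt0.
exists (Q + cr e *: W), e; split; first exact: e0.
- by rewrite adjmxD adjmxZ conj_cr hQ Wherm.
- move=> k.
  have -> : Q + cr e *: W - adjmx (M k) *m (Q + cr e *: W) *m M k - (cr e)%:M =
      \sum_(b : bool) (if b then Q - adjmx (M k) *m Q *m M k
        else cr e *: (W - adjmx (M k) *m W *m M k - 1%:M)).
    rewrite big_bool /= mulmxDr mulmxDl -scalemxAr -scalemxAl !scalerBr scale_scalar_mx mulr1.
    by rewrite opprD addrACA -!addrA.
  by apply: psdmx_sum => -[] _ //; apply: psdmxZ; rewrite // cr_ge0 ltW.
- rewrite mulmxDr -scalemxAr linearD linearZ /= (trreal _ _ hH hQ) (trreal _ _ hH Wherm).
  rewrite -crM -crD -cr0 ltr_cr -/w.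
  have : e * w <= a / 2.
    apply: le_trans (_ : e * `|w| <= _); first by rewrite ler_wpM2l ?(ltW e0) ?ler_norm.
    rewrite /e invfM mulrA mulrAC -mulrA ler_piMr ?divr_ge0 ?(ltW a0) //.
    by rewrite ler_pdivrMr ?ltr_wpDl // mul1r lerDl.
  have -> : complex.Re (\tr (H *m Q)) = - a by rewrite opprK.
  by move: (a) a0 (e * w) => x x0 y; lra.
Qed.

End AglerDecomposition.

(** * The certificate as a Hilbert norm *)

Section Certificate.
Variables (R : realType) (d r N : nat).
Local Notation C := (cplx R).
Hypothesis d0 : (0 < d)%N.
Variable M : 'I_d -> 'M[C]_r.
Hypothesis Mnil : forall k (x : 'cV[C]_r), iter N.+1 (mulmx (M k)) x = 0.
Variables (Q : 'M[C]_r) (e : R).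
Hypothesis e0 : 0 < e.
Hypothesis Qpos : forall k, psdmx (Q - adjmx (M k) *m Q *m M k - (cr e)%:M).
Local Notation form y := ((adjmx y *m Q *m y) 0 0).

Lemma form_step k (y : 'cV[C]_r) : form (M k *m y) + cr e * (adjmx y *m y) 0 0 <= form y.
Proof.
have [_ /(_ y)] := Qpos k.
have -> : adjmx y *m (Q - adjmx (M k) *m Q *m M k - (cr e)%:M) *m y =
    adjmx y *m Q *m y - adjmx (M k *m y) *m Q *m (M k *m y) - cr e *: (adjmx y *m y).
  by rewrite 2!mulmxBr 2!mulmxBl adjmxM !mulmxA mul_mx_scalar -scalemxAl.
move: (adjmx y *m Q *m y) (_ *m Q *m _) (adjmx y *m y) => a b c; rewrite !mxE => h.
by rewrite -subr_ge0 opprD addrA.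
Qed.

(** The form does not increase along the orbit of [M k], which reaches [0] after finitely many steps
    by nilpotency. Some variable [k] exists because [d] is positive. *)
Lemma form_ge0 (y : 'cV[C]_r) : 0 <= form y.
Proof.
pose k : 'I_d := Ordinal d0.
suff H j (x : 'cV[C]_r) : iter j (mulmx (M k)) x = 0 -> 0 <= form x by exact: H (Mnil k y).
elim: j x => [|j IH] x; first by move=> /= ->; rewrite mulmx0 mxE.
rewrite iterSr => /IH h; apply: le_trans (form_step k x); apply: addr_ge0 => //.
by rewrite mulr_ge0 ?cr_ge0 ?(ltW e0) ?adjmx_self_ge0.
Qed.

Lemma form_lower (y : 'cV[C]_r) : cr e * (adjmx y *m y) 0 0 <= form y.
Proof. by apply: le_trans (form_step (Ordinal d0) y); rewrite lerDr form_ge0. Qed.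

Lemma nilpotent_unit k : 1%:M - M k \in unitmx.
Proof.
rewrite unitmxE unitfE; apply: det_neq0_ker => y; rewrite mulmxBl mul1mx => /eqP.
rewrite subr_eq0 => /eqP yM; rewrite -(Mnil k y).
by elim: N.+1 => [//|j IH]; rewrite iterS -IH.
Qed.

Hypothesis Qherm : adjmx Q = Q.

Lemma certificate_factor : exists2 G : 'M[C]_r, G \in unitmx & Q = adjmx G *m G.
Proof.
have [G QE] : exists G : 'M[C]_r, Q = adjmx G *m G.
  apply: psdmx_gramP; split; first by rewrite adjmx_hermsym Qherm.
  exact: form_ge0.
exists G => //; rewrite unitmxE unitfE; apply: det_neq0_ker => y Gy.
apply: adjmx_self_eq0; apply/eqP; rewrite eq_le adjmx_self_ge0 andbT.
have := form_lower y; rewrite QE -!mulmxA Gy !mulmx0 [X in _ <= X]mxE pmulr_rle0 //.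
by rewrite -cr0 ltr_cr.
Qed.

End Certificate.

Lemma adj_polar (R : realType) p (a b : 'cV[cplx R]_p) :
  (adjmx (a - b) *m (a + b)) 0 0 + (adjmx (a + b) *m (a - b)) 0 0 =
  2 * ((adjmx a *m a) 0 0 - (adjmx b *m b) 0 0).
Proof.
rewrite adjmxB adjmxD mulmxBl mulmxDl !mulmxBr !mulmxDr.
move: (adjmx a *m a) (adjmx a *m b) (adjmx b *m a) (adjmx b *m b) => x y z w.
by rewrite !mxE; ring.
Qed.

(** * The accretive tuple built from the certificate *)

Section OperatorTuple.
Variables (R : realType) (d n r N : nat).
Local Notation C := (cplx R).
Local Notation E := (ell2 R r).
Local Notation ip := (@ell2_ip R r : {dot E for Num.conj}).
Hypothesis d0 : (0 < d)%N.
Variable M : 'I_d -> 'M[C]_r.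
Hypothesis Mcomm : forall k l, M k *m M l = M l *m M k.
Hypothesis Mnil : forall k (x : 'cV[C]_r), iter N.+1 (mulmx (M k)) x = 0.
Variables (G : 'M[C]_r) (e : R).
Hypothesis Gu : G \in unitmx.
Hypothesis e0 : 0 < e.
Local Notation Q := (adjmx G *m G).
Hypothesis Qpos : forall k, psdmx (Q - adjmx (M k) *m Q *m M k - (cr e)%:M).

Lemma ell2_ten (x : 'cV[C]_r) : dnorm ip x = ten_norm (@scal_ip R) (fun i => x i 0 : C^o).
Proof.
rewrite /ten_norm /dnorm /= /ell2_ip /dot_sum mxE; congr (complex.Re (sqrtC _)).
by apply: eq_bigr => i _; rewrite adjmxE mulrC.
Qed.

Lemma ell2_mul_bounded (A : 'M[C]_r) : exists2 c : R, 0 <= c &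
  forall x : 'cV[C]_r, dnorm ip (A *m x) <= c * dnorm ip x.
Proof.
have [c c0 cP] := mxact_bounded (@scal_ip R) A; exists c => // x.
rewrite !ell2_ten; apply: le_trans (cP _); rewrite le_eqVlt; apply/orP; left; apply/eqP.
by congr (ten_norm _ _); apply/funext => i; rewrite mxE.
Qed.

(** Inverse Cayley transform of [M k], conjugated by [G] so that the norm of the certificate becomes
    the Euclidean one; [1 - M k] is invertible by nilpotency. *)
Definition cay_mx k : 'M[C]_r := G *m (1%:M + M k) *m invmx (1%:M - M k) *m invmx G.

Definition cay_op k (x : E) : E := cay_mx k *m (x : 'cV[C]_r).

Lemma cay_op_linear k : linear (cay_op k).
Proof. by move=> c x y; rewrite /cay_op mulmxDr -scalemxAr. Qed.
HB.instance Definition _ k := GRing.isLinear.Build C E E _ (cay_op k) (cay_op_linear k).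

Let onepM k : 1%:M - M k \in unitmx := nilpotent_unit Mnil k.

Lemma cay_opE k (y : 'cV[C]_r) : cay_op k (G *m ((1%:M - M k) *m y)) = G *m ((1%:M + M k) *m y).
Proof. by rewrite /cay_op /cay_mx -!mulmxA (mulKmx Gu) (mulKmx (onepM k)). Qed.

Lemma cay_op_param k (u : 'cV[C]_r) : exists y : 'cV[C]_r, u = G *m ((1%:M - M k) *m y).
Proof.
by exists (invmx (1%:M - M k) *m (invmx G *m u)); rewrite (mulKVmx (onepM k)) (mulKVmx Gu).
Qed.

Lemma cay_op_bounded k : bounded_op (cay_op k).
Proof.
have [c c0 cP] := ell2_mul_bounded (cay_mx k); exists c => x.
by rewrite !ell2_normE -crM ler_cr; exact: cP.
Qed.

Lemma cay_op_accretive k : strictly_accretive ip (cay_op k).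
Proof.
have [c c0 cP] := ell2_mul_bounded (G *m (1%:M - M k)).
have c1 : 0 < c ^+ 2 + 1 by rewrite ltr_wpDl ?sqr_ge0.
(* With [u = G (1 - M) y] the accretivity form equals [2 (|G y|^2 - |G M y|^2) >= 2 e |y|^2], while
   [|u| <= c |y|]; the added [1] avoids division by zero. *)
exists (2 * e / (c ^+ 2 + 1)); first by rewrite divr_gt0 // mulr_gt0.
move=> u; have [y ->] := cay_op_param k u; rewrite cay_opE.
set u' := G *m ((1%:M - M k) *m y).
have -> : ip (G *m ((1%:M + M k) *m y)) u' + ip u' (G *m ((1%:M + M k) *m y)) =
    2 * ((adjmx y *m Q *m y) 0 0 - (adjmx (M k *m y) *m Q *m (M k *m y)) 0 0).
  rewrite /= /ell2_ip /u' !mulmxDl mulNmx !mul1mx; set w := M k *m y.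
  by rewrite mulmxBr mulmxDr adj_polar 2!adjmxM !mulmxA.
have step := form_step Qpos k y.
rewrite -(cr_dnorm2 ip u') -/(cr _) -crM.
have le : dnorm ip u' <= c * dnorm ip y by rewrite /u' mulmxA; exact: cP.
have yy : (adjmx y *m y) 0 0 = cr (dnorm ip y ^+ 2) by rewrite cr_dnorm2.
rewrite yy -crM in step.
apply: (@le_trans _ _ (2 * cr (e * dnorm ip y ^+ 2))); last first.
  by rewrite ler_pM2l ?ltr0n // lerBrDl.
rewrite -[2 in leRHS](cr_nat R 2) -crM ler_cr.
rewrite [leLHS](_ : _ = 2 * (e * (dnorm ip u' ^+ 2 / (c ^+ 2 + 1)))); last by ring.
rewrite ler_pM2l // ler_pM2l // ler_pdivrMr //; apply: le_trans (_ : c ^+ 2 * dnorm ip y ^+ 2 <= _).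
  by rewrite -exprMn ler_sqr ?nnegrE ?mulr_ge0 ?dnorm_nneg.
by rewrite mulrC ler_wpM2l ?sqr_ge0 // lerDl.
Qed.

Lemma cay_op_comm k l x : cay_op k (cay_op l x) = cay_op l (cay_op k x).
Proof.
have [y xE] := cay_op_param l x; have [y' yE] : exists y', y = (1%:M - M k) *m y'.
  by exists (invmx (1%:M - M k) *m y); rewrite (mulKVmx (onepM k)).
have c1 (a b : C) : (1%:M + a *: M l) *m (1%:M + b *: M k) = (1%:M + b *: M k) *m (1%:M + a *: M l).
  rewrite 2!mulmxDl !mulmxDr !mul1mx !mulmx1 -!scalemxAl -!scalemxAr Mcomm !scalerA [a * b]mulrC.
  by exact: addrACA.
have mm (a b : C) (z : 'cV[C]_r) : (1%:M + a *: M l) *m ((1%:M + b *: M k) *m z) = (1%:M + b *: M k) *m ((1%:M + a *: M l) *m z).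
  by rewrite !mulmxA c1.
have m1 := mm (-1) (-1) y'; have m2 := mm 1 (-1) y'; have m3 := mm (-1) 1 y'; have m4 := mm 1 1 y'.
rewrite !scaleN1r ?scale1r in m1 m2 m3 m4.
transitivity (G *m ((1%:M + M k) *m ((1%:M + M l) *m y')) : E).
  by rewrite xE yE cay_opE m2 cay_opE.
by rewrite -m4 xE yE m1 cay_opE -m3 cay_opE.
Qed.

Lemma cayley_cay_op k (x : 'cV[C]_r) : cayley_op (cay_op k) x = G *m (M k *m (invmx G *m x)).
Proof.
pose y := 2^-1 *: (invmx G *m x).
pose u : E := G *m ((1%:M - M k) *m y).
have cu : cay_op k u = G *m ((1%:M + M k) *m y) by exact: cay_opE.
have yy : y + y = invmx G *m x.
  by rewrite /y -scalerDl -[2^-1]mul1r -mulrDl divff ?pnatr_eq0 // scale1r.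
have xE : x = cay_op k u + u.
  rewrite cu /u -[RHS]mulmxDr -mulmxDl addrACA subrr addr0 mulmxDl mul1mx yy.
  by rewrite (mulKVmx Gu).
rewrite {1}xE (cayley_opE (@ell2_hilbert R r) (cay_op_bounded k) (cay_op_accretive k)) -[GRing.Linear.sort _ u]/(cay_op k u) cu /u.
rewrite -[LHS]mulmxBr -mulmxBl opprB addrC subrKA -yy.
by rewrite mulmxDl -mulmxDr.
Qed.

Local Notation Mop := (fun k => mulmx (M k) : {linear 'cV[C]_r -> 'cV[C]_r}).

Lemma op_monomial_cay t (x : 'cV[C]_r) :
  op_monomial (fun k => cayley_op (cay_op k)) t (x : E) = G *m opmon Mop t (invmx G *m x).
Proof.
rewrite /op_monomial /opmon; elim: (index_enum _) => [|l s IH].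
  by rewrite !big_nil /= (mulKVmx Gu).
rewrite !big_cons /= IH; elim: (t l) => [//|m IHm]; rewrite !iterS IHm cayley_cay_op.
by rewrite (mulKmx Gu).
Qed.

Lemma opmon_nilpotent t x : t \notin mbox d N -> opmon Mop t x = 0.
Proof.
rewrite mem_mbox negb_forall => /existsP [k]; rewrite -ltnNge => Nt.
have cM a b (y : 'cV[C]_r) : Mop a (Mop b y) = Mop b (Mop a y) by rewrite /= !mulmxA Mcomm.
suff H j : forall t : {ffun 'I_d -> nat}, t k = j -> exists y, opmon Mop t x = iter j (mulmx (M k)) y.
  have [y ->] := H _ t erefl; rewrite -(subnK Nt) iterD Mnil.
  by elim: (_ - _)%N => [//|m IH]; rewrite iterS IH mulmx0.
elim: j => [|j IH] s sk; first by exists (opmon Mop s x).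
have s0 : s k != 0%N by rewrite sk.
have [|y yE] := IH (mdecr k s); first by rewrite ffunE eqxx sk subn1.
by exists y; rewrite -(mdecrK s0) (opmon_mincr cM) yE.
Qed.

(** [al] and [be] will hold the coefficients of denominator and numerator; the hypothesis says that
    the calculus sends the columns of [al] to those of [be]. Accretivity at the vector formed by the
    columns of [G al] is then the trace inequality. *)
Lemma certificate_nonneg (g : 'rV[C]_d -> 'M[C]_n) (al be : 'M[C]_(r, n)) :
  herglotz_agler g ->
  (forall Fhat, power_series_on_polydisk (g \o @cayley_point R d) Fhat -> forall i,
     \sum_(t <- mbox d N) \sum_j Fhat t i j *: opmon Mop t (col j al) = col i be) ->
  0 <= \tr ((be *m adjmx al + al *m adjmx be) *m Q).
Proof.
move=> [_ HA] Hab.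
have [S [Fhat ps sm] acc] := HA E ip (@ell2_hilbert R r) (fun k => cay_op k : {linear E -> E})
  cay_op_bounded cay_op_comm cay_op_accretive.
pose h (i : 'I_n) : E := G *m col i al.
pose Sb (i : 'I_n) : E := G *m col i be.
(* [S] is known only as a limit of partial sums; by nilpotency they all equal [Sb] once the box is
   included. *)
have SE : S h = Sb.
  apply/esym/eqP; rewrite -subr_eq0; apply/eqP/(dnorm_eq0P (ip := dot_sum ip (q := n))).
  apply/eqP; rewrite eq_le dnorm_nneg andbT -/(ten_norm ip _).
  apply/ler_addgt0Pr => c c0; rewrite add0r.
  have h1 : 0 < ten_norm ip h + 1 by rewrite ltr_wpDl // dnorm_nneg.
  have [A _ AP] := sm (c / (ten_norm ip h + 1)) (divr_gt0 c0 h1).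
  have := AP (A `|` mbox d N)%fset (fsubsetUl _ _) h.
  rewrite !(tens_norm_ten_norm (@ell2_hilbert R r)) -[(_%:C)%C]/(cr _) -crM ler_cr.
  have -> : partial_sum (fun t => tens_op (Fhat t) (op_monomial (fun k => cayley_op (cay_op k)) t) h)
      (A `|` mbox d N)%fset = Sb.
    rewrite /partial_sum.
    rewrite -(big_seq_fsetE _ (A `|` mbox d N)%fset xpredT (fun t => tens_op (Fhat t) (op_monomial (fun k => cayley_op (cay_op k)) t) h)) /=.
    have tE t : tens_op (Fhat t) (op_monomial (fun k => cayley_op (cay_op k)) t) h =
       fun i => (G *m \sum_j Fhat t i j *: opmon Mop t (col j al) : E).
      apply/funext => i; rewrite /tens_op mulmx_sumr; apply: eq_bigr => j _.
      by rewrite op_monomial_cay (mulKmx Gu) -scalemxAr.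
    apply/funext => i; rewrite fct_sumE /Sb -(Hab Fhat ps) mulmx_sumr.
    rewrite (eq_bigr (fun t => (G *m \sum_j Fhat t i j *: opmon Mop t (col j al) : E))) => [|t _]; last by rewrite tE.
    apply: sum_support; rewrite ?fset_uniq // => t nz.
    rewrite in_fsetU; case: (boolP (t \in mbox d N)) => tb; rewrite ?orbT // orbF.
    exfalso; case/eqP: nz; rewrite big1 ?mulmx0 // => j _.
    by rewrite opmon_nilpotent ?scaler0.
  move=> le; apply: le_trans le _; rewrite mulrAC ler_pdivrMr // ler_pM2l // lerDl //.
have := acc h; rewrite SE; congr (is_true (_ <= _)).
have tE (a b : 'M[C]_(r, n)) : tens_ip ip (fun i => G *m col i a : E) (fun i => G *m col i b : E) =
    \tr (a *m adjmx b *m Q).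
  rewrite -mulmxA mxtrace_mulC /tens_ip /mxtrace; apply: eq_bigr => i _.
  transitivity ((adjmx (col i b) *m (Q *m col i a)) 0 0).
    by rewrite /= /ell2_ip adjmxM !mulmxA.
  rewrite -[adjmx b *m _ *m a]mulmxA [LHS]mxE [RHS]mxE.
  apply: eq_bigr => j _; rewrite !adjmxE [col i b j 0]mxE; congr (_ * _).
  by rewrite [LHS]mxE [RHS]mxE; apply: eq_bigr => l _; rewrite [col i a l 0]mxE.
by rewrite mulmxDl linearD /= -!tE.
Qed.

End OperatorTuple.

(** * Coefficients of polynomials and power series *)
Section SmallOrder.
Variable R : realType.
Local Notation C := (cplx R).

Lemma rabsM (x y : C) : rabs (x * y) = rabs x * rabs y.
Proof. by apply: (@cr_inj R); rewrite crM !cr_rabs normrM. Qed.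

Lemma rabsN (x : C) : rabs (- x) = rabs x.
Proof. by rewrite /rabs normrN. Qed.

Lemma rabs_cr (x : R) : rabs (cr x) = `|x|.
Proof. by apply: (@cr_inj R); rewrite cr_rabs norm_cr. Qed.

Lemma rabsX (x : C) k : rabs (x ^+ k) = rabs x ^+ k.
Proof. by apply: (@cr_inj R); rewrite crX !cr_rabs normrX. Qed.

Lemma rabsD_le (x y : C) : rabs (x + y) <= rabs x + rabs y.
Proof. by rewrite -ler_cr crD !cr_rabs ler_normD. Qed.

Lemma rabsB_le (x y : C) : rabs (x - y) <= rabs x + rabs y.
Proof. by rewrite -(rabsN y) rabsD_le. Qed.

Lemma rabs0 : rabs (0 : C) = 0.
Proof. by rewrite /rabs normr0. Qed.

Lemma rabs_eq0 (x : C) : rabs x = 0 -> x = 0.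
Proof. by move=> h; apply/eqP; rewrite -normr_eq0 -cr_rabs h cr0. Qed.

Lemma rabs_sum_le I (r : seq I) (P : pred I) (F : I -> C) :
  rabs (\sum_(i <- r | P i) F i) <= \sum_(i <- r | P i) rabs (F i).
Proof.
elim/big_ind2 : _ => [|x a y b xa yb|//]; first by rewrite rabs0.
by apply: le_trans (rabsD_le _ _) _; exact: lerD.
Qed.

Lemma rabs_prod I (r : seq I) (P : pred I) (F : I -> C) :
  rabs (\prod_(i <- r | P i) F i) = \prod_(i <- r | P i) rabs (F i).
Proof.
apply: (big_morph (@rabs R)); first exact: rabsM.
by apply: (@cr_inj R); rewrite cr_rabs normr1 cr1.
Qed.

(** Strong induction on [j]: once the lower coefficients vanish, division by [l ^+ j] leaves [c j]
    plus terms of order [l]. *)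
Lemma small_coef D (c : 'I_D -> C) (K : R) m :
  (forall l : R, 0 < l <= 1 -> rabs (\sum_j c j * cr l ^+ j) <= K * l ^+ m) ->
  forall j : 'I_D, (j < m)%N -> c j = 0.
Proof.
move=> cK j; have [k] := ubnP (j : nat); elim: k j => // k IH j jk jm.
apply: rabs_eq0; apply/eqP; rewrite eq_le rabs_ge0 andbT.
pose B := K + \sum_i rabs (c i).
have K0 : 0 <= K.
  have := cK 1; rewrite ltr01 lexx expr1n mulr1 => /(_ isT); apply: le_trans; exact: rabs_ge0.
have B0 : 0 <= B by rewrite addr_ge0 // sumr_ge0 // => i _; exact: rabs_ge0.
have bound l : 0 < l <= 1 -> rabs (c j) <= B * l.
  move=> /[dup] l01 /andP [l0 l1].
  rewrite -(ler_pM2r (exprn_gt0 j l0)) -mulrA -exprS.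
  have -> : rabs (c j) * l ^+ j = rabs (c j * cr l ^+ j).
    by rewrite rabsM rabsX rabs_cr gtr0_norm.
  have -> : c j * cr l ^+ j = \sum_i c i * cr l ^+ i - \sum_(i | i != j) c i * cr l ^+ i.
    by rewrite [\sum_i c i * _](bigD1 j) //= addrK.
  apply: le_trans (rabsB_le _ _) _; rewrite mulrDl; apply: lerD.
    apply: le_trans (cK l l01) _; rewrite ler_wpM2l //.
    by rewrite ler_wiXn2l // ltW.
  apply: le_trans (rabs_sum_le _ _ _) _; rewrite mulr_suml [leRHS](bigID (fun i => i != j)) /=.
  apply: ler_wpDr.
    by apply: sumr_ge0 => i _; rewrite mulr_ge0 ?rabs_ge0 ?exprn_ge0 // ltW.
  apply: ler_sum => i ij; have [lt|ge] := ltnP i j.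
    by rewrite (IH i (leq_trans lt jk) (ltn_trans lt jm)) mul0r rabs0 mul0r.
  rewrite rabsM rabsX rabs_cr gtr0_norm // ler_wpM2l ?rabs_ge0 //.
  by rewrite ler_wiXn2l ?(ltW l0) // ltn_neqAle ge andbT; apply: contra ij => /eqP e; apply/eqP/val_inj.
apply/ler_addgt0Pr => e e0; rewrite add0r.
have Be : 0 < B + e by rewrite ltr_wpDl.
have l01 : 0 < Num.min 1 (e / (B + e)) <= 1 by rewrite lt_min ltr01 divr_gt0 //= ge_min lexx.
apply: le_trans (bound _ l01) _.
apply: le_trans (_ : B * (e / (B + e)) <= _); first by rewrite ler_wpM2l // ge_min lexx orbT.
by rewrite mulrCA ler_piMr ?(ltW e0) // ler_pdivrMr // mul1r lerDl ltW.
Qed.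

Variables (d N : nat).
Local Notation T := {ffun 'I_d -> 'I_N.+1}.

Definition bdeg (t : T) : nat := (\sum_k t k)%N.

Lemma bdeg_bound (t : T) : (bdeg t < (d * N).+1)%N.
Proof.
rewrite ltnS /bdeg; apply: leq_trans (_ : \sum_(k < d) N <= _)%N.
  by apply: leq_sum => k _; rewrite -ltnS.
by rewrite sum_nat_const card_ord.
Qed.

(** Polynomials of degree at most [N] in each variable are represented by coefficient functions on
    the box; [bpart] extracts a homogeneous component. *)
Definition bval (c : T -> C) (z : 'I_d -> C) : C := \sum_t c t * \prod_k z k ^+ t k.

Definition bpart (j : nat) (c : T -> C) (t : T) : C := if bdeg t == j then c t else 0.

Lemma bval_part j c z : bval (bpart j c) z = \sum_(t | bdeg t == j) c t * \prod_k z k ^+ t k.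
Proof.
rewrite [RHS]big_mkcond; apply: eq_bigr => t _; rewrite /bpart; case: eqP => //.
by rewrite mul0r.
Qed.

Lemma bval_scale c (l : C) z :
  bval c (fun k => l * z k) = \sum_(j < (d * N).+1) bval (bpart j c) z * l ^+ j.
Proof.
have E (t : T) : \prod_k (l * z k) ^+ t k = l ^+ bdeg t * \prod_k z k ^+ t k.
  under eq_bigr do rewrite exprMn; rewrite big_split /=; congr (_ * _).
  by rewrite /bdeg prodrXr.
rewrite /bval (partition_big (fun t => Ordinal (bdeg_bound t)) predT) //=.
apply: eq_bigr => j _; rewrite -/(bval _ _) bval_part mulr_suml; apply: eq_big => [t|t /eqP tj].
  by apply/eqP/eqP => [<- //|e]; apply: val_inj.
by rewrite E -tj /= mulrCA mulrC.
Qed.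

Lemma bval_small (c : T -> C) z (K : R) m :
  (forall l : R, 0 < l <= 1 -> rabs (bval c (fun k => cr l * z k)) <= K * l ^+ m) ->
  forall j, (j < m)%N -> bval (bpart j c) z = 0.
Proof.
move=> cK j jm; have [jd|dj] := ltnP j (d * N).+1.
  apply: (small_coef (c := fun j : 'I_(d * N).+1 => bval (bpart j c) z) (K := K) _ (j := Ordinal jd) jm).
  by move=> l l01; rewrite -bval_scale; exact: cK.
rewrite bval_part big1 // => t /eqP tj; have := bdeg_bound t.
by rewrite tj ltnNge dj.
Qed.

Lemma bcoef_eq0 (x : 'I_d -> 'I_N.+1 -> C) (c : T -> C) j :
  (forall k, injective (x k)) ->
  (forall i : T, bval (bpart j c) (fun k => x k (i k)) = 0) ->
  forall t, bdeg t = j -> c t = 0.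
Proof.
move=> xi c0 t tj; have := box_poly_eq0 xi (c := bpart j c) c0 t.
by rewrite /bpart tj eqxx.
Qed.

End SmallOrder.

(** * Coefficient estimates for power series on the polydisk *)

Section PowerSeriesCoefficients.
Variables (R : realType) (d : nat).
Local Notation C := (cplx R).
Local Notation midx := {ffun 'I_d -> nat}.
Local Notation mon z t := (\prod_k z k ^+ t k).

Definition madd (s t : midx) : midx := [ffun k => (s k + t k)%N].

Lemma mon_add (z : 'I_d -> C) (s t : midx) : mon z (madd s t) = mon z s * mon z t.
Proof. by rewrite -big_split; apply: eq_bigr => k _; rewrite ffunE exprD. Qed.

Lemma bvalE N (c : {ffun 'I_d -> 'I_N.+1} -> C) z : bval c z = \sum_u c u * mon z (membed u).
Proof. by apply: eq_bigr => u _; congr (_ * _); apply: eq_bigr => k _; rewrite ffunE. Qed.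

Lemma tdeg_membed N (u : {ffun 'I_d -> 'I_N.+1}) : tdeg (membed u) = bdeg u.
Proof. by apply: eq_bigr => k _; rewrite ffunE. Qed.

Lemma membedP N (t : midx) : t \in mbox d N -> exists u : {ffun 'I_d -> 'I_N.+1}, t = membed u.
Proof. by case/imfsetP => u _ ->; exists u. Qed.

Lemma bval_push N (I : eqType) (X : seq I) (phi : I -> midx) (w : I -> C) z :
  (forall x, x \in X -> phi x \in mbox d N) ->
  bval (fun u : {ffun 'I_d -> 'I_N.+1} => \sum_(x <- X | phi x == membed u) w x) z =
  \sum_(x <- X) w x * mon z (phi x).
Proof.
move=> Xb; rewrite bvalE.
under eq_bigr do rewrite mulr_suml.
rewrite (exchange_big_dep predT) //= big_seq [RHS]big_seq; apply: eq_bigr => x /Xb /membedP [u xu].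
rewrite (big_pred1 u) ?xu // => u'; rewrite /= eq_sym.
by apply/eqP/eqP => [/membed_inj|->].
Qed.

Variables (n : nat) (F : 'rV[C]_d -> 'M[C]_n) (Fhat : midx -> 'M[C]_n).
Hypothesis ps : power_series_on_polydisk F Fhat.
Variables (i j : 'I_n).
Local Notation fh t := (Fhat t i j).

Lemma series_entry_cvg (zeta : 'rV[C]_d) (e : R) : polydisk zeta -> 0 < e ->
  exists A : {fset midx}, forall J : {fset midx}, (A `<=` J)%fset ->
    rabs (\sum_(t <- J) mon (fun k => zeta 0 k) t * fh t - F zeta i j) < e.
Proof.
move=> zd e0; have tF := @totally_filter midx.
have := ps zd => /cvg_ballP /(_ (cr e)); rewrite -cr0 ltr_cr => /(_ e0) [A _ AP].
exists A => J AJ; have /= := AP J AJ => -[_ /(_ i j)].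
rewrite -ball_normE /ball_ /= distrC -cr_rabs ltr_cr; congr (is_true (rabs (_ - _) < _)).
rewrite /partial_sum summxE -[LHS](big_seq_fsetE _ J xpredT (fun t => (mon (fun k => zeta 0 k) t *: Fhat t) i j)) /=.
by apply: eq_bigr => t _; rewrite mxE.
Qed.

Lemma mon_const (x : C) (t : midx) : mon (fun=> x) t = x ^+ tdeg t :> C.
Proof. by rewrite prodrXr. Qed.

(** Estimate at the point with all coordinates [1/2]: outside a finite set each term is the
    difference of two partial sums that are within [1] of the limit. *)
Lemma coef_bound : exists2 K : R, 0 <= K & forall t, rabs (fh t) <= K * 2 ^+ tdeg t.
Proof.
pose zeta : 'rV[C]_d := const_mx (cr 2^-1).
have zd : polydisk zeta.
  by move=> k; rewrite mxE norm_cr -cr1 ltr_cr ger0_norm ?invr_ge0 // invf_lt1 // ltr1n.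
have zE (t : midx) : mon (fun k => zeta 0 k) t = cr (2^-1 ^+ tdeg t).
  by rewrite crX -mon_const; apply: eq_bigr => k _; rewrite mxE.
have [A AP] := series_entry_cvg zd ltr01.
exists (2 + \sum_(t <- A) rabs (fh t)).
  by rewrite addr_ge0 // sumr_ge0 // => t _; exact: rabs_ge0.
move=> t; have p1 : 1 <= 2 ^+ tdeg t :> R by rewrite exprn_ege1 // ler1n.
have s0 : 0 <= \sum_(t <- A) rabs (fh t) by apply: sumr_ge0 => t' _; exact: rabs_ge0.
have [tA|tA] := boolP (t \in A).
  rewrite mulrDl; apply: ler_wpDl; first by rewrite mulr_ge0 // exprn_ge0.
  apply: le_trans (_ : \sum_(t <- A) rabs (fh t) <= _); last by rewrite ler_peMr.
  rewrite (bigD1_seq t) ?fset_uniq //= lerDl; apply: sumr_ge0 => t' _; exact: rabs_ge0.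
rewrite mulrDl; apply: ler_wpDr; first by rewrite mulr_ge0 // exprn_ge0.
have h1 := AP A (fsubset_refl A); have h2 := AP (t |` A)%fset (fsubsetU1 t A).
rewrite big_fsetU1 //= zE in h2.
rewrite -ler_pdivrMr ?exprn_gt0 // -exprVn mulrC -(ger0_norm (exprn_ge0 _ _)) ?invr_ge0 //.
rewrite -rabs_cr -rabsM.
set S := (X in rabs (X - _) < _) in h1; set f := F zeta i j in h1 h2.
rewrite (_ : cr _ * fh t = (cr (2^-1 ^+ tdeg t) * fh t + S - f) - (S - f)); last by ring.
by apply: le_trans (rabsB_le _ _) _; apply: ltW; apply: lt_le_trans (ltrD h2 h1) _; lra.
Qed.

(** For [|zeta_k| <= l / 4] a term of degree [m] is at most [K (l / 2)^m]; beyond degree [D] the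
    factor [l ^+ D.+1] comes out and a geometric series in [1/2] remains. *)
Lemma tail_bound D : exists K : R, forall (l : R) (zeta : 'rV[C]_d), 0 < l <= 1 ->
  (forall k, rabs (zeta 0 k) <= l / 4) ->
  rabs (\sum_(t <- mbox d D) mon (fun k => zeta 0 k) t * fh t - F zeta i j) <= K * l ^+ D.+1.
Proof.
have [K K0 KP] := coef_bound.
exists (K * (1 - 2^-1)^-1 ^+ d) => l zeta /andP [l0 l1] zl.
have zd : polydisk zeta.
  move=> k; rewrite -cr_rabs -cr1 ltr_cr; apply: le_lt_trans (zl k) _; lra.
apply/ler_addgt0Pr => e e0; have [A AP] := series_entry_cvg zd e0.
set J := (A `|` mbox d D)%fset; have := AP J (fsubsetUl _ _).
rewrite (bigID (fun t : midx => t \in mbox d D)) /=.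
have -> : \sum_(t <- J | t \in mbox d D) mon (fun k => zeta 0 k) t * fh t =
    \sum_(t <- mbox d D) mon (fun k => zeta 0 k) t * fh t.
  rewrite -big_filter; apply: sum_support; rewrite ?filter_uniq ?fset_uniq // => t _.
  by rewrite mem_filter in_fsetU; case: (t \in mbox d D); rewrite ?orbT.
set S := \sum_(t <- mbox d D) _; set f := F zeta i j; set T := \sum_(_ <- J | _) _ => h.
rewrite (_ : S - f = (S + T - f) - T); last by ring.
apply: le_trans (rabsB_le _ _) _; rewrite addrC; apply: lerD; last exact: ltW.
rewrite /T; apply: le_trans (rabs_sum_le _ _ _) _.
apply: (@le_trans _ _ (\sum_(t <- J) K * l ^+ D.+1 * 2^-1 ^+ tdeg t)).
  rewrite [leRHS](bigID (fun t : midx => t \notin mbox d D)) /=.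
  apply: ler_wpDr.
    by apply: sumr_ge0 => t _; rewrite !mulr_ge0 ?exprn_ge0 ?invr_ge0 // ltW.
  apply: ler_sum => t tb; rewrite rabsM rabs_prod.
  have Dt : (D < tdeg t)%N.
    move: tb; rewrite mem_mbox negb_forall => /existsP [k]; rewrite -ltnNge => h1.
    exact: leq_trans h1 (leq_tdeg t k).
  apply: (@le_trans _ _ ((l / 4) ^+ tdeg t * (K * 2 ^+ tdeg t))).
    apply: ler_pM; rewrite ?rabs_ge0 //.
      by apply: prodr_ge0 => k _; exact: rabs_ge0.
    rewrite /tdeg -prodrXr; apply: ler_prod => k _; rewrite rabs_ge0 rabsX /=.
    by rewrite lerXn2r ?nnegrE ?rabs_ge0 ?divr_ge0 // ltW.
  rewrite mulrCA -mulrA ler_wpM2l // -exprMn.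
  rewrite [l / 4 * 2](_ : _ = l * 2^-1); last by field.
  rewrite exprMn ler_wpM2r ?exprn_ge0 ?invr_ge0 //.
  by rewrite ler_wiXn2l // ltW.
rewrite -mulr_sumr -mulrA -[leRHS]mulrA ler_wpM2l //.
rewrite [leRHS]mulrC ler_wpM2l ?exprn_ge0 ?(ltW l0) // sum_geom_tdeg ?fset_uniq //.
by rewrite invr_ge0 ler0n /= invf_lt1 // ltr1n.
Qed.

Variable N : nat.
Local Notation T := {ffun 'I_d -> 'I_N.+1}.

Lemma bvalB (a b : T -> C) z : bval (fun t => a t - b t) z = bval a z - bval b z.
Proof. by rewrite /bval -sumrB; apply: eq_bigr => t _; rewrite mulrBl. Qed.

Lemma bval_sum I (s : seq I) (a : I -> T -> C) z :
  bval (fun t => \sum_(x <- s) a x t) z = \sum_(x <- s) bval (a x) z.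
Proof. by rewrite /bval exchange_big; apply: eq_bigr => t _; rewrite mulr_suml. Qed.

Lemma bval_bound (a : T -> C) z : (forall k, rabs (z k) <= 1) ->
  rabs (bval a z) <= \sum_t rabs (a t).
Proof.
move=> z1; apply: le_trans (rabs_sum_le _ _ _) _; apply: ler_sum => t _.
rewrite rabsM ler_piMr ?rabs_ge0 // rabs_prod; apply: prodr_ile1 => k _.
by rewrite rabs_ge0 rabsX exprn_ile1 ?rabs_ge0.
Qed.

End PowerSeriesCoefficients.

Section CoefficientIdentity.
Variables (R : realType) (d N : nat).
Local Notation C := (cplx R).
Local Notation midx := {ffun 'I_d -> nat}.
Local Notation T := {ffun 'I_d -> 'I_N.+1}.

(** Coefficient comparison without derivatives: at points dilated by [l], the product of [a] with a
    partial sum differs from [b] by [O(l ^+ D.+1)], so the components of degree at most [D] of this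
    polynomial vanish. *)
Lemma power_series_coef n (F : 'rV[C]_d -> 'M[C]_n) Fhat i j (a b : T -> C) :
  power_series_on_polydisk F Fhat ->
  (forall zeta, polydisk zeta ->
     bval a (fun k => zeta 0 k) * F zeta i j = bval b (fun k => zeta 0 k)) ->
  forall u : T,
  \sum_s \sum_(t <- mbox d N | madd (membed s) t == membed u) a s * Fhat t i j = b u.
Proof.
(* [d * N] bounds the degree of [u]; the extra [N] makes the box of size [D] contain that of size
   [N], and products fit in the box of size [N']. *)
move=> ps aF u; pose D := (d * N + N)%N; pose N' := (N + D)%N.
pose c (v : {ffun 'I_d -> 'I_N'.+1}) : C :=
  (\sum_s \sum_(t <- mbox d D | madd (membed s) t == membed v) a s * Fhat t i j)
  - \sum_(w <- enum T | membed w == membed v) b w.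
have cE z : bval c z = bval a z * (\sum_(t <- mbox d D) \prod_k z k ^+ t k * Fhat t i j) - bval b z.
  rewrite bvalB; congr (_ - _).
    rewrite bval_sum bvalE mulr_suml; apply: eq_bigr => s _.
    rewrite bval_push => [|t]; last first.
      rewrite !mem_mbox => /forallP tD; apply/forallP => k; rewrite !ffunE leq_add //.
      by rewrite -ltnS.
    rewrite -mulrA mulr_sumr mulr_sumr; apply: eq_bigr => t _; rewrite mon_add.
    ring.
  rewrite bval_push => [|w _]; first by rewrite big_enum bvalE.
  rewrite mem_mbox; apply/forallP => k; rewrite ffunE; apply: leq_trans (leq_addr _ _).
  by rewrite -ltnS.
have [K KP] := tail_bound ps i j D.
pose x (k : 'I_d) (m : 'I_N'.+1) : C := cr (4^-1 / m.+1%:R).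
have xinj k : injective (x k).
  move=> m m' /(@cr_inj R) /(mulfI _) e; apply/val_inj/eqP.
  by rewrite -eqSS -(eqr_nat R) -(inj_eq invr_inj) e ?invr_eq0 ?pnatr_eq0.
have x0 k m : rabs (x k m) <= 4^-1.
  rewrite rabs_cr ger0_norm ?divr_ge0 ?invr_ge0 //.
  by rewrite ler_piMr ?invr_ge0 // invf_le1 ?ltr0n // ler1n.
have c0 v : (bdeg v < D.+1)%N -> c v = 0.
  move=> vD; apply: (bcoef_eq0 xinj (j := bdeg v)) => // m.
  apply: (bval_small (K := (\sum_t rabs (a t)) * K) (m := D.+1)) => // l l01.
  have /andP [l0 l1] := l01.
  pose zeta : 'rV[C]_d := \row_k (cr l * x k (m k)).
  have zl k : rabs (zeta 0 k) <= l / 4.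
    by rewrite mxE rabsM rabs_cr gtr0_norm // ler_wpM2l // ltW.
  have zd : polydisk zeta.
    move=> k; rewrite -cr_rabs -cr1 ltr_cr; apply: le_lt_trans (zl k) _; lra.
  rewrite (_ : (fun k => cr l * x k (m k)) = (fun k => zeta 0 k)); last by apply/funext => k; rewrite mxE.
  rewrite cE -aF // -mulrBr rabsM -mulrA; apply: ler_pM; rewrite ?rabs_ge0 //; last exact: KP.
  by apply: bval_bound => k; apply: le_trans (zl k) _; lra.
have [v uv] : exists v : {ffun 'I_d -> 'I_N'.+1}, membed u = membed v.
  apply: membedP; rewrite mem_mbox; apply/forallP => k; rewrite ffunE.
  by apply: leq_trans (leq_addr _ _); rewrite -ltnS.
have := c0 v; rewrite -tdeg_membed -uv tdeg_membed => /(_ _)/eqP.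
have -> : (bdeg u < D.+1)%N by apply: leq_trans (bdeg_bound u) _; rewrite ltnS leq_addr.
move/(_ isT); rewrite subr_eq0 => /eqP; rewrite -uv.
have -> : \sum_(w <- enum T | membed w == membed u) b w = b u.
  rewrite big_enum_cond; apply: big_pred1 => w /=.
  by apply/eqP/eqP => [/membed_inj|->].
move=> <-; apply: eq_bigr => s _; rewrite -[LHS]big_filter -[RHS]big_filter.
apply: sum_support; rewrite ?filter_uniq ?fset_uniq // => t _.
rewrite !mem_filter; case: eqP => //= e.
have tN : forall k, (t k <= N)%N.
  move=> k; have := congr1 (fun f : midx => f k) e; rewrite !ffunE => e'.
  have uk : (u k <= N)%N by rewrite -ltnS.
  by apply: leq_trans uk; rewrite -e' leq_addl.
rewrite !mem_mbox; apply/forallP/forallP => _ k //.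
exact: leq_trans (tN k) (leq_addl _ _).
Qed.

End CoefficientIdentity.

(** * The positive kernel on the polydisk *)
Section ShiftMatrices.
Variables (R : realType) (d N n : nat).
Local Notation C := (cplx R).
Local Notation T := {ffun 'I_d -> 'I_N.+1}.
Local Notation r := #|{: T * 'I_n}|.
Implicit Types (t u s : T) (k : 'I_d) (i j : 'I_n).

Definition bidx t i : 'I_r := enum_rank (t, i).

Definition bidx1 (x : 'I_r) : T := (enum_val x).1.
Definition bidx2 (x : 'I_r) : 'I_n := (enum_val x).2.

Lemma bidx1K t i : bidx1 (bidx t i) = t. Proof. by rewrite /bidx1 enum_rankK. Qed.
Lemma bidx2K t i : bidx2 (bidx t i) = i. Proof. by rewrite /bidx2 enum_rankK. Qed.

Lemma bidx_inj t i u j : (bidx t i == bidx u j) = (t == u) && (i == j).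
Proof. by rewrite (inj_eq enum_rank_inj) xpair_eqE. Qed.

Lemma bidxP (x : 'I_r) : exists t i, x = bidx t i.
Proof.
by exists (@bidx1 x), (@bidx2 x); rewrite /bidx1 /bidx2 /bidx -surjective_pairing enum_valK.
Qed.

Lemma sum_bidx (F : 'I_r -> C) : \sum_x F x = \sum_t \sum_i F (bidx t i).
Proof.
rewrite pair_big /= (reindex (@enum_rank _)) /=; last exact/onW_bij/enum_rank_bij.
by apply: eq_bigr => -[t i].
Qed.

Definition tdec k t : T := [ffun l => inord (t l - (l == k))].
Definition tinc k t : T := [ffun l => inord (t l + (l == k))].

Lemma membed_tdec k t : membed (tdec k t) = mdecr k (membed t).
Proof.
apply/ffunP => l; rewrite !ffunE inordK // ltnS.
by apply: leq_trans (leq_subr _ _) _; rewrite -ltnS.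
Qed.

Lemma membed_tinc k t : (t k < N)%N -> membed (tinc k t) = mincr k (membed t).
Proof.
move=> tN; apply/ffunP => l; rewrite !ffunE inordK //.
by case: eqP => [->|_]; rewrite ?addn1 // addn0.
Qed.

Lemma mincr_membed k t u :
  (membed t == mincr k (membed u)) = (t k != ord0) && (u == tdec k t).
Proof.
apply/eqP/andP => [e|[t0 /eqP ->]].
  split.
    rewrite -val_eqE /=; have := congr1 (fun f : {ffun 'I_d -> nat} => f k) e.
    by rewrite !ffunE eqxx addn1 => ->.
  by apply/eqP/(@membed_inj d N); rewrite membed_tdec e mincrK.
by rewrite membed_tdec mdecrK // ffunE.
Qed.

Lemma membed_mincr k t u :
  (membed t == mincr k (membed u)) = (u k < N)%N && (t == tinc k u).
Proof.
apply/eqP/andP => [e|[uN /eqP ->]]; last by rewrite membed_tinc.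
have uN : (u k < N)%N.
  have := congr1 (fun f : {ffun 'I_d -> nat} => f k) e; rewrite !ffunE eqxx addn1.
  by rewrite -ltnS => <-.
by split=> //; apply/eqP/(@membed_inj d N); rewrite membed_tinc.
Qed.

(** Multiplication by [zeta_k] on coefficient vectors with values in C^n, truncated at degree [N];
    the truncation makes it nilpotent. *)
Definition shiftmx k : 'M[C]_r := \matrix_(x, y)
  ((membed (bidx1 x) == mincr k (membed (bidx1 y))) &&
   (bidx2 x == bidx2 y))%:R.

Lemma shiftmxE k t i u j : shiftmx k (bidx t i) (bidx u j) =
  ((membed t == mincr k (membed u)) && (i == j))%:R.
Proof. by rewrite mxE !bidx1K ?bidx2K. Qed.

Lemma shift_act k p (v : 'M[C]_(r, p)) t i c :
  (shiftmx k *m v) (bidx t i) c = if t k == ord0 then 0 else v (bidx (tdec k t) i) c.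
Proof.
rewrite mxE sum_bidx; case: eqP => [t0|/eqP t0].
  by rewrite big1 // => u _; rewrite big1 // => j _; rewrite shiftmxE mincr_membed t0 eqxx mul0r.
rewrite (bigD1 (tdec k t)) //= (bigD1 i) //= shiftmxE mincr_membed t0 !eqxx mul1r.
rewrite big1 ?addr0 => [|j ji]; last by rewrite shiftmxE [i == j]eq_sym (negbTE ji) andbF mul0r.
rewrite big1 ?addr0 // => u ut; rewrite big1 // => j _.
by rewrite shiftmxE mincr_membed (negbTE ut) andbF mul0r.
Qed.

Lemma shift_act_row k p (v : 'M[C]_(p, r)) t i c :
  (v *m shiftmx k) c (bidx t i) = if (t k < N)%N then v c (bidx (tinc k t) i) else 0.
Proof.
rewrite mxE sum_bidx; case: ltnP => tN; last first.
  by rewrite big1 // => u _; rewrite big1 // => j _; rewrite shiftmxE membed_mincr ltnNge tN mulr0.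
rewrite (bigD1 (tinc k t)) //= (bigD1 i) //= shiftmxE membed_mincr tN !eqxx mulr1.
rewrite big1 ?addr0 => [|j ji]; last by rewrite shiftmxE (negbTE ji) andbF mulr0.
rewrite big1 ?addr0 // => u ut; rewrite big1 // => j _.
by rewrite shiftmxE membed_mincr (negbTE ut) andbF mulr0.
Qed.

Lemma shift_comm k l : shiftmx k *m shiftmx l = shiftmx l *m shiftmx k.
Proof.
have H a b t i u j : (shiftmx a *m shiftmx b) (bidx t i) (bidx u j) =
   ((membed t == mincr a (mincr b (membed u))) && (i == j))%:R.
  rewrite shift_act; case: eqP => t0.
    rewrite [_ == _](_ : _ = false) //; apply/eqP => e.
    have := congr1 (fun f : {ffun 'I_d -> nat} => f a) e.
    by rewrite !ffunE eqxx addn1 t0.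
  rewrite shiftmxE membed_tdec; congr (nat_of_bool (_ && _))%:R.
  have ta : membed t a != 0%N by rewrite ffunE; apply/eqP => h; apply: t0; exact: val_inj.
  by apply/eqP/eqP => [<-|->]; rewrite ?mdecrK // mincrK.
apply/matrixP => x y; have [t [i ->]] := bidxP x; have [u [j ->]] := bidxP y.
rewrite !H; congr (nat_of_bool ((_ == _) && _))%:R.
by apply/ffunP => m; rewrite !ffunE addnAC.
Qed.

Lemma shift_nilpotent k (v : 'cV[C]_r) : iter N.+1 (mulmx (shiftmx k)) v = 0.
Proof.
suff H m t i : (t k < m)%N -> iter m (mulmx (shiftmx k)) v (bidx t i) 0 = 0.
  apply/matrixP => x y; rewrite (ord1 y); have [t [i ->]] := bidxP x.
  by rewrite H // mxE.
elim: m t => // m IH t tm; rewrite iterS shift_act; case: eqP => // t0; apply: IH.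
have := congr1 (fun f : {ffun 'I_d -> nat} => f k) (membed_tdec k t); rewrite !ffunE eqxx => ->.
by rewrite subn1 prednK // lt0n; apply/eqP => h; apply: t0; exact: val_inj.
Qed.

(** The weight drops by exactly one at each shift and is still at least one at top degree, where the
    shift gives zero; hence [W - S^* W S >= 1]. *)
Definition wcoef t : nat := (\sum_k (N.+1 - t k))%N.
Definition weightmx : 'M[C]_r := diag_mx (\row_x (wcoef (bidx1 x))%:R).

Lemma weightmx_herm : adjmx weightmx = weightmx.
Proof.
apply/matrixP => x y; rewrite adjmxE !mxE eq_sym.
by case: eqP => [->|_]; rewrite ?mulr1n ?mulr0n ?conjC0 // conjC_nat.
Qed.

Lemma psd_diag (w : 'I_r -> C) : (forall x, 0 <= w x) -> psdmx (diag_mx (\row_x w x)).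
Proof.
move=> w0; split.
  rewrite adjmx_hermsym; apply/eqP/matrixP => x y; rewrite adjmxE !mxE eq_sym.
  by case: eqP => [->|_]; rewrite ?mulr1n ?mulr0n ?conjC0 // conj_Creal // ger0_real.
move=> v; rewrite -mulmxA mxE sumr_ge0 // => x _.
by rewrite mul_diag_mx adjmxE !mxE mulrCA mulr_ge0 // mulrC -normCK exprn_ge0.
Qed.

Lemma shift_gram k (w : T -> C) :
  adjmx (shiftmx k) *m diag_mx (\row_x w (bidx1 x)) *m shiftmx k =
  diag_mx (\row_x (if (bidx1 x k < N)%N then w (tinc k (bidx1 x)) else 0)).
Proof.
apply/matrixP => x y; have [t [i ->]] := bidxP x; have [u [j ->]] := bidxP y.
rewrite shift_act_row [RHS]mxE [X in _ = X *+ _]mxE bidx1K bidx_inj.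
have -> : (adjmx (shiftmx k) *m diag_mx (\row_x w (bidx1 x))) (bidx t i) (bidx (tinc k u) j) =
    ((t k < N)%N && (tinc k u == tinc k t) && (j == i))%:R * w (tinc k u).
  by rewrite mul_mx_diag mxE adjmxE shiftmxE membed_mincr conjC_nat mxE bidx1K.
have [tu|tu] := eqVneq t u.
  rewrite tu eqxx eq_sym; case: (ltnP (u k)) => uN /=; last by rewrite mul0rn.
  by case: (i == j); rewrite ?mul1r ?mulr1n // mul0r mulr0n.
rewrite mulr0n; case: (ltnP (u k)) => uN //; case: (ltnP (t k)) => tN /=; last by rewrite mul0r.
rewrite [_ == tinc k t](_ : _ = false) ?mul0r //; apply/eqP => e.
case/eqP: tu; apply/(@membed_inj d N); rewrite -(mincrK k (membed t)) -membed_tinc // -e.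
by rewrite membed_tinc // mincrK.
Qed.

Lemma weightmx_coercive k :
  psdmx (weightmx - adjmx (shiftmx k) *m weightmx *m shiftmx k - 1%:M).
Proof.
rewrite /weightmx (shift_gram k (fun t => (wcoef t)%:R)).
have -> : diag_mx (\row_x (wcoef (bidx1 x))%:R) -
    diag_mx (\row_x (if (bidx1 x k < N)%N then (wcoef (tinc k (bidx1 x)))%:R else 0)) - 1%:M
    = diag_mx (\row_x (if (bidx1 x k < N)%N then 0 else (wcoef (bidx1 x)).-1%:R)) :> 'M[C]_r.
  apply/matrixP => x y; rewrite !mxE; case: eqP => [->|_]; last by rewrite !mulr0n !subr0.
  rewrite !mulr1n; set t := bidx1 y.
  have w1 : (0 < wcoef t)%N.
    by rewrite /wcoef (bigD1 k) //= ltn_addr // subn_gt0.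
  case: ltnP => tN; last by rewrite subr0 -(prednK w1) /= -natr1 addrK.
  have -> : wcoef t = (wcoef (tinc k t)).+1.
    have tl l : tinc k t l = (t l + (l == k))%N :> nat.
      by have := congr1 (fun f : {ffun 'I_d -> nat} => f l) (membed_tinc tN); rewrite !ffunE.
    rewrite /wcoef (bigD1 k) //= [in RHS](bigD1 k) //= tl eqxx addn1 subSS -addSn -subSn 1?ltnW //.
    by congr (_ + _)%N; apply: eq_bigr => l /negbTE lk; rewrite tl lk addn0.
  by rewrite -natr1 addrAC addrK subrr.
by apply: psd_diag => x; case: ifP.
Qed.

Local Notation Mop := (fun k => mulmx (shiftmx k) : {linear 'cV[C]_r -> 'cV[C]_r}).

Lemma opmon_shift (m : {ffun 'I_d -> nat}) (v : 'cV[C]_r) u i :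
  opmon Mop m v (bidx u i) 0 = \sum_(s | madd (membed s) m == membed u) v (bidx s i) 0.
Proof.
have cM a b (y : 'cV[C]_r) : Mop a (Mop b y) = Mop b (Mop a y) by rewrite /= !mulmxA shift_comm.
have [D] := ubnP (tdeg m); elim: D m u => // D IH m u mD.
have [m0|] := eqVneq (tdeg m) 0%N.
  rewrite (tdeg_eq0 m0) opmon0 (big_pred1 u) // => s.
  have -> : madd (membed s) (midx0 d) = membed s by apply/ffunP => k; rewrite !ffunE addn0.
  by apply/eqP/eqP => [/membed_inj|->].
rewrite /tdeg sum_nat_eq0 negb_forall => /existsP [k mk].
have [m' mE] : exists m', m = mincr k m' by exists (mdecr k m); rewrite mdecrK.
rewrite mE (opmon_mincr cM) /= shift_act.
have mad s : madd (membed s) (mincr k m') = mincr k (madd (membed s) m').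
  by apply/ffunP => l; rewrite !ffunE addnA.
case: eqP => u0.
  rewrite big_pred0 // => s; apply/eqP => e.
  have := congr1 (fun f : {ffun 'I_d -> nat} => f k) e.
  by rewrite mad !ffunE eqxx addn1 u0.
rewrite IH; last by move: mD; rewrite mE tdeg_mincr.
apply: eq_bigl => s; rewrite mad membed_tdec.
have uk : membed u k != 0%N by rewrite ffunE; apply/eqP => h; apply: u0; exact: val_inj.
by apply/eqP/eqP => [->|<-]; rewrite ?mdecrK // mincrK.
Qed.

Variables (a : T -> C) (B : T -> 'M[C]_n).

(** Coefficients of the scalar denominator times the identity. In [bmx] the indices of the numerator
    are exchanged: column [i] of [bmx] collects row [i] of [B]. *)
Definition amx : 'M[C]_(r, n) := \matrix_(x, i) ((bidx2 x == i)%:R * a (bidx1 x)).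
Definition bmx : 'M[C]_(r, n) := \matrix_(x, i) B (bidx1 x) i (bidx2 x).

Lemma amxE t i j : amx (bidx t i) j = (i == j)%:R * a t.
Proof. by rewrite mxE bidx1K bidx2K. Qed.
Lemma bmxE t i j : bmx (bidx t i) j = B t j i.
Proof. by rewrite mxE bidx1K bidx2K. Qed.

Lemma shift_series_identity (F : 'rV[C]_d -> 'M[C]_n) Fhat i :
  power_series_on_polydisk F Fhat ->
  (forall zeta, polydisk zeta -> forall i j,
     bval a (fun k => zeta 0 k) * F zeta i j = bval (fun t => B t i j) (fun k => zeta 0 k)) ->
  \sum_(t <- mbox d N) \sum_j Fhat t i j *: opmon Mop t (col j amx) = col i bmx.
Proof.
move=> ps aF; apply/matrixP => x y; rewrite (ord1 y); have [u [i0 ->]] := bidxP x.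
rewrite [RHS]mxE bmxE -(power_series_coef ps (fun zeta zd => aF zeta zd i i0) u).
rewrite [RHS](exchange_big_dep predT) //= summxE; apply: eq_bigr => t _.
rewrite summxE (bigD1 i0) //= big1 ?addr0 => [|j ji0].
  rewrite mxE opmon_shift mulr_sumr; apply: eq_bigr => s _.
  by rewrite mxE amxE eqxx mul1r mulrC.
rewrite mxE opmon_shift big1 ?mulr0 // => s _.
by rewrite mxE amxE eq_sym (negbTE ji0) mul0r.
Qed.

Lemma kernel_alternative (g : 'rV[C]_d -> 'M[C]_n) : (0 < d)%N -> herglotz_agler g ->
  (forall zeta, polydisk zeta -> forall i j,
     bval a (fun k => zeta 0 k) * g (cayley_point zeta) i j =
     bval (fun t => B t i j) (fun k => zeta 0 k)) ->
  exists K : 'I_d -> 'M[C]_r, (forall k, psdmx (K k)) /\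
    bmx *m adjmx amx + amx *m adjmx bmx =
    \sum_k (K k - shiftmx k *m K k *m adjmx (shiftmx k)).
Proof.
move=> d0 HA aF.
case: (positive_certificate weightmx_coercive weightmx_herm amx bmx) => // -[Q [e [e0 hQ Qpos]]].
have [G Gu QE] := certificate_factor d0 shift_nilpotent e0 Qpos hQ.
rewrite QE in Qpos * => neg; exfalso; move: neg; rewrite le_gtF //.
apply: (certificate_nonneg shift_comm shift_nilpotent Gu e0 Qpos HA) => Fhat ps i.
exact: shift_series_identity ps aF.
Qed.

End ShiftMatrices.

(** * Vanishing top coefficients and the kernel identity *)

Section PolydiskKernel.
Variables (R : realType) (d N n : nat).
Local Notation C := (cplx R).
Local Notation T := {ffun 'I_d -> 'I_N.+1}.
Local Notation r := #|{: T * 'I_n}|.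
Local Notation S := (@shiftmx R d N n).
Variables (a : T -> C) (B : T -> 'M[C]_n).
Local Notation al := (@amx R d N n a).
Local Notation be := (bmx B).
Local Notation bP := (fun (z : 'I_d -> C) i j => bval (fun t => B t i j) z).

Lemma monE_tinc (k : 'I_d) (t : T) (z : 'I_d -> C) : (t k < N)%N ->
  \prod_l z l ^+ tinc k t l = z k * \prod_l z l ^+ t l.
Proof.
move=> tN; have tl l : tinc k t l = (t l + (l == k))%N :> nat.
  by have := congr1 (fun f : {ffun 'I_d -> nat} => f l) (membed_tinc tN); rewrite !ffunE.
rewrite (bigD1 k) //= [in RHS](bigD1 k) //= tl eqxx addn1 exprS mulrA; congr (_ * _).
by apply: eq_bigr => l /negbTE lk; rewrite tl lk addn0.
Qed.

(** [S_k^* S_k] is the projection onto the indices with [t k < N], so only the top layer [t k = N]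
    survives in the trace. *)
Lemma tr_step (k : 'I_d) (K : 'M[C]_r) :
  \tr (K - S k *m K *m adjmx (S k)) = \sum_(t : T | ~~ (t k < N)%N) \sum_i K (bidx t i) (bidx t i).
Proof.
have -> : \tr (K - S k *m K *m adjmx (S k)) =
    \tr (K *m (1%:M - adjmx (S k) *m diag_mx (\row_x (fun=> 1) (bidx1 x)) *m S k)).
  rewrite linearB mulmxBr linearB /= mulmx1 (_ : diag_mx _ = 1%:M); last first.
    by apply/matrixP => x y; rewrite !mxE.
  by congr (_ - _); rewrite mulmx1 [LHS]mxtrace_mulC [RHS]mxtrace_mulC mulmxA.
rewrite (@shift_gram R d N n k (fun=> 1)) mulmxBr mulmx1 linearB /= {1}/mxtrace sum_bidx.
rewrite (bigID (fun t : T => (t k < N)%N)) /= [\tr _]sum_bidx.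
rewrite [X in _ - X](bigID (fun t : T => (t k < N)%N)) /=.
rewrite [X in _ - (_ + X)]big1 => [|t tN]; last first.
  by rewrite big1 // => i _; rewrite mul_mx_diag mxE mxE bidx1K (negbTE tN) mulr0.
rewrite addr0 addrAC (eq_bigr (fun t : T => \sum_i K (bidx t i) (bidx t i))) => [|t tN //].
rewrite [X in _ - X](eq_bigr (fun t : T => \sum_i K (bidx t i) (bidx t i))) => [|t tN]; last first.
  by apply: eq_bigr => i _; rewrite mul_mx_diag mxE mxE bidx1K tN mulr1.
by rewrite subrr add0r.
Qed.

Lemma kernel_support (K : 'I_d -> 'M[C]_r) :
  (forall k, psdmx (K k)) -> \sum_k \tr (K k - S k *m K k *m adjmx (S k)) = 0 ->
  forall k (t : T) i, ~~ (t k < N)%N -> K k (bidx t i) (bidx t i) = 0.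
Proof.
move=> pK /eqP; have diag0 k x : 0 <= K k x x.
  have [_ /(_ (delta_mx x 0))] := pK k; rewrite adjmx_delta -rowE -colE !mxE //.
under eq_bigr do rewrite tr_step.
rewrite psumr_eq0 => [/allP H k t i tk|k _]; last first.
  by apply: sumr_ge0 => t _; apply: sumr_ge0.
have := H k (mem_index_enum _); rewrite psumr_eq0 => [/allP /(_ t (mem_index_enum _))|t' _]; last exact: sumr_ge0.
rewrite tk /= psumr_eq0 => [/allP /(_ i (mem_index_enum _)) /eqP //|i' _]; exact: diag0.
Qed.

Lemma polydisk_kernel (g : 'rV[C]_d -> 'M[C]_n) : (0 < d)%N -> herglotz_agler g ->
  (forall zeta, polydisk zeta -> forall i j,
     bval a (fun k => zeta 0 k) * g (cayley_point zeta) i j = bP (fun k => zeta 0 k) i j) ->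
  \sum_t \sum_i (B t i i * (a t)^* + a t * (B t i i)^*) = 0 ->
  exists c : 'I_d -> 'I_r -> 'I_n -> T -> C, forall z w i j,
    bP z i j * (bval a w)^* + bval a z * (bP w j i)^* =
    \sum_k (1 - z k * (w k)^*) * \sum_l (bval (c k l i) w)^* * bval (c k l j) z.
Proof.
move=> d0 HA aF tr0; have [K [pK HK]] := kernel_alternative d0 HA aF.
have supp : forall k (t : T) i, ~~ (t k < N)%N -> K k (bidx t i) (bidx t i) = 0.
  apply: (kernel_support pK); rewrite -linear_sum /= -HK linearD /= -tr0 /mxtrace !sum_bidx -big_split /=.
  apply: eq_bigr => t _; rewrite -big_split; apply: eq_bigr => i _.
  rewrite ![(_ *m _) _ _]mxE (bigD1 i) //= big1 => [|j ji]; last first.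
    by rewrite adjmxE amxE eq_sym (negbTE ji) mul0r conjC0 mulr0.
  rewrite addr0 [X in _ + X = _](bigD1 i) //= big1 => [|j ji]; last first.
    by rewrite amxE eq_sym (negbTE ji) mul0r mul0r.
  by rewrite !adjmxE !amxE !bmxE eqxx !mul1r addr0.
have /boolp.choice [G GE] : forall k, exists G : 'M[C]_r, K k = adjmx G *m G.
  by move=> k; have [G] := psdmx_gramP (pK k); exists G.
have G0 k l (t : T) i : ~~ (t k < N)%N -> G k l (bidx t i) = 0.
  move=> /(supp k t i); rewrite GE mxE => /eqP; rewrite psumr_eq0 => [/allP /(_ l (mem_index_enum _))|x _].
    by rewrite adjmxE mulrC -normCK /= expf_eq0 normr_eq0 /= => /eqP.
  by rewrite adjmxE mulrC -normCK exprn_ge0.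
exists (fun k l j t => (G k l (bidx t j))^*) => z w i j.
(* [E y] evaluates a coefficient vector at [y]. Evaluation turns the shift into multiplication by
   [y k] except on the top layer, and there the columns of [G k] vanish by [G0]. *)
pose E (y : 'I_d -> C) : 'M[C]_(n, r) := \matrix_(m, x) ((bidx2 x == m)%:R * \prod_l y l ^+ bidx1 x l).
have EE p (v : 'M[C]_(r, p)) y m q : (E y *m v) m q = \sum_(t : T) (\prod_l y l ^+ t l) * v (bidx t m) q.
  rewrite mxE sum_bidx; apply: eq_bigr => t _; rewrite (bigD1 m) //= big1 => [|m' /negbTE m'm].
    by rewrite mxE bidx1K bidx2K eqxx mul1r addr0.
  by rewrite mxE bidx2K m'm !mul0r.
have Ea y m q : (E y *m al) m q = (m == q)%:R * bval a y.
  by rewrite EE mulr_sumr; apply: eq_bigr => t _; rewrite amxE mulrCA [_ * a t]mulrC.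
have Eb y m q : (E y *m be) m q = bP y q m.
  by rewrite EE; apply: eq_bigr => t _; rewrite bmxE mulrC.
have EG k y m l : (E y *m adjmx (G k)) m l = bval (fun t => (G k l (bidx t m))^*) y.
  by rewrite EE; apply: eq_bigr => t _; rewrite adjmxE mulrC.
have ESG k y : E y *m S k *m adjmx (G k) = y k *: (E y *m adjmx (G k)).
  apply/matrixP => m l; rewrite [RHS]mxE EG [LHS]mxE sum_bidx /bval mulr_sumr; apply: eq_bigr => t _.
  rewrite (bigD1 m) //= big1 => [|m' m'm].
    rewrite addr0 shift_act_row adjmxE; case: ifP => tN; last by rewrite G0 ?tN // conjC0 !(mulr0, mul0r).
    by rewrite mxE bidx1K bidx2K eqxx mul1r monE_tinc // [RHS]mulrCA [_^* * _]mulrC.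
  rewrite shift_act_row; case: ifP => tN; last by rewrite mul0r.
  by rewrite mxE bidx2K (negbTE m'm) !mul0r.
have := congr1 (fun M => (E z *m M *m adjmx (E w)) j i) HK.
rewrite mulmxDr mulmxDl !mulmxA -2!(mulmxA _ _ (adjmx (E w))) -!adjmxM mxE.
rewrite [X in X + _]mxE (bigD1 i) //= big1 => [|q qi]; last first.
  by rewrite adjmxE Ea eq_sym (negbTE qi) mul0r conjC0 mulr0.
rewrite [X in _ + X = _]mxE (bigD1 j) //= big1 => [|q qi]; last first.
  by rewrite Ea eq_sym (negbTE qi) mul0r mul0r.
rewrite !addr0 !adjmxE !Ea !Eb !eqxx !mul1r => ->.
rewrite mulmx_sumr mulmx_suml summxE; apply: eq_bigr => k _.
have -> : E z *m (K k - S k *m K k *m adjmx (S k)) *m adjmx (E w) =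
    (1 - z k * (w k)^*) *: ((E z *m adjmx (G k)) *m adjmx (E w *m adjmx (G k))).
  rewrite mulmxBr mulmxBl scalerBl scale1r; congr (_ - _).
    by rewrite GE !adjmxM adjmxK !mulmxA.
  have -> : E z *m (S k *m K k *m adjmx (S k)) *m adjmx (E w) =
      (E z *m S k *m adjmx (G k)) *m adjmx (E w *m S k *m adjmx (G k)).
    by rewrite GE !adjmxM adjmxK !mulmxA.
  by rewrite !ESG adjmxZ -scalemxAl -scalemxAr scalerA.
rewrite mxE; congr (_ * _); rewrite mxE; apply: eq_bigr => l _.
by rewrite adjmxE !EG mulrC.
Qed.

End PolydiskKernel.

(** * The positive kernel on the polyhalfplane *)
Section BoundaryValues.
Variables (R : realType) (d n : nat).
Local Notation C := (cplx R).
Local Notation ev z := (fun k => z 0 k : C).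
Variables (p : mpoly d C) (P : 'M[mpoly d C]_n) (g : 'rV[C]_d -> 'M[C]_n).
Hypothesis pgP : forall z, polyhalfplane z -> forall i j,
  meval (ev z) p * g z i j = meval (ev z) (P i j).

Lemma continuous_meval (q : mpoly d C) : continuous (fun z : 'rV[C]_d => meval (ev z) q : C).
Proof. by move=> z; apply: differentiable_continuous; exact: differentiable_meval. Qed.

Lemma imag_point_shift (t : 'rV[R]_d) (e : R) : 0 < e ->
  stolz 2 t (imag_point t + const_mx (cr e)).
Proof.
move=> e0; split=> k; rewrite !mxE /=; first by rewrite add0r.
rewrite addrAC subrr add0r norm_cr gtr0_norm // -[(_%:C)%C]/(cr _) ler_cr add0r.
by rewrite ler_peMl ?(ltW e0) // ler1n.
Qed.

Lemma stolz_proper (t : 'rV[R]_d) : ProperFilter (within (stolz 2 t) (nbhs (imag_point t))).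
Proof.
apply: within_nbhs_proper => B /nbhs_ballP [e e0 eB].
have e1 : 0 < complex.Re e / 2 by rewrite divr_gt0 // -(ltr_cr 0) cr0 cr_Re // ltW.
exists (imag_point t + const_mx (cr (complex.Re e / 2))); split; first exact: imag_point_shift.
apply: eB; split => // i j; rewrite -ball_normE /ball_ /= [X in _ - X]mxE [const_mx _ i j]mxE opprD addrA subrr add0r normrN.
rewrite norm_cr gtr0_norm // -[ltRHS](cr_Re (ltW e0)) ltr_cr; lra.
Qed.

(** The identity [p g = P] passes to the limit inside a Stolz region. *)
Lemma boundary_value (t : 'rV[R]_d) (L : 'M[C]_n) i j : nontangential_limit g t L ->
  meval (ev (imag_point t)) p * L i j = meval (ev (imag_point t)) (P i j).
Proof.
move=> /(_ 2); rewrite ltr1n => /(_ isT) gL; have pF := stolz_proper t.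
set F := within _ _ in gL pF.
have gij : (fun z => g z i j) @ F --> L i j.
  have := @cvg_comp _ _ _ g (fun M : 'M[C]_n => M i j) F (nbhs L) (nbhs (L i j)) gL; apply.
  exact: coord_continuous.
have pc (q : mpoly d C) : (fun z : 'rV[C]_d => meval (ev z) q : C) @ F --> (meval (ev (imag_point t)) q : C).
  by apply: cvg_within_filter; exact: continuous_meval.
apply: (cvg_unique _ _ (pc (P i j))); first exact: norm_hausdorff.
apply: cvg_trans (cvgM (pc p) gij); apply: near_eq_cvg.
by rewrite /F near_withinE; apply: nearW => z [zp _]; exact: pgP.
Qed.

Hypothesis inner : cayley_inner g.

Definition bform i (z : 'rV[C]_d) : C :=
  meval (ev z) (P i i) * (meval (ev z) p)^* + meval (ev z) p * (meval (ev z) (P i i))^*.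

(** The form vanishes almost everywhere by the inner condition, hence everywhere by continuity,
    because the complement of a null set is dense. *)
Lemma boundary_form (t : 'rV[R]_d) i : bform i (imag_point t) = 0.
Proof.
have [_ _ nE] := inner.
have conjc : continuous (fun x : C => x^* : C).
  move=> x A /nbhs_ballP [e e0 eA]; apply/nbhs_ballP; exists e => // y.
  by rewrite -ball_normE /ball_ /= => xy; apply: eA; rewrite -ball_normE /ball_ /= -rmorphB norm_conjC.
have mc (h : 'rV[C]_d -> C) : continuous h -> continuous (fun z => (h z)^*).
  by move=> hc z; apply: (@continuous_comp _ _ _ h (fun x => x^*)); [exact: hc|exact: conjc].
have bc : continuous (bform i).
  pose u (z : 'rV[C]_d) : C := meval (ev z) (P i i); pose v (z : 'rV[C]_d) : C := meval (ev z) p.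
  have cu : continuous u by exact: continuous_meval.
  have cv : continuous v by exact: continuous_meval.
  move=> z; apply: (@continuousD C C^o _ (fun z => u z * (v z)^*) (fun z => v z * (u z)^*)).
    by apply: (@continuousM C _ u (fun z => (v z)^*)); [exact: cu|exact: mc].
  by apply: (@continuousM C _ v (fun z => (u z)^*)); [exact: cv|exact: mc].
apply/eqP; apply: contrapT => /negP b0.
have := bc (imag_point t); move/cvgrPdist_lt/(_ `|bform i (imag_point t)|); rewrite normr_gt0 => /(_ b0).
move=> /nbhs_ballP [e e0 eB].
have e1 : 0 < complex.Re e / 2 by rewrite divr_gt0 // -(ltr_cr 0) cr0 cr_Re // ltW.
have [s nEs st] := null_set_dense t e1 nE.
have s0 : bform i (imag_point s) = 0.
  have [L Llim LL] : exists2 L, nontangential_limit g s L & L + adjmx L = 0.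
    by apply: contrapT.
  rewrite /bform -(boundary_value i i Llim) rmorphM /=.
  have := congr1 (fun M : 'M[C]_n => M i i) LL; rewrite !mxE => e2.
  have key (u v : C) : v + v^* = 0 -> u * v * u^* + u * (u^* * v^*) = 0.
    by move=> vv; rewrite -[RHS](mulr0 (u * u^*)) -vv; ring.
  exact: key.
have := eB (imag_point s); rewrite /= s0 subr0 ltxx => H.
suff : false by []; apply: H; split => // a b.
rewrite -ball_normE /ball_ /= !mxE.
have -> : ((0 +i* t 0 b) - (0 +i* s 0 b))%C = (0 +i* (t 0 b - s 0 b))%C :> C.
  by apply/eqP; rewrite eq_complex /= subrr !eqxx.
have -> : (0 +i* (t 0 b - s 0 b))%C = (0 +i* 1)%C * cr (t 0 b - s 0 b) :> C.
  by apply/eqP; rewrite eq_complex /=; apply/andP; split; apply/eqP; ring.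
rewrite normrM norm_cr (_ : `|(0 +i* 1)%C| = 1 :> C) ?mul1r; last first.
  by rewrite normc_def /= expr0n expr1n add0r sqrtr1.
have := st b => /andP [h1 h2]; rewrite -[ltRHS](cr_Re (ltW e0)) ltr_cr ltr_norml; apply/andP; split; lra.
Qed.

End BoundaryValues.

(** * Cayley substitution in coefficient form *)

Section BoxSubstitution.
Variables (R : realType) (d N : nat).
Local Notation C := (cplx R).
Local Notation T := {ffun 'I_d -> 'I_N.+1}.

Lemma box_subst M (a : T -> C) (u : 'I_d -> nat -> {poly C}) :
  (forall k j, (j <= N)%N -> (size (u k j) <= M.+1)%N) ->
  exists a' : {ffun 'I_d -> 'I_M.+1} -> C,
    forall z, bval a' z = \sum_t a t * \prod_k (u k (t k)).[z k].
Proof.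
move=> us; exists (fun s : {ffun 'I_d -> 'I_M.+1} => \sum_t a t * \prod_k (u k (t k))`_(s k)) => z.
rewrite /bval; under eq_bigr do rewrite mulr_suml.
rewrite exchange_big /=; apply: eq_bigr => t _.
under eq_bigr do rewrite -mulrA; rewrite -mulr_sumr; congr (_ * _).
transitivity (\prod_k \sum_(j < M.+1) (u k (t k))`_j * z k ^+ j); last first.
  by apply: eq_bigr => k _; apply/esym/horner_coef_wide/us; rewrite -ltnS.
rewrite bigA_distr_bigA.
by apply: eq_bigr => s _; rewrite big_split.
Qed.

(** Substituting [(x + c) / (e x + 1)] into a power of degree [j] and multiplying by
    [(e x + 1)^(j + m)] leaves this polynomial. *)
Definition linpow (c e : C) (j m : nat) : {poly C} := ('X + c%:P) ^+ j * (e *: 'X + 1) ^+ m.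

Lemma size_linpow c e j m : (size (linpow c e j m) <= (j + m).+1)%N.
Proof.
have h (x y : C) l : (size ((x *: 'X + y%:P) ^+ l) <= l.+1)%N.
  have s2 : (size (x *: 'X + y%:P)%R <= 2)%N.
    apply: leq_trans (size_polyD _ _) _; rewrite geq_max (leq_trans (size_scale_leq _ _)) ?size_polyX //.
    by rewrite (leq_trans (size_polyC_leq1 _)).
  apply: leq_trans (size_poly_exp_leq _ _) _; rewrite ltnS -[leqRHS]mul1n leq_mul2r.
  by apply/orP; right; move: s2; case: (size _) => [|[|]].
apply: leq_trans (size_mul_leq _ _) _; have := h 1 c j; have := h e 1 m.
rewrite scale1r polyC1 /linpow.
move: (size _) (size _) => x y; lia.
Qed.

Lemma linpowE c e j m x : (linpow c e j m).[x] = (x + c) ^+ j * (e * x + 1) ^+ m.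
Proof. by rewrite /linpow !hornerE. Qed.

Lemma cayley_box (a : T -> C) : exists a' : T -> C, forall z,
  (forall k, 1 - z k != 0) ->
  bval a' z = (\prod_k (1 - z k) ^+ N) * bval a (fun k => (1 + z k) / (1 - z k)).
Proof.
have [|a' aE] := box_subst (M := N) a (u := fun _ j => linpow 1 (-1) j (N - j)).
  by move=> _ j jN; apply: leq_trans (size_linpow _ _ _ _) _; rewrite subnKC.
exists a' => z z1; rewrite aE mulr_sumr; apply: eq_bigr => t _.
rewrite [RHS]mulrCA -big_split; congr (_ * _); apply: eq_bigr => k _ /=.
have tk : (t k <= N)%N by rewrite -ltnS.
rewrite linpowE expr_div_n mulN1r [- _ + 1]addrC [z k + 1]addrC.
have -> : (1 - z k) ^+ N = (1 - z k) ^+ (N - t k) * (1 - z k) ^+ t k by rewrite -exprD subnK.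
have := expf_neq0 (t k) (z1 k); move: ((1 - z k) ^+ t k) ((1 - z k) ^+ (N - t k)) => x y x0.
by field.
Qed.

(** The clearing factor has one power less of [z k0 + 1] than of the other variables: by
    [cayley_step] the missing one is consumed by the kernel factor [1 - zeta_k0 conj(omega_k0)]. *)
Lemma cayley_box_inv (c : T -> C) (k0 : 'I_d) : exists c' : {ffun 'I_d -> 'I_N.+2} -> C, forall z,
  (forall k, z k + 1 != 0) ->
  bval c' z = (\prod_k (z k + 1) ^+ N * \prod_(k | k != k0) (z k + 1)) *
    bval c (fun k => (z k - 1) / (z k + 1)).
Proof.
have [|c' cE] := box_subst (M := N.+1) c (u := fun k j => linpow (-1) 1 j (N - j + (k != k0))).
  move=> k j jN; apply: leq_trans (size_linpow _ _ _ _) _.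
  by rewrite addnA subnKC // ltnS; case: (k != k0); rewrite ?addn1 // addn0.
exists c' => z z1; rewrite cE mulr_sumr; apply: eq_bigr => t _.
rewrite [\prod_(k | k != k0) _]big_mkcond -big_split [RHS]mulrCA -big_split; congr (_ * _).
apply: eq_bigr => k _ /=; have tk : (t k <= N)%N by rewrite -ltnS.
rewrite linpowE mul1r exprD expr_div_n.
have -> : (z k + 1) ^+ N = (z k + 1) ^+ (N - t k) * (z k + 1) ^+ t k by rewrite -exprD subnK.
have -> : (if k != k0 then z k + 1 else 1) = (z k + 1) ^+ (k != k0) by case: (k != k0).
have := expf_neq0 (t k) (z1 k); move: ((z k - 1) ^+ t k) ((z k + 1) ^+ t k) ((z k + 1) ^+ (N - t k)) ((z k + 1) ^+ (k != k0)) => x y v w y0.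
by field.
Qed.

(* Parseval on the torus, sampled at finitely many points: omega^s conj(omega^t)
   omega^N is a monomial of degree at most 2N in each variable. *)
Lemma torus_diagonal (a b : T -> C) :
  (forall tau : 'I_d -> R, let w := fun k => ((0 +i* tau k)%C - 1) / ((0 +i* tau k)%C + 1) in
     bval b w * (bval a w)^* + bval a w * (bval b w)^* = 0) ->
  \sum_t (b t * (a t)^* + a t * (b t)^*) = 0.
Proof.
move=> H; pose h (st : T * T) := b st.2 * (a st.1)^* + a st.2 * (b st.1)^*.
pose phi (st : T * T) : {ffun 'I_d -> nat} := [ffun k => (st.2 k + (N - st.1 k))%N].
pose c (u : {ffun 'I_d -> 'I_(N + N).+1}) := \sum_(st <- index_enum (T * T)%type | phi st == membed u) h st.
(* Sample points on the circle: the Cayley images of distinct imaginary integers. *)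
pose x (k : 'I_d) (j : 'I_(N + N).+1) : C := ((0 +i* j%:R)%C - 1) / ((0 +i* j%:R)%C + 1).
have i1 (y : R) : (0 +i* y)%C + 1 != 0 :> C.
  by rewrite eq_complex /= add0r oner_eq0.
have xinj k : injective (x k).
  move=> j l; rewrite /x => /eqP; rewrite eqr_div // => /eqP e.
  have e2 : (0 +i* j%:R)%C = (0 +i* l%:R)%C :> C.
    apply: (@mulfI _ 2%:R); first by rewrite pnatr_eq0.
    move: e; move: ((0 +i* j%:R)%C : C) ((0 +i* l%:R)%C : C) => u v e.
    apply/eqP; rewrite -subr_eq0 (_ : 2 * u - 2 * v = (u - 1) * (v + 1) - (v - 1) * (u + 1)); last by ring.
    by rewrite e subrr.
  by move: e2 => [] /eqP; rewrite eqr_nat => /eqP /val_inj.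
have circ (tau : 'I_d -> R) k : let w := ((0 +i* tau k)%C - 1) / ((0 +i* tau k)%C + 1) in w * w^* = 1 :> C.
  rewrite /=; have i2 := i1 (tau k).
  have cj : ((0 +i* tau k)%C : C)^* = - (0 +i* tau k)%C by apply/eqP; rewrite eq_complex /= oppr0 !eqxx.
  rewrite rmorphM fmorphV rmorphB rmorphD rmorph1 /= cj.
  have i3 : - (0 +i* tau k)%C + 1 != 0 :> C by rewrite eq_complex /= oppr0 add0r oner_eq0.
  by move: ((0 +i* tau k)%C : C) i2 i3 => y y0 y1; field; apply/andP.
have c0 : forall u, c u = 0.
  apply: (box_poly_eq0 xinj) => j; rewrite -/(bval c _) bval_push; last first.
    move=> st _; rewrite mem_mbox; apply/forallP => k; rewrite ffunE leq_add ?leq_subr //.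
    by rewrite -ltnS.
  pose w k : C := ((0 +i* (j k)%:R)%C - 1) / ((0 +i* (j k)%:R)%C + 1).
  have wc k : w k * (w k)^* = 1 by exact: (circ (fun k => (j k)%:R)).
  have mono st : \prod_k w k ^+ phi st k = (\prod_k w k ^+ N) * ((\prod_k w k ^+ st.2 k) * (\prod_k w k ^+ st.1 k)^*).
    rewrite rmorph_prod -!big_split; apply: eq_bigr => k _ /=; rewrite ffunE exprD rmorphXn /=.
    have sk : (st.1 k <= N)%N by rewrite -ltnS.
    have -> : w k ^+ N = w k ^+ (N - st.1 k) * w k ^+ st.1 k by rewrite -exprD subnK.
    have ww : w k ^+ st.1 k * (w k)^* ^+ st.1 k = 1 by rewrite -exprMn wc expr1n.
    by rewrite -[LHS]mulr1 -ww; ring.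
  transitivity ((\prod_k w k ^+ N) * (bval b w * (bval a w)^* + bval a w * (bval b w)^*)); last first.
    by rewrite (H (fun k => (j k)%:R)) mulr0.
  rewrite (eq_bigr (fun st : T * T => (\prod_k w k ^+ N) * (h st * ((\prod_k w k ^+ st.2 k) * (\prod_k w k ^+ st.1 k)^*)))) => [|st _]; last first.
    by rewrite mono mulrCA.
  rewrite -mulr_sumr; congr (_ * _); rewrite /bval !rmorph_sum /= !mulr_suml -big_split /=.
  rewrite -(pair_bigA _ (fun s t => h (s, t) * ((\prod_k w k ^+ t k) * (\prod_k w k ^+ s k)^*))) exchange_big /=.
  apply: eq_bigr => t _; rewrite !mulr_sumr -big_split /=; apply: eq_bigr => s _.
  by rewrite /h /= !rmorphM /=; ring.
(* The coefficient at exponent [N] in every variable collects exactly the pairs [s = t]. *)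
pose u0 : {ffun 'I_d -> 'I_(N + N).+1} := [ffun=> inord N].
have u0E k : u0 k = N :> nat by rewrite ffunE inordK // ltnS leq_addr.
rewrite -[RHS](c0 u0) /c -(pair_big_dep predT (fun s t => phi (s, t) == membed u0) (fun s t => h (s, t))) /=.
apply: eq_bigr => t _; rewrite (big_pred1 t) // => s.
apply/eqP/eqP => [e|->].
  apply/ffunP => k; apply/val_inj; have := congr1 (fun f : {ffun 'I_d -> nat} => f k) e.
  rewrite !ffunE /= inordK ?ltnS ?leq_addr //; have := ltn_ord (t k); have := ltn_ord (s k).
  move: (s k : nat) (t k : nat) => x1 y1; lia.
apply/ffunP => k; rewrite !ffunE /= inordK ?ltnS ?leq_addr //.
by rewrite subnKC // -ltnS.
Qed.

End BoxSubstitution.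

(** * Transfer of the kernel to the polyhalfplane *)

Section HalfPlaneKernel.
Variables (R : realType) (d n : nat).
Local Notation C := (cplx R).

Lemma bvalZ N (x : C) (a : {ffun 'I_d -> 'I_N.+1} -> C) z :
  bval (fun t => x * a t) z = x * bval a z.
Proof. by rewrite /bval mulr_sumr; apply: eq_bigr => t _; rewrite mulrA. Qed.

Lemma box_mul_shift N (a : {ffun 'I_d -> 'I_N.+1} -> C) :
  exists a' : {ffun 'I_d -> 'I_N.+2} -> C, forall z,
    bval a' z = (\prod_k (z k + 1)) * bval a z.
Proof.
have [|a' aE] := box_subst (M := N.+1) a (u := fun _ j => linpow 0 1 j 1).
  by move=> _ j jN; apply: leq_trans (size_linpow _ _ _ _) _; rewrite addn1.
exists a' => z; rewrite aE mulr_sumr; apply: eq_bigr => t _.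
rewrite [RHS]mulrCA -big_split; congr (_ * _); apply: eq_bigr => k _ /=.
by rewrite linpowE addr0 mul1r expr1 mulrC.
Qed.

Lemma cayley_step (x v : C) : x + 1 != 0 -> v + 1 != 0 ->
  (x + 1) * (v + 1)^* * (1 - (x - 1) / (x + 1) * ((v - 1) / (v + 1))^*) = 2 * (x + v^*).
Proof.
move=> x1 v1; have v2 : v^* + 1 != 0 by rewrite -(rmorph1 Num.conj) -rmorphD /= conjC_eq0.
rewrite rmorphM fmorphV !rmorphD rmorphN !rmorph1 /=; move: v2; move: (v^*) => y h2.
by field; apply/andP.
Qed.

Variables (p : mpoly d C) (P : 'M[mpoly d C]_n).

(** [g1] and [g2] represent the same rational function, one in each class, and are linked only
    through [p g = P]. The factor [om], common to numerator and denominator, will cancel in their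
    quotient. *)
Lemma halfplane_kernel (g1 g2 : 'rV[C]_d -> 'M[C]_n) : (0 < d)%N ->
  (forall z, polyhalfplane z -> forall i j,
     meval (fun k => z 0 k) p * g1 z i j = meval (fun k => z 0 k) (P i j)) ->
  (forall z, polyhalfplane z -> forall i j,
     meval (fun k => z 0 k) p * g2 z i j = meval (fun k => z 0 k) (P i j)) ->
  herglotz_agler g1 -> cayley_inner g2 ->
  exists (N r : nat) (a : {ffun 'I_d -> 'I_N.+1} -> C)
    (b : 'I_n -> 'I_n -> {ffun 'I_d -> 'I_N.+1} -> C)
    (c : 'I_d -> 'I_r -> 'I_n -> {ffun 'I_d -> 'I_N.+1} -> C) (om : ('I_d -> C) -> C),
  (forall z, (forall k, z k + 1 != 0) -> [/\ om z != 0, bval a z = om z * meval z p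
     & forall i j, bval (b i j) z = om z * meval z (P i j)]) /\
  forall z w, (forall k, z k + 1 != 0) -> (forall k, w k + 1 != 0) -> forall i j,
    bval (b i j) z * (bval a w)^* + bval a z * (bval (b j i) w)^* =
    \sum_k (z k + (w k)^*) * \sum_l (bval (c k l i) w)^* * bval (c k l j) z.
Proof.
move=> d0 pg1 pg2 HA inner.
pose N := maxn (mmeasure mdeg p) (\max_i \max_j mmeasure mdeg (P i j)).
have pN : (mmeasure mdeg p <= N.+1)%N by apply: leqW; exact: leq_maxl.
have PN i j : (mmeasure mdeg (P i j) <= N.+1)%N.
  apply: leqW; apply: leq_trans (leq_maxr _ _).
  by apply: leq_trans (leq_bigmax i); exact: (leq_bigmax j).
pose co (q : mpoly d C) (t : {ffun 'I_d -> 'I_N.+1}) : C := mcoeff (box_mnm t) q.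
have coE q z : (mmeasure mdeg q <= N.+1)%N -> bval (co q) z = meval z q.
  by move=> qN; rewrite (meval_box z qN).
have [a aE] := cayley_box (co p).
have /boolp.choice [b bE] : forall ij : 'I_n * 'I_n, exists a' : {ffun 'I_d -> 'I_N.+1} -> C, forall z,
    (forall k, 1 - z k != 0) ->
    bval a' z = (\prod_k (1 - z k) ^+ N) * bval (co (P ij.1 ij.2)) (fun k => (1 + z k) / (1 - z k)).
  by move=> ij; exact: cayley_box.
have aF (zeta : 'rV[C]_d) : polydisk zeta -> forall i j,
    bval a (fun k => zeta 0 k) * g1 (cayley_point zeta) i j = bval (fun t => b (i, j) t) (fun k => zeta 0 k).
  move=> zd i j; have z1 k : 1 - zeta 0 k != 0.
    by rewrite subr_eq0; apply: contraTneq (zd k) => <-; rewrite normr1 ltxx.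
  rewrite aE // bE // -mulrA !coE //; congr (_ * _).
  have := pg1 _ (cayley_point_halfplane zd) i j.
  rewrite (_ : (fun k => cayley_point zeta 0 k) = fun k => (1 + zeta 0 k) / (1 - zeta 0 k)) //.
  by apply/funext => k; rewrite mxE.
have tr0 : \sum_t \sum_i (b (i, i) t * (a t)^* + a t * (b (i, i) t)^*) = 0.
  rewrite exchange_big big1 // => i _; apply: torus_diagonal => tau /=.
  set w := fun k => _; have y1 k : (0 +i* tau k)%C + 1 != 0 :> C by rewrite eq_complex /= add0r oner_eq0.
  have w1 k : 1 - w k != 0.
    rewrite /w (_ : 1 - _ = 2 / ((0 +i* tau k)%C + 1)) ?mulf_neq0 ?invr_eq0 ?pnatr_eq0 //.
    by move: (y1 k); move: ((0 +i* tau k)%C : C) => y h; field.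
  have wE : (fun k => (1 + w k) / (1 - w k)) = fun k => imag_point (\row_k tau k) 0 k.
    apply/funext => k; rewrite !mxE; have := w1 k; rewrite /w.
    move: (y1 k); move: ((0 +i* tau k)%C : C) => y h1 h2; field; rewrite h1 /=.
    by rewrite (_ : y + 1 - (y - 1) = 2) ?pnatr_eq0 //; ring.
  rewrite aE // bE // !wE !coE //.
  have := boundary_form pg2 inner (\row_k tau k) i; rewrite /bform.
  move: (meval _ (P i i)) (meval _ p) (\prod_k _) => x y v e.
  by rewrite !rmorphM -(mulr0 (v * v^*)) -e; ring.
pose B t : 'M[C]_n := \matrix_(i, j) b (i, j) t.
have BE i j : (fun t => B t i j) = b (i, j) by apply/funext => t; rewrite mxE.
have [zeta zd i j||c cE] := @polydisk_kernel R d N n a B g1 d0 HA.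
- by rewrite BE; exact: aF.
- rewrite -[RHS]tr0; apply: eq_bigr => t _; apply: eq_bigr => i _.
  by rewrite /B !mxE.
have {}cE z w i j : bval (b (i, j)) z * (bval a w)^* + bval a z * (bval (b (j, i)) w)^* =
    \sum_k (1 - z k * (w k)^*) * \sum_l (bval (c k l i) w)^* * bval (c k l j) z.
  by rewrite -cE !BE.
have /boolp.choice [c' c'E] : forall k, exists c' : 'I_#|{: {ffun 'I_d -> 'I_N.+1} * 'I_n}| -> 'I_n ->
    {ffun 'I_d -> 'I_N.+2} -> C, forall l j z, (forall k, z k + 1 != 0) ->
    bval (c' l j) z = (\prod_k (z k + 1) ^+ N * \prod_(k' | k' != k) (z k' + 1)) *
      bval (c k l j) (fun k => (z k - 1) / (z k + 1)).
  move=> k.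
  have /boolp.choice [h hE] : forall lj : 'I_#|{: {ffun 'I_d -> 'I_N.+1} * 'I_n}| * 'I_n,
      exists c' : {ffun 'I_d -> 'I_N.+2} -> C, forall z, (forall k, z k + 1 != 0) ->
      bval c' z = (\prod_k (z k + 1) ^+ N * \prod_(k' | k' != k) (z k' + 1)) *
        bval (c k lj.1 lj.2) (fun k => (z k - 1) / (z k + 1)).
    by move=> lj; exact: cayley_box_inv.
  by exists (fun l j => h (l, j)) => l j z z1; rewrite (hE (l, j)).
have [a' a'E] := box_mul_shift (co p).
have /boolp.choice [b' b'E] : forall ij : 'I_n * 'I_n, exists b' : {ffun 'I_d -> 'I_N.+2} -> C,
    forall z, bval b' z = (\prod_k (z k + 1)) * bval (co (P ij.1 ij.2)) z.
  by move=> ij; exact: box_mul_shift.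
(* Since [(1 - zeta) (z + 1) = 2], the powers from the two Cayley substitutions combine to this
   constant. The factor [sqrtC 2] below absorbs the [2] of [cayley_step]. *)
pose ka : C := \prod_(k < d) 2%:R ^+ N.
have ka0 : ka != 0 by apply/prodf_neq0 => k _; rewrite expf_neq0 // pnatr_eq0.
exists N.+1, #|{: {ffun 'I_d -> 'I_N.+1} * 'I_n}|, (fun t => ka * a' t), (fun i j t => ka * b' (i, j) t),
  (fun k l j t => sqrtC 2 * c' k l j t), (fun z => ka * \prod_k (z k + 1)).
split=> [z z1|z w z1 w1 i j].
  split; first by rewrite mulf_neq0 //; apply/prodf_neq0 => k _.
    by rewrite bvalZ a'E coE // mulrA.
  by move=> i j; rewrite bvalZ b'E coE // mulrA.
pose ze (y : 'I_d -> C) k := (y k - 1) / (y k + 1).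
have ze1 y k : (forall k, y k + 1 != 0) -> 1 - ze y k = 2 / (y k + 1).
  by move=> y1; rewrite /ze; field.
have ze2 y : (forall k, y k + 1 != 0) -> (fun k => (1 + ze y k) / (1 - ze y k)) = y.
  move=> y1; apply/funext => k; by rewrite ze1 // /ze; field; rewrite y1.
have zeN y k : (forall k, y k + 1 != 0) -> 1 - ze y k != 0.
  by move=> y1; rewrite ze1 // mulf_neq0 ?invr_eq0 ?pnatr_eq0.
pose Om (y : 'I_d -> C) := \prod_k (y k + 1) ^+ N * \prod_k (y k + 1).
have pw y : (forall k, y k + 1 != 0) -> \prod_k (1 - ze y k) ^+ N * \prod_k (y k + 1) ^+ N = ka.
  move=> y1; rewrite -big_split; apply: eq_bigr => k _ /=; rewrite -exprMn ze1 //.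
  by rewrite mulfVK.
have aO y : (forall k, y k + 1 != 0) -> bval (fun t => ka * a' t) y = Om y * bval a (ze y).
  move=> y1; rewrite bvalZ a'E aE => [|k]; last exact: zeN.
  by rewrite ze2 // -(pw y y1) /Om; ring.
have bO i' j' y : (forall k, y k + 1 != 0) -> bval (fun t => ka * b' (i', j') t) y = Om y * bval (b (i', j')) (ze y).
  move=> y1; rewrite bvalZ b'E bE => [|k]; last exact: zeN.
  by rewrite ze2 // -(pw y y1) /Om; ring.
rewrite !aO // !bO // !rmorphM /=.
transitivity (Om z * (Om w)^* * (bval (b (i, j)) (ze z) * (bval a (ze w))^* + bval a (ze z) * (bval (b (j, i)) (ze w))^*)).
  by rewrite /Om !rmorphM /=; ring.
rewrite cE mulr_sumr; apply: eq_bigr => k _; rewrite mulrA !mulr_sumr; apply: eq_bigr => l _.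
have c'E2 l' j' y : (forall k, y k + 1 != 0) -> bval (c' k l' j') y =
    (\prod_k (y k + 1) ^+ N * \prod_(k' | k' != k) (y k' + 1)) * bval (c k l' j') (ze y).
  exact: c'E.
rewrite !bvalZ !c'E2 //.
have s2 : (sqrtC 2)^* * sqrtC 2 = 2 :> C.
  by rewrite conj_Creal ?ger0_real ?sqrtC_ge0 ?ler0n // -expr2 sqrtCK.
have OmE y : Om y = (\prod_k (y k + 1) ^+ N * \prod_(k' | k' != k) (y k' + 1)) * (y k + 1).
  by rewrite /Om [X in _ * X](bigD1 k) //= [X in _ * X]mulrC mulrA.
have one := cayley_step (z1 k) (w1 k); rewrite -/(ze z k) -/(ze w k) in one.
rewrite !OmE; move: one s2.
move: (1 - ze z k * (ze w k)^*) (bval _ (ze z)) (bval _ (ze w)) => u x y.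
move: (\prod_k (z k + 1) ^+ N * _) (\prod_k (w k + 1) ^+ N * _) => p1 p2 one s2.
rewrite !rmorphM /=.
transitivity (((z k + 1) * (w k + 1)^* * u) * (p1 * p2^* * (y^* * x))); first by ring.
have E (q1 q2 v : C) : q1 * q2 = 2 ->
    2 * v * (p1 * p2^* * (y^* * x)) = v * (q1 * (p2^* * y^*) * (q2 * (p1 * x))).
  by move=> <-; ring.
by rewrite one; exact: E.
Qed.

End HalfPlaneKernel.

(** * Homogenization and realization *)
Section HomogeneousKernel.
Variables (R : realType) (d n N r : nat).
Local Notation C := (cplx R).
Local Notation T := {ffun 'I_d -> 'I_N.+1}.

Definition bpoly (c : T -> C) z : {poly C} := \poly_(j < (d * N).+1) bval (bpart j c) z.

Lemma bpolyE c z x : (bpoly c z).[x] = bval c (fun k => x * z k).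
Proof. by rewrite bval_scale /bpoly horner_poly. Qed.

Lemma coef_bpoly c z j : (bpoly c z)`_j = bval (bpart j c) z.
Proof.
rewrite coef_poly; case: ltnP => // dj; rewrite bval_part big1 // => t /eqP tj.
by have := bdeg_bound t; rewrite tj ltnNge dj.
Qed.

Lemma poly_eq_unit_interval (p q : {poly C}) :
  (forall l : R, 0 < l <= 1 -> p.[cr l] = q.[cr l]) -> p = q.
Proof.
move=> H; apply/eqP; rewrite -subr_eq0; apply/eqP/polyP => j; rewrite coef0.
have [js|/(nth_default 0) //] := ltnP j (size (p - q)).
apply: (small_coef (c := fun i : 'I_(size (p - q)) => (p - q)`_i) (K := 0) (m := size (p - q)) _ (j := Ordinal js)) => //.
move=> l l01; rewrite -horner_coef hornerD hornerN H // subrr rabs0 mul0r //.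
Qed.

(** As [p] starts at order [m], the term in [x] only enters at order [m + 1]; this suppresses one of
    the two points in [homogeneous_kernel]. *)
Lemma coef_mul_linear (p : {poly C}) (x y : C) m : (forall j, (j < m)%N -> p`_j = 0) ->
  (p * (x *: 'X + y%:P))`_m = y * p`_m.
Proof.
move=> p0; rewrite mulrDr coefD coefMC -scalerAr coefZ coefMX.
case: m p0 => [|m'] p0 /=; first by rewrite mulr0 add0r mulrC.
by rewrite p0 // mulr0 add0r mulrC.
Qed.

Lemma conj_mul3 (x y v : C) : (x^* * y * v^*)^* = x * y^* * v.
Proof. by rewrite !rmorphM /= !conjCK. Qed.

Lemma conj_sum2 (x : 'I_d -> C) (y v : 'I_d -> 'I_r -> C) :
  (\sum_k (x k)^* * \sum_s (y k s)^* * v k s)^* = \sum_k x k * \sum_s y k s * (v k s)^*.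
Proof.
rewrite rmorph_sum; apply: eq_bigr => k _; rewrite rmorphM /= conjCK; congr (_ * _).
by rewrite rmorph_sum; apply: eq_bigr => s _; rewrite rmorphM /= conjCK.
Qed.

Variables (a : T -> C) (b : 'I_n -> 'I_n -> T -> C) (c : 'I_d -> 'I_r -> 'I_n -> T -> C) (m : nat).
Hypothesis ker : forall z w, (forall k, 0 < z k) -> (forall k, 0 < w k) -> forall i j,
  bval (b i j) z * (bval a w)^* + bval a z * (bval (b j i) w)^* =
  \sum_k (z k + (w k)^*) * \sum_l (bval (c k l i) w)^* * bval (c k l j) z.
Hypothesis hom : forall (l : R) z, 0 < l -> (forall k, 0 < z k) -> forall i j,
  bval (b i j) (fun k => cr l * z k) * bval a z = cr l * bval (b i j) z * bval a (fun k => cr l * z k).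
Hypothesis a_low : forall t, (bdeg t < m)%N -> a t = 0.

Let rat z i j := bval (b i j) z / bval a z.

Let scale_pos (l : R) (z : 'I_d -> C) : 0 < l -> (forall k, 0 < z k) -> forall k, 0 < cr l * z k.
Proof. by move=> l0 z0 k; rewrite mulr_gt0 // -cr0 ltr_cr. Qed.

(** Homogeneity at positive scalars turns the left side of [ker] into the two dilated denominators
    times an expression linear in [l] and [u]. *)
Lemma scaled_kernel (l u : R) z w i j : 0 < l -> 0 < u ->
  (forall k, 0 < z k) -> (forall k, 0 < w k) -> bval a z != 0 -> bval a w != 0 ->
  bval a (fun k => cr l * z k) * (bval a (fun k => cr u * w k))^* *
    (cr l * rat z i j + cr u * (rat w j i)^*) =
  \sum_k (cr l * z k + cr u * (w k)^*) *
    \sum_s (bval (c k s i) (fun k => cr u * w k))^* * bval (c k s j) (fun k => cr l * z k).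
Proof.
move=> l0 u0 z0 w0 az aw.
have hb (x : R) y i' j' : 0 < x -> (forall k, 0 < y k) -> bval a y != 0 ->
    bval (b i' j') (fun k => cr x * y k) = cr x * rat y i' j' * bval a (fun k => cr x * y k).
  by move=> x0 y0 ay; apply: (mulIf ay); rewrite hom // /rat; field.
have := ker (scale_pos l0 z0) (scale_pos u0 w0) i j; rewrite !hb //.
under eq_bigr do rewrite rmorphM /= conj_cr.
move=> <-; rewrite !rmorphM /= conj_cr; ring.
Qed.

Lemma a_part_low j z : (j < m)%N -> bval (bpart j a) z = 0.
Proof.
by move=> jm; rewrite bval_part big1 // => t /eqP tj; rewrite a_low ?mul0r // tj.
Qed.

(** On the diagonal [w = z] the right side is a sum of nonnegative terms: after cancelling [l], each
    [|c(l z)|^2] is at most a constant times [|a(l z)|^2], which is [O(l^(2 m))]. *)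
Lemma c_part_low q k s j z : (q < m)%N -> (forall k, 0 < z k) -> bval a z != 0 ->
  bval (bpart q (c k s j)) z = 0.
Proof.
move=> qm z0 az.
pose S := \sum_(i < (d * N).+1) rabs (bval (bpart i a) z).
have aS (l : R) : 0 < l <= 1 -> rabs (bval a (fun k => cr l * z k)) <= S * l ^+ m.
  move=> /andP [l0 l1]; rewrite bval_scale; apply: le_trans (rabs_sum_le _ _ _) _.
  rewrite mulr_suml; apply: ler_sum => i _; rewrite rabsM rabsX rabs_cr gtr0_norm //.
  have [im|mi] := ltnP i m; first by rewrite a_part_low // rabs0 !mul0r.
  by rewrite ler_wpM2l ?rabs_ge0 // ler_wiXn2l // ltW.
pose x := complex.Re (z k).
have zx : z k = cr x by rewrite cr_Re // ltW.
have x0 : 0 < x by rewrite -ltr_cr cr0 -zx.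
pose f := 2 * complex.Re (rat z j j).
have fE : rat z j j + (rat z j j)^* = cr f.
  by rewrite /f; case: (rat z j j) => u v; apply/eqP; rewrite eq_complex /= subrr eqxx andbT; apply/eqP; ring.
have zreal k' : (z k')^* = z k' by rewrite conj_Creal // ger0_real // ltW.
have key (l : R) : 0 < l <= 1 ->
    2 * x * rabs (bval (c k s j) (fun k => cr l * z k)) ^+ 2 <= rabs (bval a (fun k => cr l * z k)) ^+ 2 * f.
  move=> /andP [l0 l1].
  have := scaled_kernel j j l0 l0 z0 z0 az az.
  rewrite -mulrDr fE -normCK -cr_rabs -crX.
  under eq_bigr do rewrite zreal -mulr2n -mulr_natl -mulrA.
  have E k' : \sum_s' (bval (c k' s' j) (fun k => cr l * z k))^* * bval (c k' s' j) (fun k => cr l * z k)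
      = cr (\sum_s' rabs (bval (c k' s' j) (fun k => cr l * z k)) ^+ 2).
    rewrite /cr rmorph_sum; apply: eq_bigr => s' _.
    by rewrite mulrC -normCK -[RHS]/(cr _) crX cr_rabs.
  have zx' k' : z k' = cr (complex.Re (z k')) by rewrite cr_Re // ltW.
  have xp k' : 0 < complex.Re (z k') by rewrite -ltr_cr cr0 -zx'.
  rewrite (eq_bigr (fun k' => cr (l * (2 * complex.Re (z k') * \sum_s' rabs (bval (c k' s' j) (fun k => cr l * z k)) ^+ 2)))) => [|k' _]; last first.
    by rewrite E [X in _ * (_ * X * _)]zx' !crM -(cr_nat R 2); ring.
  rewrite -!crM => e1; have {e1} : cr (rabs (bval a (fun k => cr l * z k)) ^+ 2 * (l * f)) =
      cr (\sum_k' l * (2 * complex.Re (z k') * \sum_s' rabs (bval (c k' s' j) (fun k => cr l * z k)) ^+ 2)).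
    by rewrite e1 /cr rmorph_sum.
  move/(@cr_inj R _ _); rewrite -mulr_sumr mulrCA => /(mulfI (lt0r_neq0 l0)) ->.
  rewrite (bigD1 k) //= ler_wpDr //.
    apply: sumr_ge0 => k' _; rewrite !mulr_ge0 ?(ltW (xp _)) //.
    by apply: sumr_ge0 => s' _; exact: sqr_ge0.
  rewrite -/x ler_pM2l ?mulr_gt0 // (bigD1 s) //= lerDl.
  by apply: sumr_ge0 => s' _; exact: sqr_ge0.
have f0 : 0 <= f.
  have := key 1; rewrite ltr01 lexx => /(_ isT) h.
  have : 0 <= rabs (bval a (fun k => cr 1 * z k)) ^+ 2 * f.
    by apply: le_trans h; rewrite mulr_ge0 ?sqr_ge0 // mulr_ge0 // ltW.
  rewrite pmulr_rge0 // exprn_gt0 // lt_def rabs_ge0 andbT.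
  apply: contra az => /eqP /rabs_eq0; rewrite (_ : (fun k => _) = z) => [->//|].
  by apply/funext => k'; rewrite cr1 mul1r.
apply: (bval_small (K := Num.sqrt (S ^+ 2 * f / (2 * x))) (m := m)) => // l l01.
have /andP [l0 l1] := l01.
have x20 : 0 < 2 * x by rewrite mulr_gt0.
rewrite -ler_sqr ?nnegrE ?rabs_ge0 ?mulr_ge0 ?sqrtr_ge0 ?exprn_ge0 ?(ltW l0) //.
rewrite exprMn sqr_sqrtr; last by rewrite divr_ge0 ?(ltW x20) // mulr_ge0 // sqr_ge0.
rewrite mulrAC ler_pdivlMr // mulrC; apply: le_trans (key l l01) _.
rewrite [leRHS]mulrAC -exprMn ler_wpM2r // ler_sqr ?nnegrE ?rabs_ge0 ?aS //.
exact: le_trans (rabs_ge0 _) (aS l l01).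
Qed.

(** Coefficients of order [m] are compared first in the dilation [u] of [w], which discards the
    terms carrying an extra [u], then, after conjugation, in the dilation [l] of [z]. The result has
    lost the summand [w_k] and is asymmetric in the two points. *)
Lemma homogeneous_kernel z w i j :
  (forall k, 0 < z k) -> (forall k, 0 < w k) -> bval a z != 0 -> bval a w != 0 ->
  rat z i j * bval (bpart m a) z * (bval (bpart m a) w)^* =
  \sum_k z k * \sum_s (bval (bpart m (c k s i)) w)^* * bval (bpart m (c k s j)) z.
Proof.
move=> z0 w0 az aw.
have step1 (l : R) : 0 < l <= 1 ->
    (rat z i j)^* * bval (bpart m a) w * (bval a (fun k => cr l * z k))^* =
    \sum_k (z k)^* * \sum_s (bval (c k s j) (fun k => cr l * z k))^* * bval (bpart m (c k s i)) w.
  move=> /andP [l0 l1].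
  pose pz := \sum_k \sum_s (bval (c k s j) (fun k => cr l * z k))^* *:
     (bpoly (c k s i) w * (w k *: 'X + (cr l * (z k)^*)%:P)).
  pose pa := (bval a (fun k => cr l * z k))^* *:
     (bpoly a w * (rat w j i *: 'X + (cr l * (rat z i j)^*)%:P)).
  have pE : pa = pz.
    apply: poly_eq_unit_interval => u /andP [u0 _].
    have := scaled_kernel j i u0 l0 w0 z0 aw az.
    rewrite /pa /pz hornerZ hornerM bpolyE hornerD hornerZ hornerX hornerC.
    rewrite [cr u * rat w j i]mulrC mulrA [_^* * bval _ _]mulrC => ->.
    rewrite horner_sum; apply: eq_bigr => k _; rewrite horner_sum mulr_sumr; apply: eq_bigr => s _.
    rewrite hornerZ hornerM bpolyE hornerD hornerZ hornerX hornerC; ring.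
  have := congr1 (fun p : {poly C} => p`_m) pE; rewrite /pa /pz coefZ.
  rewrite coef_mul_linear => [|q qm]; last by rewrite coef_bpoly a_part_low.
  rewrite coef_bpoly coef_sum => e.
  have l0' : cr l != 0 by rewrite -cr0 (inj_eq (@cr_inj R)) gt_eqF.
  apply: (mulfI l0'); transitivity ((bval a (fun k => cr l * z k))^* * (cr l * (rat z i j)^* * bval (bpart m a) w)); first by ring.
  rewrite e mulr_sumr; apply: eq_bigr => k _; rewrite coef_sum !mulr_sumr; apply: eq_bigr => s _.
  rewrite coefZ coef_mul_linear => [|q qm]; last by rewrite coef_bpoly c_part_low.
  by rewrite coef_bpoly; ring.
pose qa := (rat z i j * (bval (bpart m a) w)^*) *: bpoly a z.
pose qz := \sum_k \sum_s (z k * (bval (bpart m (c k s i)) w)^*) *: bpoly (c k s j) z.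
have qE : qa = qz.
  apply: poly_eq_unit_interval => l l01; rewrite /qa /qz hornerZ bpolyE.
  rewrite -[LHS]conj_mul3 step1 // (conj_sum2 z (fun k s => bval (c k s j) (fun k => cr l * z k))
    (fun k s => bval (bpart m (c k s i)) w)).
  rewrite horner_sum; apply: eq_bigr => k _; rewrite horner_sum mulr_sumr.
  by apply: eq_bigr => s _; rewrite hornerZ bpolyE; ring.
have := congr1 (fun p : {poly C} => p`_m) qE; rewrite /qa /qz coefZ coef_bpoly coef_sum => e.
rewrite mulrAC e; apply: eq_bigr => k _; rewrite coef_sum mulr_sumr; apply: eq_bigr => s _.
by rewrite coefZ coef_bpoly mulrA.
Qed.

End HomogeneousKernel.

(** * From the asymmetric kernel to a positive semidefinite pencil *)

Section Realization.
Variables (R : realType) (d n q : nat).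
Local Notation C := (cplx R).
Variables (kap : 'I_q -> 'I_d) (Gen : set ('I_d -> C)).
Hypothesis Gen_pos : forall z, Gen z -> forall k, 0 < z k.
Variables (Phi : ('I_d -> C) -> 'M[C]_(q, n)) (F : ('I_d -> C) -> 'M[C]_n).
Local Notation D z := (diag_mx (\row_x z (kap x)) : 'M[C]_q).
Hypothesis kernel : forall z w, Gen z -> Gen w -> F z = adjmx (Phi w) *m D z *m Phi z.

(** The left side of [kernel] does not depend on [w], so [D z *m Phi z] is orthogonal to all
    differences [Phi w - Phi w0]. Writing [Phi z = Phi w0 + Xt Y], this says [A_21 = - A_22 Y], and
    the Schur complement becomes [Phi(w0)^* D(z) Phi(z) = F z]. *)
Lemma realization w0 : Gen w0 -> exists (m : nat) (A : 'I_d -> 'M[C]_(n + m)),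
  [/\ forall k, psdmx (A k),
      forall z, (forall k, 0 < z k) -> \det (drsubmx (pencil_at A z)) != 0
    & forall z, Gen z -> schur (pencil_at A z) = F z].
Proof.
move=> Gw0.
have [m [X [Xfree XFam Xspan]]] := spanning_rows (fun v : 'rV[C]_q =>
  exists w j, Gen w /\ v = (col j (Phi w - Phi w0))^T).
pose Xt : 'M[C]_(q, m) := X^T; pose W := row_mx (Phi w0) Xt.
pose E k : 'M[C]_q := diag_mx (\row_x (kap x == k)%:R).
have Eidem k : adjmx (E k) *m E k = E k.
  apply/matrixP => x y; rewrite mul_mx_diag mxE adjmxE !mxE [y == x]eq_sym.
  case: (x =P y) => [->|_]; rewrite ?mulr1n ?mulr0n ?conjC0 ?mul0r //.
  by case: (_ == k); rewrite ?conjC1 ?mulr1 ?mulr0.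
pose A k := adjmx (E k *m W) *m (E k *m W).
have ED z : D z = \sum_k z k *: E k.
  apply/matrixP => x y; rewrite summxE !mxE (bigD1 (kap x)) //= big1 => [|k kx].
    by rewrite addr0 !mxE eqxx mulrnAr mulr1.
  by rewrite !mxE eq_sym (negbTE kx) mul0rn mulr0.
have AE z : pencil_at A z = adjmx W *m D z *m W.
  rewrite ED mulmx_sumr mulmx_suml; apply: eq_bigr => k _.
  by rewrite -scalemxAr -scalemxAl /A adjmxM mulmxA -(mulmxA (adjmx W)) Eidem.
have blk z : pencil_at A z = block_mx
    (adjmx (Phi w0) *m D z *m Phi w0) (adjmx (Phi w0) *m D z *m Xt)
    (adjmx Xt *m D z *m Phi w0) (adjmx Xt *m D z *m Xt).
  by rewrite AE /W -mul_col_row; congr (_ *m _); rewrite /adjmx map_row_mx tr_row_mx mul_col_mx.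
have form z (v : 'cV[C]_q) : (adjmx v *m D z *m v) 0 0 = \sum_x z (kap x) * `|v x 0| ^+ 2.
  rewrite -mulmxA mxE; apply: eq_bigr => x _; rewrite mul_diag_mx adjmxE !mxE mulrCA.
  by rewrite [_^* * _]mulrC -normCK.
have det0 z : (forall k, 0 < z k) -> \det (drsubmx (pencil_at A z)) != 0.
  move=> z0; rewrite blk block_mxKdr; apply: det_neq0_ker => y yy.
  have Xy : Xt *m y = 0.
    apply/matrixP => x j; rewrite (ord1 j) [RHS]mxE.
    have : (adjmx (Xt *m y) *m D z *m (Xt *m y)) 0 0 = 0.
      have -> : adjmx (Xt *m y) *m D z *m (Xt *m y) = adjmx y *m (adjmx Xt *m D z *m Xt *m y).
        by rewrite adjmxM !mulmxA.
      by rewrite yy mulmx0 mxE.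
    rewrite form => /eqP; rewrite psumr_eq0 => [/allP /(_ x (mem_index_enum _)) /=|x' _]; last first.
      by rewrite mulr_ge0 ?exprn_ge0 // ltW.
    by rewrite mulf_eq0 gt_eqF //= expf_eq0 normr_eq0 /= => /eqP.
  apply: trmx_inj; rewrite trmx0; apply: (row_free_inj Xfree); rewrite mul0mx.
  by apply: trmx_inj; rewrite trmx_mul trmxK trmx0.
exists m, A; split=> // [k|z Gz]; first exact: psdmx_gram.
have [Y YE] : exists Y, Phi z = Phi w0 + Xt *m Y.
  have Hsub : ((Phi z - Phi w0)^T <= X)%MS.
    apply/row_subP => j; rewrite -tr_col; apply: Xspan; by exists z, j.
  have [Y' YE] := submxP Hsub; exists Y'^T; rewrite /Xt -trmx_mul -YE trmxK.
  by rewrite addrC subrK.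
have orth : adjmx Xt *m D z *m Phi z = 0.
  apply/row_matrixP => i; rewrite row0 row_mul row_mul.
  have [w [j [Gw XE]]] := XFam i.
  have -> : row i (adjmx Xt) = row j (adjmx (Phi w - Phi w0)).
    apply/matrixP => i' x; have := congr1 (fun M : 'rV[C]_q => M 0 x) XE.
    by rewrite !mxE => ->.
  by rewrite -!row_mul adjmxB !mulmxBl -!kernel // subrr row0.
have dru : adjmx Xt *m D z *m Xt \in unitmx.
  by have := det0 z (Gen_pos Gz); rewrite blk block_mxKdr unitmxE unitfE.
rewrite /schur blk block_mxKul block_mxKur block_mxKdl block_mxKdr.
have -> : adjmx Xt *m D z *m Phi w0 = - (adjmx Xt *m D z *m Xt *m Y).
  by move: orth; rewrite YE mulmxDr mulmxA => /eqP; rewrite addr_eq0 => /eqP.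
rewrite mulmxN opprK -[_ *m invmx _ *m _]mulmxA (mulKmx dru) (kernel Gz Gw0) YE mulmxDr.
by rewrite mulmxA.
Qed.

End Realization.

(** * The converse implication *)

Section Converse.
Variables (R : realType) (d n : nat).
Local Notation C := (cplx R).

Definition bmpoly N (c : {ffun 'I_d -> 'I_N.+1} -> C) : mpoly d C :=
  \sum_t c t *: mpolyX C (box_mnm t).

Lemma meval_bmpoly N (c : {ffun 'I_d -> 'I_N.+1} -> C) z : meval z (bmpoly c) = bval c z.
Proof.
rewrite /bmpoly rmorph_sum; apply: eq_bigr => t _ /=; rewrite mevalZ mevalX; congr (_ * _).
by apply: eq_bigr => k _; rewrite multinomE tnth_mktuple.
Qed.

Lemma bmpoly_neq0 N (c : {ffun 'I_d -> 'I_N.+1} -> C) t : c t != 0 -> bmpoly c != 0.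
Proof.
apply: contra_neq => c0.
apply: (box_poly_eq0 (x := fun _ (j : 'I_N.+1) => (j%:R : C))) => [k i j /eqP|j].
  by rewrite eqr_nat => /eqP /val_inj.
by rewrite -/(bval c _) -meval_bmpoly c0 meval0.
Qed.

(** [represents] prescribes values only where [q] is nonzero; with an extra factor [q] both sides
    vanish elsewhere, and the identity holds on the whole polyhalfplane. *)
Lemma represents_mul (f : 'M[ratfun R d]_n) (g : 'rV[C]_d -> 'M[C]_n) (q : mpoly d C) P :
  represents f g -> (forall i j, f i j = tofrac (P i j) / tofrac q) ->
  forall z, polyhalfplane z -> forall i j,
  meval (fun k => z 0 k) (q * q) * g z i j = meval (fun k => z 0 k) (q * P i j).
Proof.
move=> rep fE z zp i j; rewrite !mevalM.
have [->|qz] := eqVneq (meval (fun k => z 0 k) q) 0; first by rewrite !mul0r.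
by rewrite (rep z zp i j _ _ (fE i j) qz); field.
Qed.

Lemma homogeneous_meval (f : 'M[ratfun R d]_n) (q : mpoly d C) P (l : C) z i j :
  homogeneous1 f -> (forall i j, f i j = tofrac (P i j) / tofrac q) -> q != 0 -> l != 0 ->
  meval (fun k => l * z k) (P i j) * meval z q = l * meval z (P i j) * meval (fun k => l * z k) q.
Proof.
move=> hom fE q0 l0; have := hom l l0 i j _ _ q0 (fE i j).
rewrite fE /rconst mulrA -tofracM => /eqP; rewrite tofrac_div_eq ?dilate_neq0 // => /eqP E.
have := congr1 (meval z) E; move: (meval_dilate l q z) (meval_dilate l (P i j) z) (mevalC z l : meval z (mpolyC d l) = l).
move: (dilate l q) (dilate l (P i j)) (mpolyC d l) => q' P' l' q'E P'E l'E.
by rewrite !mevalM q'E P'E l'E.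
Qed.

Lemma bessmertnyi_converse (f : 'M[ratfun R d]_n) : (0 < d)%N ->
  rat_herglotz_agler f -> homogeneous1 f -> rat_cayley_inner f -> bessmertnyi f.
Proof.
move=> d0 [g1 rep1 HA] hom [g2 rep2 inner].
have [q0 [P0 [q00 fE0]]] := common_denominator f.
pose p := q0 * q0; pose P : 'M[mpoly d C]_n := \matrix_(i, j) (q0 * P0 i j).
have p0 : p != 0 by rewrite mulf_neq0.
have fE i j : f i j = tofrac (P i j) / tofrac p.
  by rewrite fE0 mxE; apply/eqP; rewrite tofrac_div_eq // /p mulrCA mulrA.
have pg g : represents f g -> forall z, polyhalfplane z -> forall i j,
    meval (fun k => z 0 k) p * g z i j = meval (fun k => z 0 k) (P i j).
  by move=> rep z zp i j; rewrite mxE; exact: (represents_mul rep fE0).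
have [N [r [a [b [c [om [abE ker]]]]]]] := halfplane_kernel d0 (pg g1 rep1) (pg g2 rep2) HA inner.
have z1 (z : 'I_d -> C) : (forall k, 0 < z k) -> forall k, z k + 1 != 0.
  by move=> z0 k; rewrite gt_eqF // addr_gt0.
have kerp z w : (forall k, 0 < z k) -> (forall k, 0 < w k) -> forall i j,
    bval (b i j) z * (bval a w)^* + bval a z * (bval (b j i) w)^* =
    \sum_k (z k + (w k)^*) * \sum_l (bval (c k l i) w)^* * bval (c k l j) z.
  by move=> z0 w0; apply: ker; exact: z1.
have homp (l : R) z : 0 < l -> (forall k, 0 < z k) -> forall i j,
    bval (b i j) (fun k => cr l * z k) * bval a z =
    cr l * bval (b i j) z * bval a (fun k => cr l * z k).
  move=> l0 z0 i j; have l0' : 0 < cr l by rewrite -cr0 ltr_cr.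
  have [_ az bz] := abE z (z1 z z0).
  have [_ alz blz] := abE (fun k => cr l * z k) (z1 _ (fun k => mulr_gt0 l0' (z0 k))).
  have := homogeneous_meval z i j hom fE p0 (lt0r_neq0 l0').
  rewrite az bz alz blz; move: (meval _ _) (meval _ _) (meval _ _) (meval _ _) (om _) (om _) => x1 x2 x3 x4 o1 o2 e.
  by transitivity (o1 * o2 * (x4 * x3)); [ring|rewrite e; ring].
have [w0 w00 pw0] := mpoly_neq0_pos p0.
have [t0 at0] : exists t, a t != 0.
  have [om0 aw0 _] := abE w0 (z1 w0 w00).
  apply/existsP; apply: contraT; rewrite negb_exists => /forallP a0.
  have : bval a w0 != 0 by rewrite aw0 mulf_neq0.
  by rewrite /bval big1 ?eqxx // => t _; have := a0 t; rewrite negbK => /eqP ->; rewrite mul0r.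
(* [tm] attains the order [m] of vanishing of the denominator at [0], which makes its lowest-order
   component [am] nonzero. *)
have [tm atm tmin] : exists2 tm, a tm != 0 & forall t, (bdeg t < bdeg tm)%N -> a t = 0.
  case: (arg_minnP (fun t => bdeg t) (at0 : (fun t => a t != 0) t0)) => tm atm tmin.
  exists tm => // t tlt; apply/eqP; apply: contraTT tlt => /tmin; by rewrite -leqNgt.
pose m := bdeg tm; pose am := bmpoly (bpart m a).
have am0 : am != 0 by apply: (@bmpoly_neq0 _ _ tm); rewrite /bpart eqxx.
have r0 : p * am != 0 by rewrite mulf_neq0.
(* Positive points where the denominator and its lowest-order component are both nonzero; they still
   separate polynomials by [mpoly_ext_generic]. *)
pose Gen := [set z : 'I_d -> C | (forall k, 0 < z k) /\ meval z (p * am) != 0].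
have GenE z : Gen z -> [/\ forall k, 0 < z k, meval z p != 0, bval (bpart m a) z != 0,
    bval a z != 0 & forall i j, bval (b i j) z / bval a z = meval z (P i j) / meval z p].
  move=> [z0]; rewrite mevalM mulf_eq0 negb_or => /andP [pz amz]; have [om0 az bz] := abE z (z1 z z0).
  rewrite meval_bmpoly in amz; split=> // [|i j]; first by rewrite az mulf_neq0.
  by rewrite az bz; field; apply/andP.
pose kap (x : 'I_#|{: 'I_d * 'I_r}|) : 'I_d := (enum_val x).1.
(* Rows are indexed by a variable and a kernel term; division by the lowest-order part of the
   denominator normalizes the kernel to [F] itself. *)
pose Phi z : 'M[C]_(#|{: 'I_d * 'I_r}|, n) :=
  \matrix_(x, j) (bval (bpart m (c (enum_val x).1 (enum_val x).2 j)) z / bval (bpart m a) z).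
pose F z : 'M[C]_n := \matrix_(i, j) (meval z (P i j) / meval z p).
have kernel z w : Gen z -> Gen w ->
    F z = adjmx (Phi w) *m diag_mx (\row_x z (kap x)) *m Phi z.
  move=> /GenE [z0 pz amz az bz] /GenE [w0' pw amw aw bw].
  apply/matrixP => i j; rewrite mxE -bz.
  have := homogeneous_kernel kerp homp tmin i j z0 w0' az aw; rewrite -/m => e.
  have amw' : (bval (bpart m a) w)^* != 0 by rewrite conjC_eq0.
  apply: (mulIf amz); apply: (mulIf amw'); rewrite e.
  rewrite mxE !mulr_suml (reindex (@enum_rank _)) /=; last exact/onW_bij/enum_rank_bij.
  transitivity (\sum_(ks : 'I_d * 'I_r) z ks.1 * ((bval (bpart m (c ks.1 ks.2 i)) w)^* * bval (bpart m (c ks.1 ks.2 j)) z)).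
    rewrite -(pair_bigA _ (fun k s => z k * ((bval (bpart m (c k s i)) w)^* * bval (bpart m (c k s j)) z))) /=.
    by apply: eq_bigr => k _; rewrite mulr_sumr.
  apply: eq_bigr => -[k s] _ /=; rewrite mul_mx_diag mxE adjmxE !mxE /kap enum_rankK /=.
  by rewrite rmorphM fmorphV /=; field; apply/andP.
have Gen_pos z : Gen z -> forall k, 0 < z k by case.
have [w1 w10 pw1] := mpoly_neq0_pos r0.
have [m' [A [Apsd Adet AF]]] := realization Gen_pos kernel (conj w10 pw1 : Gen w1).
have delta0 : pdelta A != 0.
  by apply: contraNneq (Adet w1 w10) => d00; rewrite -meval_pdelta d00 meval0.
exists m', A; split=> //; first by rewrite det_pencil tofrac_eq0.
rewrite -/(schur (pencil A)); apply/matrixP => i j; rewrite schur_pencil // fE; apply/eqP.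
rewrite tofrac_div_eq //; apply/eqP; apply: (mpoly_ext_generic r0) => z z0 rz.
have Gz : Gen z by [].
have [_ pz _ _ _] := GenE z Gz.
move: (meval_pschur i j (Adet z z0)); rewrite (AF z Gz).
have -> : F z i j = meval z (P i j) / meval z p by rewrite mxE.
move: (pschur A i j) (pdelta A) => x y xE; rewrite [LHS]mevalM [RHS]mevalM xE.
by move: (meval z p) pz => pz' pz; field.
Qed.

End Converse.

Theorem mainTheorem1 (R : realType) (d n : nat) (hd : (0 < d)%N) (hn : (0 < n)%N)
    (f : 'M[ratfun R d]_n) :
  bessmertnyi f <->
  [/\ rat_herglotz_agler f, homogeneous1 f & rat_cayley_inner f].
Proof.
split; first exact: bessmertnyi_forward.
by move=> [HA hom inner]; exact: bessmertnyi_converse.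
Qed.
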